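(* Let $k\ge 2$ be a fixed integer. There is a fully polynomial-time approximation scheme for the $k$-Subset Sum Ratio problem ($k$-SSR) that runs in $\widetilde{O}(n/\varepsilon^{3k-1})$ time, where $n$ is the number of input integers, $\varepsilon\in(0,1)$ is the error parameter, and $\widetilde{O}$ hides $\mathrm{polylog}(1/\varepsilon)$ factors. That is, given a multiset $A=\{a_1,\dots,a_n\}$ of positive integers and $\varepsilon\in(0,1)$, it returns $k$ pairwise disjoint subsets $S_1,\dots,S_k\subseteq[n]$ whose ratio is at most $(1+\varepsilon)$ times the minimum ratio over all $k$-tuples of pairwise disjoint subsets of $[n]$.
   Context: $[n]=\{1,\dots,n\}$. The input multiset $A$ is assumed sorted, $a_1\le\dots\le a_n$. For $S\subseteq[n]$ let $\Sigma(S,A)=\sum_{i\in S}a_i$. For pairwise disjoint $S_1,\dots,S_k\subseteq[n]$ the ratio $\mathcal{R}(S_1,\dots,S_k,A)$ is $\max_i\Sigma(S_i,A)/\min_i\Sigma(S_i,A)$ if $\min_i\Sigma(S_i,A)>0$ and $+\infty$ otherwise. $k$-SSR: given $A$, find $k$ pairwise disjoint subsets of $[n]$ minimizing the ratio. *)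

(* Defs.v *)
From Stdlib Require Import ZArith QArith List Sorting.Sorted.
Import ListNotations.
Open Scope Z_scope.

(* Indices are 0-based: element i < n of [A] is a_{i+1}.  A "subset of [n]"
   is a boolean predicate on indices; only indices i < n are ever looked at. *)

Definition subset_sum (A : list Z) (S : nat -> bool) : Z :=
  fold_right Z.add 0
    (map (fun i => if S i then nth i A 0 else 0) (seq 0 (length A))).

Definition pairwise_disjoint (k n : nat) (S : nat -> nat -> bool) : Prop :=
  forall j1 j2 i, (j1 < k)%nat -> (j2 < k)%nat -> j1 <> j2 -> (i < n)%nat ->
    S j1 i = false \/ S j2 i = false.

Definition sums (k : nat) (A : list Z) (S : nat -> nat -> bool) : list Z :=
  map (fun j => subset_sum A (S j)) (seq 0 k).

Definition max_sum (k : nat) (A : list Z) S : Z :=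
  fold_right Z.max (hd 0 (sums k A S)) (sums k A S).
Definition min_sum (k : nat) (A : list Z) S : Z :=
  fold_right Z.min (hd 0 (sums k A S)) (sums k A S).

(* R(S_1..S_k, A): Some (max/min) if min > 0, None encodes +infinity. *)
Definition ratio (k : nat) (A : list Z) (S : nat -> nat -> bool) : option Q :=
  if 0 <? min_sum k A S
  then Some (inject_Z (max_sum k A S) / inject_Z (min_sum k A S))%Q
  else None.

Definition ext_le_scaled (r1 : option Q) (f : Q) (r2 : option Q) : Prop :=
  match r2 with
  | None => True
  | Some y => match r1 with Some x => (x <= f * y)%Q | None => False end
  end.

Definition approx_solution (k : nat) (A : list Z) (p q : Z)
  (S : nat -> nat -> bool) : Prop :=
  pairwise_disjoint k (length A) S /\
  forall T, pairwise_disjoint k (length A) T ->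
    ext_le_scaled (ratio k A S) (1 + inject_Z p / inject_Z q)%Q (ratio k A T).

(* Memory: infinitely many integer cells (nat -> Z), all 0 initially except the
   input.  Registers are memory cells addressed by constants in instructions;
   Load/Store give indirect addressing. *)
Inductive instr : Type :=
| IConst (d : nat) (z : Z)
| IAdd (d a b : nat)
| ISub (d a b : nat)
| IMul (d a b : nat)
| IDiv (d a b : nat)                (* Z.div, x/0 = 0 *)
| IMod (d a b : nat)
| ILoad (d a : nat)
| IStore (a s : nat)
| IJlt (a b : nat) (t : nat)
| IJmp (t : nat)
| IHalt.

Definition program := list instr.

Record state := mkState { pc : nat; mem : nat -> Z }.

Definition upd (m : nat -> Z) (a : nat) (v : Z) : nat -> Z :=
  fun x => if Nat.eqb x a then v else m x.

Definition bits (z : Z) : Z := Z.log2 (Z.abs z) + 1.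

(* Cost of an instruction touching values vs, with word size w: operations on
   b-bit numbers cost ceil(b/w)^2 (at least 1): unit cost on word-size numbers,
   multi-precision (schoolbook) cost otherwise. This prevents unit-cost
   arithmetic on huge integers. *)
Definition op_cost (w : Z) (vs : list Z) : Z :=
  let b := fold_right Z.max 0 (map bits vs) in
  let m := (b + w - 1) / w in
  Z.max 1 m * Z.max 1 m.

Definition arith (w : Z) (s : state) (d a b : nat) (f : Z -> Z -> Z)
  : state * Z :=
  let x := mem s a in let y := mem s b in let r := f x y in
  (mkState (S (pc s)) (upd (mem s) d r), op_cost w [x; y; r]).

Definition step (w : Z) (prog : program) (s : state) : option (state * Z) :=
  match nth_error prog (pc s) with
  | None => None
  | Some IHalt => None
  | Some (IConst d z) => Some (mkState (S (pc s)) (upd (mem s) d z), op_cost w [z])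
  | Some (IAdd d a b) => Some (arith w s d a b Z.add)
  | Some (ISub d a b) => Some (arith w s d a b Z.sub)
  | Some (IMul d a b) => Some (arith w s d a b Z.mul)
  | Some (IDiv d a b) => Some (arith w s d a b Z.div)
  | Some (IMod d a b) => Some (arith w s d a b Z.modulo)
  | Some (ILoad d a) =>
      let ad := mem s a in let v := mem s (Z.to_nat ad) in
      Some (mkState (S (pc s)) (upd (mem s) d v), op_cost w [ad; v])
  | Some (IStore a src) =>
      let ad := mem s a in let v := mem s src in
      Some (mkState (S (pc s)) (upd (mem s) (Z.to_nat ad) v), op_cost w [ad; v])
  | Some (IJlt a b t) =>
      let x := mem s a in let y := mem s b in
      Some (mkState (if x <? y then t else S (pc s)) (mem s), op_cost w [x; y])
  | Some (IJmp t) => Some (mkState t (mem s), 1)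
  end.

Fixpoint run (w : Z) (prog : program) (fuel : nat) (s : state)
  : option (state * Z) :=
  match step w prog s with
  | None => Some (s, 0)
  | Some (s', c) =>
      match fuel with
      | O => None
      | S f => match run w prog f s' with
               | Some (s'', c') => Some (s'', c + c')
               | None => None
               end
      end
  end.

Definition init_state (A : list Z) (p q : Z) : state :=
  mkState 0 (fun x =>
    match x with
    | O => Z.of_nat (length A)
    | 1%nat => p
    | 2%nat => q
    | S (S (S i)) => nth i A 0
    end).

Definition word_size (A : list Z) (q : Z) : Z :=
  bits (fold_right Z.max (Z.max (Z.of_nat (length A)) q) A).

(* Output encoding: M[3+n+i] = j+1 means element i is put in subset j (j < k);
   any other value means i is in no subset. *)
Definition decode_output (n : nat) (s : state) : nat -> nat -> bool :=
  fun j i => Z.eqb (mem s (3 + n + i)) (Z.of_nat (S j)).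

(* Main.v *)
Require Import Defs.
From Stdlib Require Import ZArith QArith List Sorting.Sorted Lia FinFun.
Import ListNotations.
Open Scope Z_scope.

(* If some [k] consecutive elements of the sorted sequence lie within a factor
   [1 + eps], their singletons are a solution.  Otherwise the sequence doubles
   every [O(k / eps)] indices, so that among the elements up to a given one, all
   but the last [O(log(1/eps) / eps)] are negligible in total.

   Take an optimal solution and let [m] be its least sum.  Elements can be
   dropped from every other set until its sum is below [2 m], or until the set
   is a singleton [>= m].  If [h] is the last index with an element below [m],
   these large singletons may be replaced by the elements [h+1], [h+2], and so
   on.  The remaining sets are made of elements of index at most [h] and have
   sums of the order of a power of two [z]; only a window of
   [O(log(1/eps) / eps)] elements below [h] matters for them.  For all [h], and
   for the [O(log(1/eps))] scales [z] compatible with [h], a dynamic program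
   runs over the [k]-tuples of sums rounded down to multiples of about
   [eps z / window], keeping one exact representative of every reachable tuple.
   Its [O~(eps^(-2k))] nodes times the [O~(1/eps)] window elements give
   [O~(n eps^(-(2k+1)))] in total, and [2k + 1 <= 3k - 1] since [k >= 2].
   Candidates are compared by their exact sums, so rounding only affects which
   of them are considered.

   The algorithm is written in a small while language and compiled to the word
   RAM.  All numbers it handles have [O(w)] bits, so the cost of a run is
   proportional to the number of commands executed. *)

(** * A while language over the word RAM *)

(** Write [eps = p/q]; the integer [E = q / p + 1] plays the role of [1/eps]. The tolerance is spent
    as follows: restricting a set to the window costs at most [eps*m/10], the rounding of the
    dynamic program at most [eps*m/5] in either direction, and
    [(1 + eps/5) / (1 - 3*eps/10) <= 1 + eps]. This fixes [20*k*E*E <= 2^l], the window [N = l*k*E]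
    and the number [L = 40*N*E] of buckets per sum.

    The singletons are not part of the dynamic program: a node is completed afterwards, according to
    which of its sums are zero. An approximate sum must therefore be zero exactly when the intended
    set is empty, a condition carried through all statements about rounding.

    Linearity in [n] forbids clearing an array of length [n] whenever a better solution is found.
    Nodes and labels carry stamps from one growing counter, so outdated entries expire by
    themselves.

    Correctness is stated for arbitrary bounds [U / V]: the recorded ratio is at most every bound
    that some candidate satisfies. No optimal solution has to be singled out, since each competitor
    yields such a candidate. *)

Inductive binop : Type := Add | Sub | Mul | Div.

Inductive expr : Type :=
| Cst (z : Z)
| Var (x : nat)
| Arr (b : nat) (e : expr)
| Bin (o : binop) (e1 e2 : expr).

Inductive cmd : Type :=
| Asg (x : nat) (e : expr)
| Sto (b : nat) (e1 e2 : expr)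
| Rld (x y : nat)
| Rst (y x : nat)
| Seq (c1 c2 : cmd)
| Ifl (e1 e2 : expr) (c : cmd)
| Whl (e1 e2 : expr) (c : cmd).

(** [raw] is the part of RAM memory that keeps its own addresses, so that the input can be read and
    the output written where the encoding puts them. Arrays live at addresses the language cannot
    name. *)
Record st := mkSt { rg : nat -> Z; ar : nat -> Z -> Z; raw : Z -> Z }.

Definition setr (s : st) (x : nat) (v : Z) : st :=
  mkSt (fun y => if Nat.eqb y x then v else rg s y) (ar s) (raw s).
Definition seta (s : st) (b : nat) (i v : Z) : st :=
  mkSt (rg s)
    (fun b' => if Nat.eqb b' b then fun i' => if i' =? i then v else ar s b i' else ar s b')
    (raw s).
Definition setraw (s : st) (i v : Z) : st :=
  mkSt (rg s) (ar s) (fun i' => if i' =? i then v else raw s i').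

Definition evop (o : binop) : Z -> Z -> Z :=
  match o with Add => Z.add | Sub => Z.sub | Mul => Z.mul | Div => Z.div end.

Fixpoint ev (e : expr) (s : st) : Z :=
  match e with
  | Cst z => z
  | Var x => rg s x
  | Arr b e => ar s b (ev e s)
  | Bin o e1 e2 => evop o (ev e1 s) (ev e2 s)
  end.

(** A negative index would address cells below the arrays, where registers, scratch cells and input
    lie. *)
Fixpoint ok (e : expr) (s : st) : Prop :=
  match e with
  | Cst _ | Var _ => True
  | Arr _ e => ok e s /\ 0 <= ev e s
  | Bin _ e1 e2 => ok e1 s /\ ok e2 s
  end.

(* [Y] bounds every stored value; [lo, hi) is the part of memory reachable by
   the raw accesses. *)
Inductive exec (Y lo hi : Z) : cmd -> st -> st -> Z -> Prop :=
| exAsg x e s : ok e s -> Z.abs (ev e s) <= Y ->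
    exec Y lo hi (Asg x e) s (setr s x (ev e s)) 1
| exSto b e1 e2 s : ok e1 s -> ok e2 s -> 0 <= ev e1 s -> Z.abs (ev e2 s) <= Y ->
    exec Y lo hi (Sto b e1 e2) s (seta s b (ev e1 s) (ev e2 s)) 1
| exRld x y s : lo <= rg s y < hi ->
    exec Y lo hi (Rld x y) s (setr s x (raw s (rg s y))) 1
| exRst x y s : lo <= rg s y < hi ->
    exec Y lo hi (Rst y x) s (setraw s (rg s y) (rg s x)) 1
| exSeq c1 c2 s s1 s2 u1 u2 :
    exec Y lo hi c1 s s1 u1 -> exec Y lo hi c2 s1 s2 u2 ->
    exec Y lo hi (Seq c1 c2) s s2 (u1 + u2)
| exIflT e1 e2 c s s' u : ok e1 s -> ok e2 s -> ev e1 s < ev e2 s ->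
    exec Y lo hi c s s' u -> exec Y lo hi (Ifl e1 e2 c) s s' (1 + u)
| exIflF e1 e2 c s : ok e1 s -> ok e2 s -> ev e2 s <= ev e1 s ->
    exec Y lo hi (Ifl e1 e2 c) s s 1
| exWhlF e1 e2 c s : ok e1 s -> ok e2 s -> ev e2 s <= ev e1 s ->
    exec Y lo hi (Whl e1 e2 c) s s 1
| exWhlT e1 e2 c s s1 s2 u1 u2 : ok e1 s -> ok e2 s -> ev e1 s < ev e2 s ->
    exec Y lo hi c s s1 u1 -> exec Y lo hi (Whl e1 e2 c) s1 s2 u2 ->
    exec Y lo hi (Whl e1 e2 c) s s2 (1 + u1 + u2).

(** * Compilation to the word RAM *)

(** Memory layout: cell 0 holds the address [base] of the arrays, cells 1 to 40 the variables, cells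
    41 to 60 an evaluation stack. Cells from 61 up to [base] excluded are the raw area. From [base]
    on, the eight arrays are interleaved with stride 8, which lets each of them be unbounded. *)
Definition nV : nat := 40.
Definition nA : nat := 8.
Definition nR : nat := 61.
Definition zA : Z := 8.
Definition zR : Z := 61.

Definition vc (x : nat) : nat := S x.
Definition sc (d : nat) : nat := (41 + d)%nat.

Definition caddr (b d : nat) : list instr :=
  [IConst (sc (S d)) zA; IMul (sc d) (sc d) (sc (S d)); IAdd (sc d) (sc d) 0;
   IConst (sc (S d)) (Z.of_nat b); IAdd (sc d) (sc d) (sc (S d))].

Definition iop (o : binop) : nat -> nat -> nat -> instr :=
  match o with Add => IAdd | Sub => ISub | Mul => IMul | Div => IDiv end.

(** The value is left in [sc d], and only stack cells from [sc d] on are touched. There is no move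
    instruction: a variable is copied by adding 0. *)
Fixpoint ce (d : nat) (e : expr) : list instr :=
  match e with
  | Cst z => [IConst (sc d) z]
  | Var x => [IConst (sc (S d)) 0; IAdd (sc d) (vc x) (sc (S d))]
  | Arr b e => ce d e ++ caddr b d ++ [ILoad (sc d) (sc d)]
  | Bin o e1 e2 => ce d e1 ++ ce (S d) e2 ++ [iop o (sc d) (sc d) (sc (S d))]
  end.

Fixpoint clen (c : cmd) : nat :=
  match c with
  | Asg x e => length (ce 0 e) + 2
  | Sto b e1 e2 => length (ce 0 e1) + 5 + length (ce 1 e2) + 1
  | Rld _ _ | Rst _ _ => 1
  | Seq c1 c2 => clen c1 + clen c2
  | Ifl e1 e2 c => length (ce 0 e1) + length (ce 1 e2) + 2 + clen c
  | Whl e1 e2 c => length (ce 0 e1) + length (ce 1 e2) + 2 + clen c + 1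
  end.

Fixpoint cc (pc : nat) (c : cmd) : list instr :=
  match c with
  | Asg x e => ce 0 e ++ [IConst (sc 1) 0; IAdd (vc x) (sc 0) (sc 1)]
  | Sto b e1 e2 => ce 0 e1 ++ caddr b 0 ++ ce 1 e2 ++ [IStore (sc 0) (sc 1)]
  | Rld x y => [ILoad (vc x) (vc y)]
  | Rst y x => [IStore (vc y) (vc x)]
  | Seq c1 c2 => cc pc c1 ++ cc (pc + clen c1) c2
  | Ifl e1 e2 c =>
      let a := (pc + length (ce 0 e1) + length (ce 1 e2) + 2)%nat in
      ce 0 e1 ++ ce 1 e2 ++ [IJlt (sc 0) (sc 1) a; IJmp (a + clen c)] ++ cc a c
  | Whl e1 e2 c =>
      let a := (pc + length (ce 0 e1) + length (ce 1 e2) + 2)%nat in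
      ce 0 e1 ++ ce 1 e2 ++ [IJlt (sc 0) (sc 1) a; IJmp (a + clen c + 1)]
      ++ cc a c ++ [IJmp pc]
  end.

Lemma length_cc c : forall pc, length (cc pc c) = clen c.
Proof.
  induction c; intros pc; cbn [cc clen]; repeat rewrite ?length_app, ?IHc1, ?IHc2, ?IHc;
    cbn [length caddr]; lia.
Qed.

(** An exponent such that everything computed while evaluating [e] stays within [Y ^ dg e]. An array
    read yields a stored value, but its address is computed on the way; the [+ 3] pays for that. *)
Fixpoint dg (e : expr) : nat :=
  match e with
  | Cst _ | Var _ => 1
  | Arr _ e => dg e + 3
  | Bin Mul e1 e2 => dg e1 + dg e2
  | Bin _ e1 e2 => Nat.max (dg e1) (dg e2) + 1
  end.

(** The depth limit 15 keeps the stack below cell [nR]. *)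
Fixpoint wfe (Y : Z) (d : nat) (e : expr) : Prop :=
  (d <= 15)%nat /\
  match e with
  | Cst z => Z.abs z <= Y
  | Var x => (x < nV)%nat
  | Arr b e => (b < nA)%nat /\ wfe Y d e
  | Bin _ e1 e2 => wfe Y d e1 /\ wfe Y (S d) e2
  end.

Definition maxdg : nat := 40.

Fixpoint wfc (Y : Z) (c : cmd) : Prop :=
  match c with
  | Asg x e => (x < nV)%nat /\ wfe Y 0 e /\ (dg e <= maxdg)%nat
  | Sto b e1 e2 => (b < nA)%nat /\ wfe Y 0 e1 /\ (dg e1 + 3 <= maxdg)%nat
                   /\ wfe Y 1 e2 /\ (dg e2 <= maxdg)%nat
  | Rld x y | Rst y x => (x < nV)%nat /\ (y < nV)%nat
  | Seq c1 c2 => wfc Y c1 /\ wfc Y c2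
  | Ifl e1 e2 c | Whl e1 e2 c => wfe Y 0 e1 /\ wfe Y 1 e2 /\ (dg e1 <= maxdg)%nat /\ (dg e2 <= maxdg)%nat
                   /\ wfc Y c
  end.

(** * Runs of the RAM with a bound on their cost *)

Inductive star (w : Z) (prog : program) : state -> state -> Z -> Prop :=
| star0 s : star w prog s s 0
| starS s s1 s2 c1 c2 : step w prog s = Some (s1, c1) -> star w prog s1 s2 c2 ->
    star w prog s s2 (c1 + c2).

Lemma star_run w prog s s' c : star w prog s s' c -> step w prog s' = None ->
  exists fuel, run w prog fuel s = Some (s', c).
Proof.
  induction 1 as [s|s s1 s2 c1 c2 H H1 IH]; intros Hn.
  - exists O. cbn. now rewrite Hn.
  - destruct (IH Hn) as [f Hf]. exists (S f). cbn. now rewrite H, Hf.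
Qed.

Definition reach w prog s s' C := exists c, star w prog s s' c /\ c <= C.

Lemma reach_refl w prog s C : 0 <= C -> reach w prog s s C.
Proof. intros; exists 0; split; [constructor|easy]. Qed.

Lemma reach_trans w prog s1 s2 s3 C1 C2 C :
  reach w prog s1 s2 C1 -> reach w prog s2 s3 C2 -> C1 + C2 <= C -> reach w prog s1 s3 C.
Proof.
  intros [c1 [H1 L1]] [c2 [H2 L2]] L. exists (c1 + c2); split; [|lia].
  clear L1 L. induction H1 as [|? ? ? ? ? Hs H1 IH]; [easy|].
  rewrite <- Z.add_assoc. econstructor; eauto.
Qed.

Lemma reach_step w prog s s' c C : step w prog s = Some (s', c) -> c <= C ->
  reach w prog s s' C.
Proof.
  intros H L. exists (c + 0). split; [|lia]. econstructor; [exact H|constructor].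
Qed.

Lemma reach_weak w prog s s' C C' : reach w prog s s' C -> C <= C' -> reach w prog s s' C'.
Proof. intros [c [H L]] L'. exists c. split; [easy|lia]. Qed.

Definition code_at (prog : program) (pc : nat) (code : list instr) :=
  exists pre post, prog = pre ++ code ++ post /\ length pre = pc.

Lemma code_at_app prog pc c1 c2 : code_at prog pc (c1 ++ c2) ->
  code_at prog pc c1 /\ code_at prog (pc + length c1) c2.
Proof.
  intros [pre [post [-> <-]]]. split.
  - exists pre, (c2 ++ post). now rewrite <- app_assoc.
  - exists (pre ++ c1), post. rewrite length_app, <- !app_assoc. easy.
Qed.

Lemma code_at_cons prog pc i c : code_at prog pc (i :: c) ->
  nth_error prog pc = Some i /\ code_at prog (S pc) c.
Proof.
  intros [pre [post [-> <-]]]. split.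
  - rewrite nth_error_app2 by lia. now rewrite Nat.sub_diag.
  - exists (pre ++ [i]), post. rewrite length_app, <- app_assoc. split; [easy|cbn; lia].
Qed.

(** * Simulation of commands by their compiled code *)

Section Sim.
Variables (w : Z) (prog : program) (Y base B kap : Z).
Hypothesis HY : 10 <= Y.
Hypothesis Hbase : zR <= base <= Y.
Hypothesis HB : forall d, (d <= maxdg)%nat -> Y ^ Z.of_nat d <= B.
Hypothesis Hkap : forall vs, Forall (fun v => Z.abs v <= B) vs -> op_cost w vs <= kap.

Lemma kap_pos : 1 <= kap.
Proof.
  clear - Hkap. specialize (Hkap [] (Forall_nil _)). unfold op_cost in Hkap.
  set (m := (_ + w - 1) / w) in *. cbn zeta in *. nia.
Qed.

Lemma Y_le_B : Y <= B.
Proof.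
  rewrite <- (Z.pow_1_r Y) at 1. apply (HB 1). unfold maxdg; lia.
Qed.

Definition Rel (s : st) (m : nat -> Z) : Prop :=
  m O = base /\ (forall x, (x < nV)%nat -> m (vc x) = rg s x) /\
  (forall b i, (b < nA)%nat -> 0 <= i -> m (Z.to_nat (base + zA * i + Z.of_nat b)) = ar s b i) /\
  (forall i, zR <= i < base -> m (Z.to_nat i) = raw s i).

Definition bs (s : st) : Prop :=
  (forall x, (x < nV)%nat -> Z.abs (rg s x) <= Y) /\
  (forall b i, (b < nA)%nat -> 0 <= i -> Z.abs (ar s b i) <= Y) /\
  (forall i, zR <= i < base -> Z.abs (raw s i) <= Y).

(** Evaluation at depth [d] may disturb only the stack from [sc d] on. This protects left operands
    already computed at smaller depth, and at depth 0 it protects everything [Rel] speaks of. *)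
Definition same (d : nat) (m m' : nat -> Z) : Prop :=
  forall a, (a < sc d)%nat \/ (nR <= a)%nat -> m' a = m a.

Lemma same_refl d m : same d m m. Proof. intros a _; reflexivity. Qed.
Lemma same_trans d m m' m'' : same d m m' -> same d m' m'' -> same d m m''.
Proof. intros H1 H2 a Ha. now rewrite H2, H1. Qed.
Lemma same_S d m m' : same (S d) m m' -> same d m m'.
Proof. intros H a Ha. apply H. unfold sc in *. lia. Qed.
Lemma same_upd d d' m v : (d <= d' < 20)%nat -> same d m (upd m (sc d') v).
Proof.
  intros Hd a Ha. unfold upd. destruct (Nat.eqb_spec a (sc d')); [|easy].
  unfold sc, nR in *. lia.
Qed.

Lemma Rel_same s m m' : Rel s m -> same 0 m m' -> Rel s m'.
Proof.
  intros (H0 & Hv & Ha & Hr) Hs. unfold Rel. repeat split.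
  - rewrite Hs; [easy|unfold sc; lia].
  - intros x Hx. rewrite Hs; [now apply Hv|]. unfold vc, sc, nV in *; lia.
  - intros b i Hb Hi. rewrite Hs; [now apply Ha|]. right. unfold nR, zR, zA in *; lia.
  - intros i Hi. rewrite Hs; [now apply Hr|]. right. unfold nR, zR in *; lia.
Qed.

Lemma upd_same m a v : upd m a v a = v.
Proof. unfold upd. now rewrite Nat.eqb_refl. Qed.
Lemma upd_diff m a v b : b <> a -> upd m a v b = m b.
Proof. intros H. unfold upd. apply Nat.eqb_neq in H. now rewrite H. Qed.

Ltac fb := cbv beta; repeat (apply Forall_nil || (apply Forall_cons; [assumption|])).

Lemma r_const pc m d z : nth_error prog pc = Some (IConst d z) -> Z.abs z <= B ->
  reach w prog (mkState pc m) (mkState (S pc) (upd m d z)) kap.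
Proof. intros H Hz. eapply reach_step; [unfold step; cbn; now rewrite H|]. apply Hkap; fb. Qed.

Lemma r_op o pc m d a b : nth_error prog pc = Some (iop o d a b) ->
  Z.abs (m a) <= B -> Z.abs (m b) <= B -> Z.abs (evop o (m a) (m b)) <= B ->
  reach w prog (mkState pc m) (mkState (S pc) (upd m d (evop o (m a) (m b)))) kap.
Proof.
  intros H ? ? ?.
  apply (reach_step _ _ _ _ (op_cost w [m a; m b; evop o (m a) (m b)])); [|apply Hkap; fb].
  unfold step; cbn; rewrite H. destruct o; reflexivity.
Qed.
Lemma r_load pc m d a : nth_error prog pc = Some (ILoad d a) ->
  Z.abs (m a) <= B -> Z.abs (m (Z.to_nat (m a))) <= B ->
  reach w prog (mkState pc m) (mkState (S pc) (upd m d (m (Z.to_nat (m a))))) kap.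
Proof. intros H ? ?. eapply reach_step; [unfold step; cbn; rewrite H; reflexivity|]. apply Hkap; fb. Qed.
Lemma r_store pc m a b : nth_error prog pc = Some (IStore a b) ->
  Z.abs (m a) <= B -> Z.abs (m b) <= B ->
  reach w prog (mkState pc m) (mkState (S pc) (upd m (Z.to_nat (m a)) (m b))) kap.
Proof. intros H ? ?. eapply reach_step; [unfold step; cbn; rewrite H; reflexivity|]. apply Hkap; fb. Qed.
Lemma r_jlt pc m a b t : nth_error prog pc = Some (IJlt a b t) ->
  Z.abs (m a) <= B -> Z.abs (m b) <= B ->
  reach w prog (mkState pc m) (mkState (if m a <? m b then t else S pc) m) kap.
Proof. intros H ? ?. eapply reach_step; [unfold step; cbn; rewrite H; reflexivity|]. apply Hkap; fb. Qed.
Lemma r_jmp pc m t : nth_error prog pc = Some (IJmp t) ->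
  reach w prog (mkState pc m) (mkState t m) kap.
Proof. intros H. eapply reach_step; [unfold step; cbn; rewrite H; reflexivity|]. apply kap_pos. Qed.

Lemma abs_div_le x y : Z.abs (x / y) <= Z.abs x.
Proof.
  destruct (Z.eq_dec y 0) as [->|Hy]; [rewrite Zdiv_0_r; lia|].
  pose proof (Z.div_mod x y Hy). pose proof (Z.mod_neg_bound x y). pose proof (Z.mod_pos_bound x y).
  destruct (Z_lt_le_dec y 0); nia.
Qed.

Definition pw (d : nat) : Z := Y ^ Z.of_nat d.
Lemma pw1 : pw 1 = Y. Proof. unfold pw. apply Z.pow_1_r. Qed.
Lemma pw_add a b : pw (a + b) = pw a * pw b.
Proof. unfold pw. rewrite Nat2Z.inj_add. apply Z.pow_add_r; lia. Qed.
Lemma pw_mono a b : (a <= b)%nat -> pw a <= pw b.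
Proof. intros. apply Z.pow_le_mono_r; lia. Qed.
Lemma pw_pos a : 1 <= pw a.
Proof. change 1 with (pw 0). apply pw_mono. lia. Qed.
Lemma pw_B a : (a <= maxdg)%nat -> pw a <= B.
Proof. exact (HB a). Qed.

Lemma pw3_large : 1000 <= pw 3 /\ 100 * Y <= pw 3.
Proof.
  replace (pw 3) with (Y * Y * Y) by (unfold pw; change (Z.of_nat 3) with 3; ring). nia.
Qed.

Lemma dg_pos e : (1 <= dg e)%nat.
Proof. induction e; cbn; try destruct o; lia. Qed.

(** Degrees add under multiplication; one extra factor [Y >= 2] absorbs a sum or difference of two
    terms; floor division does not increase absolute values. *)
Lemma ev_bound e : forall s d, bs s -> wfe Y d e -> ok e s -> Z.abs (ev e s) <= pw (dg e).
Proof.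
  induction e; intros s d Hb [Hd Hw] Ho; cbn [ev dg ok wfe] in *.
  - now rewrite pw1.
  - rewrite pw1. now apply Hb.
  - destruct Hb as (_ & Hb & _). transitivity Y; [now apply Hb|].
    rewrite <- pw1 at 1. apply pw_mono; lia.
  - destruct Hw as [W1 W2], Ho as [O1 O2].
    specialize (IHe1 _ _ Hb W1 O1). specialize (IHe2 _ _ Hb W2 O2).
    pose proof (pw_mono (dg e1) (Nat.max (dg e1) (dg e2)) ltac:(lia)).
    pose proof (pw_mono (dg e2) (Nat.max (dg e1) (dg e2)) ltac:(lia)).
    pose proof (abs_div_le (ev e1 s) (ev e2 s)).
    pose proof (pw_pos (Nat.max (dg e1) (dg e2))).
    destruct o; cbn [evop]; rewrite pw_add, ?pw1, ?Z.abs_mul; [nia|nia| |nia].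
    apply Z.mul_le_mono_nonneg; lia.
Qed.

Definition adr (b : nat) (i : Z) : Z := base + zA * i + Z.of_nat b.

Lemma sim_addr b d pc m g :
  code_at prog pc (caddr b d) -> (d <= 15)%nat -> (b < nA)%nat ->
  m O = base -> (1 <= g)%nat -> (g + 3 <= maxdg)%nat -> Z.abs (m (sc d)) <= pw g ->
  exists m', reach w prog (mkState pc m) (mkState (pc + 5) m') (5 * kap) /\
    m' (sc d) = adr b (m (sc d)) /\ same d m m'.
Proof.
  intros Hc Hd Hb H0 Hg Hg3 Hi. unfold caddr in Hc.
  repeat (apply code_at_cons in Hc; destruct Hc as [? Hc]).
  pose proof (pw_B _ Hg3) as HPB. rewrite pw_add in HPB.
  pose proof pw3_large as HP3.
  pose proof (pw_pos g).
  (* The three spare degrees give a factor [Y ^ 3 >= 1000], ample room for [base + 8 * i + b]. *)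
  assert (HG : 1000 * pw g <= B /\ 100 * Y <= B) by nia.
  clear HPB HP3.
  assert (Hb' : 0 <= Z.of_nat b < 8) by (unfold nA in Hb; lia).
  set (v := m (sc d)) in *.
  unfold zR, zA in *.
  eexists. split; [|split].
  - refine (reach_trans _ _ _ _ _ kap (4 * kap) _ _ _ _); [eapply r_const; [eassumption|nia]| |lia].
    refine (reach_trans _ _ _ _ _ kap (3 * kap) _ _ _ _); [eapply (r_op Mul); [eassumption| | |]| |lia]; cbn [evop];
      rewrite ?upd_same, ?(upd_diff _ _ _ (sc d)) by (unfold sc; lia); fold v; try nia.
    refine (reach_trans _ _ _ _ _ kap (2 * kap) _ _ _ _); [eapply (r_op Add); [eassumption| | |]| |lia]; cbn [evop];
      rewrite ?upd_same, ?(upd_diff _ _ _ O) by (unfold sc; lia); rewrite ?H0; try nia.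
    refine (reach_trans _ _ _ _ _ kap (1 * kap) _ _ _ _); [eapply r_const; [eassumption|nia]| |lia].
    rewrite Z.mul_1_l. replace (pc + 5)%nat with (S (S (S (S (S pc))))) by lia.
    eapply (r_op Add); [eassumption| | |]; cbn [evop];
      rewrite ?upd_same, ?(upd_diff _ _ _ (sc d)) by (unfold sc; lia);
      rewrite ?upd_same; try nia.
  - rewrite upd_same. rewrite ?upd_same, ?(upd_diff _ _ _ (sc d)) by (unfold sc; lia).
    rewrite ?upd_same. cbn [evop]. unfold adr, zA. lia.
  - repeat (eapply same_trans; [|apply same_upd; lia]). apply same_refl.
Qed.

Lemma sim_e e : forall d pc s m,
  code_at prog pc (ce d e) -> wfe Y d e -> (dg e <= maxdg)%nat -> bs s -> ok e s -> Rel s m ->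
  exists m', reach w prog (mkState pc m) (mkState (pc + length (ce d e)) m')
               (Z.of_nat (length (ce d e)) * kap) /\
    m' (sc d) = ev e s /\ same d m m'.
Proof.
  induction e; intros d pc s m Hc Hw Hdg Hb Ho HR.
  - apply code_at_cons in Hc. destruct Hc as [C _]. destruct Hw as [Hd Hz].
    exists (upd m (sc d) z). cbn [ce length ev]. split; [|split].
    + rewrite Nat.add_1_r. change (Z.of_nat 1) with 1. rewrite Z.mul_1_l.
      apply r_const; [easy|]. pose proof Y_le_B. lia.
    + apply upd_same.
    + apply same_upd; lia.
  - cbn [ce] in Hc. repeat (apply code_at_cons in Hc; destruct Hc as [? Hc]).
    destruct Hw as [Hd Hz].
    assert (Hx : m (vc x) = rg s x) by now apply HR.
    exists (upd (upd m (sc (S d)) 0) (sc d) (rg s x)). cbn [ce length ev]. split; [|split].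
    + refine (reach_trans _ _ _ _ _ kap kap _ _ _ _);
        [eapply r_const; [eassumption|pose proof Y_le_B; lia]| |lia].
      replace (pc + 2)%nat with (S (S pc)) by lia.
      replace (rg s x) with (upd m (sc (S d)) 0 (vc x) + upd m (sc (S d)) 0 (sc (S d))).
      2:{ rewrite upd_same, upd_diff, Hx by (unfold nV, vc, sc in *; lia). lia. }
      pose proof Y_le_B. destruct Hb as [Hb _]. specialize (Hb x Hz).
      apply (r_op Add); [easy|..]; cbn [evop]; rewrite ?upd_same, ?(upd_diff _ _ _ (vc x)), ?Hx
        by (unfold nV, vc, sc in *; lia); lia.
    + apply upd_same.
    + eapply same_trans; [|apply same_upd; lia]. apply same_upd; lia.
  - cbn [ce] in Hc. destruct Hw as [Hd [Hb' Hw]]. destruct Ho as [Ho Hi]. cbn [dg] in Hdg.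
    apply code_at_app in Hc. destruct Hc as [C1 Hc].
    apply code_at_app in Hc. destruct Hc as [C2 Hc].
    apply code_at_cons in Hc. destruct Hc as [C3 _].
    destruct (IHe d pc s m C1 Hw ltac:(lia) Hb Ho HR) as (m1 & R1 & E1 & S1).
    assert (HR1 : Rel s m1).
    { eapply Rel_same; [exact HR|]. intros a Ha. apply S1. unfold sc in *; lia. }
    pose proof (ev_bound e s d Hb Hw Ho) as Hbe.
    assert (Hb1 : m1 O = base) by apply HR1.
    destruct (sim_addr b d _ m1 (dg e) C2 Hd Hb' Hb1 (dg_pos e) Hdg ltac:(now rewrite E1))
      as (m2 & R2 & E2 & S2).
    assert (HR2 : Rel s m2).
    { eapply Rel_same; [exact HR1|]. intros a Ha. apply S2. unfold sc in *; lia. }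
    assert (E3 : m2 (Z.to_nat (m2 (sc d))) = ar s b (ev e s)).
    { rewrite E2, E1. now apply HR2. }
    exists (upd m2 (sc d) (ar s b (ev e s))). cbn [ce ev]. rewrite !length_app. cbn [length caddr].
    split; [|split].
    + eapply reach_trans; [exact R1| |].
      * eapply reach_trans; [exact R2| |apply Z.le_refl].
        replace (pc + (length (ce d e) + (5 + 1)))%nat with (S (pc + length (ce d e) + 5)) by lia.
        rewrite <- E3. apply r_load; [exact C3| |].
        -- rewrite E2, E1. unfold adr. pose proof (pw_B _ Hdg) as HPB.
           rewrite pw_add in HPB. pose proof (pw_pos (dg e)).
           pose proof pw3_large.
           unfold zR, zA, nA in *.
           assert (100 * Y <= B) by nia. assert (1000 * pw (dg e) <= B) by nia. lia.
        -- rewrite E3. destruct Hb as (_ & Hb & _). specialize (Hb b (ev e s) Hb' Hi).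
           pose proof Y_le_B. lia.
      * lia.
    + apply upd_same.
    + eapply same_trans; [exact S1|]. eapply same_trans; [exact S2|]. apply same_upd; lia.
  - destruct Hw as [Hd [W1 W2]], Ho as [O1 O2]. pose proof (dg_pos e1). pose proof (dg_pos e2).
    assert (D12 : (dg e1 <= maxdg)%nat /\ (dg e2 <= maxdg)%nat) by (destruct o; cbn [dg] in Hdg; lia).
    destruct D12 as [D1 D2].
    pose proof (ev_bound (Bin o e1 e2) s d Hb (conj Hd (conj W1 W2)) (conj O1 O2)) as Hg.
    pose proof (pw_B _ Hdg). cbn [ev] in Hg.
    apply code_at_app in Hc. destruct Hc as [C1 Hc].
    apply code_at_app in Hc. destruct Hc as [C2 Hc].
    apply code_at_cons in Hc. destruct Hc as [C3 _].
    destruct (IHe1 d pc s m C1 W1 D1 Hb O1 HR) as (m1 & R1 & E1 & S1).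
    assert (HR1 : Rel s m1).
    { eapply Rel_same; [exact HR|]. intros a Ha. apply S1. unfold sc in *; lia. }
    destruct (IHe2 (S d) _ s m1 C2 W2 D2 Hb O2 HR1) as (m2 & R2 & E2 & S2).
    assert (E1' : m2 (sc d) = ev e1 s) by (rewrite S2; [easy|unfold sc; lia]).
    exists (upd m2 (sc d) (ev (Bin o e1 e2) s)). cbn [ce]. rewrite !length_app. cbn [length].
    split; [|split].
    + eapply reach_trans; [exact R1| |].
      * eapply reach_trans; [exact R2| |apply Z.le_refl].
        cbn [ev]. rewrite !Nat.add_assoc, Nat.add_1_r, <- E1', <- E2.
        apply r_op; [exact C3| | |]; rewrite ?E1', ?E2; [| |lia].
        -- pose proof (ev_bound e1 s d Hb W1 O1). pose proof (pw_B _ D1). lia.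
        -- pose proof (ev_bound e2 s _ Hb W2 O2). pose proof (pw_B _ D2). lia.
      * lia.
    + apply upd_same.
    + eapply same_trans; [exact S1|]. eapply same_trans; [apply same_S; exact S2|].
      apply same_upd; lia.
Qed.

Lemma Rel_setr s m x v : (x < nV)%nat -> Rel s m -> Rel (setr s x v) (upd m (vc x) v).
Proof.
  intros Hx (H0 & Hv & Ha & Hr). unfold Rel, upd, setr, vc, nV, nA, zA, zR in *; cbn [rg ar raw].
  repeat split.
  - exact H0.
  - intros y Hy. cbn [Nat.eqb]. destruct (Nat.eqb_spec y x); [easy|now apply Hv].
  - intros b i Hb Hi. rewrite <- (Ha b i Hb Hi). destruct (Nat.eqb_spec (Z.to_nat (base + 8 * i + Z.of_nat b)) (S x)); [lia|easy].
  - intros i Hi. rewrite <- (Hr i Hi). destruct (Nat.eqb_spec (Z.to_nat i) (S x)); [lia|easy].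
Qed.

Lemma Rel_seta s m b i v : (b < nA)%nat -> 0 <= i -> Rel s m ->
  Rel (seta s b i v) (upd m (Z.to_nat (adr b i)) v).
Proof.
  intros Hb Hi (H0 & Hv & Ha & Hr). unfold Rel, upd, seta, adr, vc, nV, nA, zA, zR in *; cbn [rg ar raw].
  repeat split.
  - destruct (Nat.eqb_spec 0 (Z.to_nat (base + 8 * i + Z.of_nat b))); [lia|easy].
  - intros x Hx. destruct (Nat.eqb_spec (S x) (Z.to_nat (base + 8 * i + Z.of_nat b))); [lia|now apply Hv].
  - intros b' i' Hb' Hi'. specialize (Ha b' i' Hb' Hi').
    destruct (Nat.eqb_spec b' b) as [->|Hne].
    + destruct (Z.eqb_spec i' i) as [->|Hne'].
      * now rewrite Nat.eqb_refl.
      * destruct (Nat.eqb_spec (Z.to_nat (base + 8 * i' + Z.of_nat b)) (Z.to_nat (base + 8 * i + Z.of_nat b))); [lia|easy].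
    + destruct (Nat.eqb_spec (Z.to_nat (base + 8 * i' + Z.of_nat b')) (Z.to_nat (base + 8 * i + Z.of_nat b))); [lia|easy].
  - intros j Hj. specialize (Hr j Hj).
    destruct (Nat.eqb_spec (Z.to_nat j) (Z.to_nat (base + 8 * i + Z.of_nat b))); [lia|easy].
Qed.

Lemma Rel_setraw s m i v : zR <= i < base -> Rel s m ->
  Rel (setraw s i v) (upd m (Z.to_nat i) v).
Proof.
  intros Hi (H0 & Hv & Ha & Hr). unfold Rel, upd, setraw, vc, nV, nA, zA, zR in *; cbn [rg ar raw].
  repeat split.
  - destruct (Nat.eqb_spec 0 (Z.to_nat i)); [lia|easy].
  - intros x Hx. destruct (Nat.eqb_spec (S x) (Z.to_nat i)); [lia|now apply Hv].
  - intros b j Hb Hj. specialize (Ha b j Hb Hj).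
    destruct (Nat.eqb_spec (Z.to_nat (base + 8 * j + Z.of_nat b)) (Z.to_nat i)); [lia|easy].
  - intros j Hj. specialize (Hr j Hj). destruct (Z.eqb_spec j i) as [->|].
    + now rewrite Nat.eqb_refl.
    + destruct (Nat.eqb_spec (Z.to_nat j) (Z.to_nat i)); [lia|easy].
Qed.

Lemma bs_setr s x v : Z.abs v <= Y -> bs s -> bs (setr s x v).
Proof.
  intros Hx (Hv & Ha & Hr). unfold bs, setr; cbn [rg ar raw]. repeat split; try easy.
  intros y Hy. destruct (Nat.eqb y x); auto.
Qed.
Lemma bs_seta s b i v : Z.abs v <= Y -> bs s -> bs (seta s b i v).
Proof.
  intros Hx (Hv & Ha & Hr). unfold bs, seta; cbn [rg ar raw]. repeat split; try easy.
  intros b' i' Hb' Hi'. destruct (Nat.eqb_spec b' b) as [->|]; [|auto]. destruct (i' =? i); auto.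
Qed.
Lemma bs_setraw s i v : Z.abs v <= Y -> bs s -> bs (setraw s i v).
Proof.
  intros Hx (Hv & Ha & Hr). unfold bs, setraw; cbn [rg ar raw]. repeat split; try easy.
  intros j Hj. destruct (j =? i); auto.
Qed.

Lemma sim_guard e1 e2 pc t rest s m :
  let a := (pc + length (ce 0 e1) + length (ce 1 e2) + 2)%nat in
  code_at prog pc (ce 0 e1 ++ ce 1 e2 ++ [IJlt (sc 0) (sc 1) a; IJmp t] ++ rest) ->
  wfe Y 0 e1 -> wfe Y 1 e2 -> (dg e1 <= maxdg)%nat -> (dg e2 <= maxdg)%nat ->
  bs s -> ok e1 s -> ok e2 s -> Rel s m ->
  exists m', reach w prog (mkState pc m) (mkState (if ev e1 s <? ev e2 s then a else t) m')
     (Z.of_nat (length (ce 0 e1) + length (ce 1 e2) + 2) * kap) /\ Rel s m' /\ code_at prog a rest.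
Proof.
  intros a Hc W1 W2 D1 D2 Hb O1 O2 HR. pose proof kap_pos.
  apply code_at_app in Hc. destruct Hc as [C1 Hc].
  apply code_at_app in Hc. destruct Hc as [C2 Hc].
  apply code_at_cons in Hc. destruct Hc as [C3 Hc].
  apply code_at_cons in Hc. destruct Hc as [C4 Hc].
  destruct (sim_e e1 0 pc s m C1 W1 D1 Hb O1 HR) as (m1 & R1 & E1 & S1).
  pose proof (Rel_same _ _ _ HR S1) as HR1.
  destruct (sim_e e2 1 _ s m1 C2 W2 D2 Hb O2 HR1) as (m2 & R2 & E2 & S2).
  assert (E1' : m2 (sc 0) = ev e1 s) by (rewrite S2; [easy|unfold sc; lia]).
  exists m2. split; [|split].
  - eapply reach_trans; [exact R1| |].
    + eapply reach_trans; [exact R2| |apply Z.le_refl].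
      refine (reach_trans _ _ _ _ _ kap kap _ _ _ (Z.le_refl _)).
      * apply r_jlt; [exact C3| |].
        -- rewrite E1'. pose proof (ev_bound e1 s _ Hb W1 O1). pose proof (pw_B _ D1). lia.
        -- rewrite E2. pose proof (ev_bound e2 s _ Hb W2 O2). pose proof (pw_B _ D2). lia.
      * rewrite E1', E2. destruct (ev e1 s <? ev e2 s); [apply reach_refl; lia|apply r_jmp, C4].
    + lia.
  - eapply Rel_same; [exact HR1|]. apply same_S, S2.
  - replace a with (S (S (pc + length (ce 0 e1) + length (ce 1 e2)))) by (unfold a; lia). exact Hc.
Qed.

(** A unit of time in [exec] is one assignment, memory access or guard, hence at most [Lam]
    instructions for any [Lam] bounding the code length. The jump back at the end of a loop body is
    charged to the guard that opened the iteration. *)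
Lemma sim_c Lam c s s' u : exec Y zR base c s s' u -> forall pc m,
  code_at prog pc (cc pc c) -> wfc Y c -> bs s -> Rel s m -> (clen c <= Lam)%nat ->
  exists m', reach w prog (mkState pc m) (mkState (pc + clen c) m')
    (u * (Z.of_nat Lam * kap)) /\ Rel s' m' /\ bs s'.
Proof.
  pose proof kap_pos as Hkp.
  induction 1 as [x e s Ho Hv|b e1 e2 s O1 O2 Hi Hv|x y s Hi|x y s Hi
    |c1 c2 s s1 s2 u1 u2 H1 IH1 H2 IH2|e1 e2 c s s' u O1 O2 Ht H IH
    |e1 e2 c s O1 O2 Ht|e1 e2 c s O1 O2 Ht
    |e1 e2 c s s1 s2 u1 u2 O1 O2 Ht H1 IH1 H2 IH2];
    intros pc m Hc Hw Hb HR HL; cbn [cc wfc clen] in *.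
  - destruct Hw as (Hx & We & De).
    apply code_at_app in Hc. destruct Hc as [C1 Hc].
    apply code_at_cons in Hc. destruct Hc as [C2 Hc].
    apply code_at_cons in Hc. destruct Hc as [C3 _].
    destruct (sim_e e 0 pc s m C1 We De Hb Ho HR) as (m1 & R1 & E1 & S1).
    pose proof (Rel_same _ _ _ HR S1) as HR1.
    exists (upd (upd m1 (sc 1) 0) (vc x) (ev e s)). split; [|split].
    + eapply reach_trans; [exact R1| |].
      * refine (reach_trans _ _ _ _ _ kap kap _ _ _ (Z.le_refl _));
          [eapply r_const; [eassumption|pose proof Y_le_B; lia]|].
        replace (pc + (length (ce 0 e) + 2))%nat with (S (S (pc + length (ce 0 e)))) by lia.
        pose proof Y_le_B.
        replace (ev e s) with (upd m1 (sc 1) 0 (sc 0) + upd m1 (sc 1) 0 (sc 1)).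
        2:{ rewrite upd_same, upd_diff, E1 by (unfold sc; lia). lia. }
        apply (r_op Add); [easy|..]; cbn [evop]; rewrite ?upd_same, ?(upd_diff _ _ _ (sc 0)), ?E1
          by (unfold nV, vc, sc in *; lia); lia.
      * nia.
    + apply Rel_setr; [easy|]. eapply Rel_same; [exact HR1|]. apply same_upd; lia.
    + now apply bs_setr.
  - destruct Hw as (Hb' & W1 & D1 & W2 & D2).
    apply code_at_app in Hc. destruct Hc as [C1 Hc].
    apply code_at_app in Hc. destruct Hc as [C2 Hc].
    apply code_at_app in Hc. destruct Hc as [C3 Hc].
    apply code_at_cons in Hc. destruct Hc as [C4 _]. cbn [length caddr] in C3, C4.
    destruct (sim_e e1 0 pc s m C1 W1 ltac:(lia) Hb O1 HR) as (m1 & R1 & E1 & S1).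
    pose proof (Rel_same _ _ _ HR S1) as HR1.
    pose proof (ev_bound e1 s _ Hb W1 O1) as Hbe.
    destruct (sim_addr b 0 _ m1 (dg e1) C2 ltac:(lia) Hb' ltac:(apply HR1) (dg_pos e1) D1 ltac:(now rewrite E1))
      as (m2 & R2 & E2 & S2).
    pose proof (Rel_same _ _ _ HR1 S2) as HR2.
    destruct (sim_e e2 1 _ s m2 C3 W2 D2 Hb O2 HR2) as (m3 & R3 & E3 & S3).
    assert (HR3 : Rel s m3) by (eapply Rel_same; [exact HR2|apply same_S, S3]).
    assert (E2' : m3 (sc 0) = adr b (ev e1 s)) by (rewrite S3, E2, E1; [easy|unfold sc; lia]).
    exists (upd m3 (Z.to_nat (adr b (ev e1 s))) (ev e2 s)). split; [|split].
    + eapply reach_trans; [exact R1| |].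
      * eapply reach_trans; [exact R2| |apply Z.le_refl].
        eapply reach_trans; [exact R3| |apply Z.le_refl].
        rewrite <- E2', <- E3.
        replace (pc + (length (ce 0 e1) + 5 + length (ce 1 e2) + 1))%nat
          with (S (pc + length (ce 0 e1) + 5 + length (ce 1 e2))) by lia.
        apply r_store; [exact C4| |].
        -- rewrite E2'. unfold adr. pose proof (pw_B _ D1) as HPB.
           rewrite pw_add in HPB. pose proof (pw_pos (dg e1)).
           pose proof pw3_large.
           unfold zR, zA, nA in *.
           assert (100 * Y <= B) by nia. assert (1000 * pw (dg e1) <= B) by nia. lia.
        -- rewrite E3. pose proof Y_le_B. lia.
      * rewrite Z.mul_1_l.
        assert (Z.of_nat (length (ce 0 e1) + 5 + length (ce 1 e2) + 1) * kap <= Z.of_nat Lam * kap)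
          by (apply Z.mul_le_mono_nonneg_r; lia). lia.
    + now apply Rel_seta.
    + now apply bs_seta.
  - destruct Hw as [Hx Hy]. apply code_at_cons in Hc. destruct Hc as [C _].
    assert (Ey : m (vc y) = rg s y) by now apply HR.
    assert (Er : m (Z.to_nat (m (vc y))) = raw s (rg s y)) by (rewrite Ey; now apply HR).
    exists (upd m (vc x) (raw s (rg s y))). split; [|split].
    + rewrite <- Er, Nat.add_1_r. eapply reach_weak; [apply r_load; [exact C| |]|].
      * rewrite Ey. destruct Hb as [Hb _]. specialize (Hb y Hy). pose proof Y_le_B. lia.
      * rewrite Er. destruct Hb as (_ & _ & Hb). specialize (Hb _ Hi). pose proof Y_le_B. lia.
      * nia.
    + now apply Rel_setr.
    + apply bs_setr; [now apply Hb|easy].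
  - destruct Hw as [Hx Hy]. apply code_at_cons in Hc. destruct Hc as [C _].
    assert (Ey : m (vc y) = rg s y) by now apply HR.
    assert (Ex : m (vc x) = rg s x) by now apply HR.
    exists (upd m (Z.to_nat (rg s y)) (rg s x)). split; [|split].
    + rewrite <- Ex, <- Ey, Nat.add_1_r. eapply reach_weak; [apply r_store; [exact C| |]|].
      * rewrite Ey. destruct Hb as [Hb _]. specialize (Hb y Hy). pose proof Y_le_B. lia.
      * rewrite Ex. destruct Hb as [Hb _]. specialize (Hb x Hx). pose proof Y_le_B. lia.
      * nia.
    + now apply Rel_setraw.
    + apply bs_setraw; [now apply Hb|easy].
  - destruct Hw as [W1 W2]. apply code_at_app in Hc. destruct Hc as [C1 C2].
    rewrite length_cc in C2.
    destruct (IH1 pc m C1 W1 Hb HR ltac:(lia)) as (m1 & R1 & HR1 & Hb1).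
    destruct (IH2 _ m1 C2 W2 Hb1 HR1 ltac:(lia)) as (m2 & R2 & HR2 & Hb2).
    exists m2. split; [|easy]. eapply reach_trans; [exact R1| |].
    + rewrite Nat.add_assoc. exact R2.
    + lia.
  - destruct Hw as (W1 & W2 & D1 & D2 & Wc).
    destruct (sim_guard _ _ _ _ _ _ _ Hc W1 W2 D1 D2 Hb O1 O2 HR) as (m1 & R1 & HR1 & Ca).
    rewrite (proj2 (Z.ltb_lt _ _) Ht) in R1.
    destruct (IH _ m1 Ca Wc Hb HR1 ltac:(lia)) as (m2 & R2 & HR2 & Hb2).
    exists m2. split; [|easy]. eapply reach_trans; [exact R1| |].
    + rewrite Nat.add_assoc, (Nat.add_assoc pc), (Nat.add_assoc pc). exact R2.
    + assert (Z.of_nat (length (ce 0 e1) + length (ce 1 e2) + 2) * kap <= Z.of_nat Lam * kap)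
        by (apply Z.mul_le_mono_nonneg_r; lia). lia.
  - destruct Hw as (W1 & W2 & D1 & D2 & Wc).
    destruct (sim_guard _ _ _ _ _ _ _ Hc W1 W2 D1 D2 Hb O1 O2 HR) as (m1 & R1 & HR1 & _).
    rewrite (proj2 (Z.ltb_ge _ _) Ht) in R1. exists m1. split; [|easy].
    eapply reach_weak; [rewrite Nat.add_assoc, (Nat.add_assoc pc), (Nat.add_assoc pc); exact R1|].
    assert (Z.of_nat (length (ce 0 e1) + length (ce 1 e2) + 2) * kap <= Z.of_nat Lam * kap)
        by (apply Z.mul_le_mono_nonneg_r; lia). lia.
  - destruct Hw as (W1 & W2 & D1 & D2 & Wc).
    destruct (sim_guard _ _ _ _ _ _ _ Hc W1 W2 D1 D2 Hb O1 O2 HR) as (m1 & R1 & HR1 & _).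
    rewrite (proj2 (Z.ltb_ge _ _) Ht) in R1. exists m1. split; [|easy].
    eapply reach_weak; [rewrite !Nat.add_assoc; exact R1|].
    assert (Z.of_nat (length (ce 0 e1) + length (ce 1 e2) + 2) * kap <= Z.of_nat Lam * kap)
        by (apply Z.mul_le_mono_nonneg_r; lia). lia.
  (* After one iteration the same loop code is entered again at the same [pc], so the unsplit
     hypotheses are kept for the second induction hypothesis. *)
  - pose proof Hw as Hw0. pose proof Hc as Hc0.
    destruct Hw as (W1 & W2 & D1 & D2 & Wc).
    destruct (sim_guard _ _ _ _ _ _ _ Hc W1 W2 D1 D2 Hb O1 O2 HR) as (m1 & R1 & HR1 & Ca).
    apply code_at_app in Ca. destruct Ca as [Cb Ca]. apply code_at_cons in Ca. destruct Ca as [Cj _].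
    rewrite length_cc in Cj. rewrite (proj2 (Z.ltb_lt _ _) Ht) in R1.
    destruct (IH1 _ m1 Cb Wc Hb HR1 ltac:(lia)) as (m2 & R2 & HR2 & Hb2).
    destruct (IH2 pc m2 Hc0 Hw0 Hb2 HR2 HL) as (m3 & R3 & HR3 & Hb3).
    exists m3. split; [|easy]. eapply reach_trans; [exact R1| |].
    + eapply reach_trans; [exact R2| |apply Z.le_refl].
      eapply reach_trans; [apply r_jmp, Cj|exact R3|apply Z.le_refl].
    + assert (Z.of_nat (length (ce 0 e1) + length (ce 1 e2) + 2 + 1) * kap <= Z.of_nat Lam * kap)
        by (apply Z.mul_le_mono_nonneg_r; lia). lia.
Qed.

End Sim.

(** * Total-correctness triples with time *)

Fixpoint wv (x : nat) (c : cmd) : bool :=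
  match c with
  | Asg y _ | Rld y _ => Nat.eqb x y
  | Seq c1 c2 => wv x c1 || wv x c2
  | Ifl _ _ c | Whl _ _ c => wv x c
  | _ => false
  end.

Fixpoint wa (b : nat) (c : cmd) : bool :=
  match c with
  | Sto b' _ _ => Nat.eqb b b'
  | Seq c1 c2 => wa b c1 || wa b c2
  | Ifl _ _ c | Whl _ _ c => wa b c
  | _ => false
  end.

Fixpoint wr (c : cmd) : bool :=
  match c with
  | Rst _ _ => true
  | Seq c1 c2 => wr c1 || wr c2
  | Ifl _ _ c | Whl _ _ c => wr c
  | _ => false
  end.

(** What a command leaves alone is computed from its text. For concrete commands these side
    conditions hold by [reflexivity], and loop invariants need only mention what the loop writes. *)
Definition frame (c : cmd) (s s' : st) : Prop :=
  (forall x, wv x c = false -> rg s' x = rg s x) /\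
  (forall b, wa b c = false -> ar s' b = ar s b) /\
  (wr c = false -> raw s' = raw s).

Lemma frame_refl c s : frame c s s.
Proof. unfold frame; auto. Qed.

Lemma frame_trans c s s' s'' : frame c s s' -> frame c s' s'' -> frame c s s''.
Proof.
  intros (A1 & A2 & A3) (B1 & B2 & B3). unfold frame; repeat split; intros.
  - now rewrite B1, A1.
  - now rewrite B2, A2.
  - now rewrite B3, A3.
Qed.

Lemma frame_sub c c' s s' :
  (forall x, wv x c' = false -> wv x c = false) -> (forall b, wa b c' = false -> wa b c = false) ->
  (wr c' = false -> wr c = false) -> frame c s s' -> frame c' s s'.
Proof. intros H1 H2 H3 (A1 & A2 & A3). unfold frame; auto. Qed.

Section T.
Variables (Y lo hi : Z).

Lemma exec_frame c s s' u : exec Y lo hi c s s' u -> frame c s s'.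
Proof.
  induction 1; try apply frame_refl; try assumption.
  - unfold frame, setr; cbn; repeat split; auto. intros y Hy. now rewrite Hy.
  - unfold frame, seta; cbn; repeat split; auto. intros b' Hb'. now rewrite Hb'.
  - unfold frame, setr; cbn; repeat split; auto. intros z Hz. now rewrite Hz.
  - unfold frame, setraw; cbn; repeat split; auto. discriminate.
  - eapply frame_trans; (eapply frame_sub; [..|eassumption]); cbn; intros;
      repeat match goal with H : _ || _ = false |- _ => apply Bool.orb_false_elim in H; destruct H end; auto.
  - eapply frame_trans; eassumption.
Qed.

Definition T (c : cmd) (s : st) (t : Z) (Q : st -> Prop) : Prop :=
  exists s' u, exec Y lo hi c s s' u /\ u <= t /\ Q s'.

Lemma T_weak c s t t' (Q Q' : st -> Prop) : T c s t Q -> t <= t' ->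
  (forall s', frame c s s' -> Q s' -> Q' s') -> T c s t' Q'.
Proof.
  intros (s' & u & H & Hu & HQ) Ht HQQ. exists s', u. split; [easy|]. split; [lia|].
  apply HQQ; [|easy]. now apply exec_frame in H.
Qed.

(* Stated for every larger budget and every consequence of the postcondition,
   so that it can be applied directly to a goal [T c s t Q]. *)
Definition spec (c : cmd) (s : st) (tc : Z) (P : st -> Prop) : Prop :=
  forall t (Q : st -> Prop), tc <= t -> (forall s', frame c s s' -> P s' -> Q s') -> T c s t Q.

Lemma spec_intro c s tc P : (forall t, tc <= t -> T c s t P) -> spec c s tc P.
Proof. intros H t Q Ht HQ. eapply T_weak; [now apply (H t)|lia|exact HQ]. Qed.

Lemma T_asg x e s t (Q : st -> Prop) : ok e s -> Z.abs (ev e s) <= Y -> 1 <= t ->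
  Q (setr s x (ev e s)) -> T (Asg x e) s t Q.
Proof. intros. exists (setr s x (ev e s)), 1. split; [now constructor|easy]. Qed.

Lemma T_sto b e1 e2 s t (Q : st -> Prop) : ok e1 s -> ok e2 s -> 0 <= ev e1 s ->
  Z.abs (ev e2 s) <= Y -> 1 <= t -> Q (seta s b (ev e1 s) (ev e2 s)) -> T (Sto b e1 e2) s t Q.
Proof. intros. eexists _, 1. split; [now constructor|easy]. Qed.

Lemma T_rld x y s t (Q : st -> Prop) : lo <= rg s y < hi -> 1 <= t ->
  Q (setr s x (raw s (rg s y))) -> T (Rld x y) s t Q.
Proof. intros. eexists _, 1. split; [now constructor|easy]. Qed.

Lemma T_rst x y s t (Q : st -> Prop) : lo <= rg s y < hi -> 1 <= t ->
  Q (setraw s (rg s y) (rg s x)) -> T (Rst y x) s t Q.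
Proof. intros. eexists _, 1. split; [now constructor|easy]. Qed.

Lemma T_seq t1 c1 c2 s t Q :
  T c1 s t1 (fun s1 => T c2 s1 (t - t1) Q) -> T (Seq c1 c2) s t Q.
Proof.
  intros (s1 & u1 & H1 & L1 & (s2 & u2 & H2 & L2 & HQ)).
  exists s2, (u1 + u2). split; [econstructor; eassumption|]. split; [lia|easy].
Qed.

Lemma T_asg' x e c s t Q : ok e s -> Z.abs (ev e s) <= Y ->
  T c (setr s x (ev e s)) (t - 1) Q -> T (Seq (Asg x e) c) s t Q.
Proof. intros. apply (T_seq 1), T_asg; easy. Qed.

Lemma T_sto' b e1 e2 c s t Q : ok e1 s -> ok e2 s -> 0 <= ev e1 s ->
  Z.abs (ev e2 s) <= Y -> T c (seta s b (ev e1 s) (ev e2 s)) (t - 1) Q ->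
  T (Seq (Sto b e1 e2) c) s t Q.
Proof. intros. apply (T_seq 1), T_sto; easy. Qed.

Lemma T_if' e1 e2 c1 c s t Q : ok e1 s -> ok e2 s ->
  (ev e1 s < ev e2 s -> T (Seq c1 c) s (t - 1) Q) ->
  (ev e2 s <= ev e1 s -> T c s (t - 1) Q) -> T (Seq (Ifl e1 e2 c1) c) s t Q.
Proof.
  intros O1 O2 H1 H2. destruct (Z_lt_le_dec (ev e1 s) (ev e2 s)) as [H|H].
  - destruct (H1 H) as (s' & u & He & Hu & HQ). inversion He; subst.
    eexists s', _. split; [econstructor; [apply exIflT|]; eassumption|]. split; [lia|easy].
  - destruct (H2 H) as (s' & u & He & Hu & HQ).
    exists s', (1 + u). split; [econstructor; [now apply exIflF|eassumption]|]. split; [lia|easy].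
Qed.

Lemma T_assoc c1 c2 c3 s t Q : T (Seq c1 (Seq c2 c3)) s t Q -> T (Seq (Seq c1 c2) c3) s t Q.
Proof.
  intros (s' & u & He & Hu & HQ). inversion He as [| | | |? ? ? s1 ? u1 ? H1 H2| | | |]; subst.
  inversion H2 as [| | | |? ? ? s2 ? ? ? H3 H4| | | |]; subst.
  eexists s', _. split; [econstructor; [econstructor|]; eassumption|]. split; [lia|easy].
Qed.

(** [mu] bounds the number of iterations left; each costs [tb] and one unit for the guard, and the
    last guard one more. The frame relative to the entry state [s0] is supplied alongside the
    invariant. *)
Lemma T_while (I : st -> Prop) (mu : st -> Z) e1 e2 c s0 tb (Q : st -> Prop) : 0 <= tb ->
  (forall s, I s -> frame c s0 s -> 0 <= mu s /\ ok e1 s /\ ok e2 s /\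
     (ev e1 s < ev e2 s -> T c s tb (fun s' => frame c s0 s' -> I s' /\ mu s' < mu s)) /\
     (ev e2 s <= ev e1 s -> Q s)) ->
  I s0 -> forall t, mu s0 * (tb + 1) + 1 <= t -> T (Whl e1 e2 c) s0 t Q.
Proof.
  intros Htb Hbody H0.
  assert (H : forall m, 0 <= m -> forall s, mu s <= m -> I s -> frame c s0 s ->
    T (Whl e1 e2 c) s (m * (tb + 1) + 1) Q).
  { apply (natlike_ind (fun m => forall s, _ -> _ -> _ -> _)).
    - intros s Hm HI Hf. destruct (Hbody s HI Hf) as (Hm0 & O1 & O2 & Ht & Hq).
      destruct (Z_lt_le_dec (ev e1 s) (ev e2 s)) as [Hlt|Hge].
      + destruct (Ht Hlt) as (s' & u & He & Hu & HQ).
        pose proof (frame_trans _ _ _ _ Hf (exec_frame _ _ _ _ He)) as Hf'.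
        destruct (HQ Hf') as [HI' Hmu]. destruct (Hbody s' HI' Hf') as (? & _). lia.
      + exists s, 1. split; [now apply exWhlF|]. split; [lia|auto].
    - intros m Hm IH s Hms HI Hf. destruct (Hbody s HI Hf) as (Hm0 & O1 & O2 & Ht & Hq).
      destruct (Z_lt_le_dec (ev e1 s) (ev e2 s)) as [Hlt|Hge].
      + destruct (Ht Hlt) as (s' & u & He & Hu & HQ).
        pose proof (frame_trans _ _ _ _ Hf (exec_frame _ _ _ _ He)) as Hf'.
        destruct (HQ Hf') as [HI' Hmu].
        destruct (IH s' ltac:(lia) HI' Hf') as (s2 & u2 & He2 & Hu2 & HQ2).
        exists s2, (1 + u + u2). split; [eapply exWhlT; eassumption|]. split; [lia|easy].
      + exists s, 1. split; [now apply exWhlF|]. split; [nia|auto]. }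
  intros t Ht. destruct (Hbody s0 H0 (frame_refl _ _)) as (Hm0 & _).
  destruct (H (mu s0) Hm0 s0 (Z.le_refl _) H0 (frame_refl _ _)) as (s' & u & He & Hu & HQ).
  exists s', u. split; [easy|]. split; [lia|easy].
Qed.
End T.

(** * Near-optimal solutions of restricted shape *)

Fixpoint zsn (f : Z -> Z) (n : nat) : Z :=
  match n with O => 0 | S n => zsn f n + f (Z.of_nat n) end.
Definition zs (f : Z -> Z) (m : Z) : Z := zsn f (Z.to_nat m).

Lemma zs_0 f : zs f 0 = 0. Proof. reflexivity. Qed.

Lemma zs_S f m : 0 <= m -> zs f (m + 1) = zs f m + f m.
Proof.
  intros H. unfold zs. replace (Z.to_nat (m + 1)) with (S (Z.to_nat m)) by lia.
  cbn [zsn]. now rewrite Z2Nat.id.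
Qed.

Lemma zind (P : Z -> Prop) : P 0 -> (forall m, 0 <= m -> P m -> P (m + 1)) ->
  forall m, 0 <= m -> P m.
Proof. intros H0 HS. apply natlike_ind; [easy|]. intros x Hx IH. now apply HS. Qed.

Lemma zs_ext f g m : (forall i, 0 <= i < m -> f i = g i) -> zs f m = zs g m.
Proof.
  destruct (Z_lt_le_dec m 0) as [H|H].
  - intros _. unfold zs. now replace (Z.to_nat m) with O by lia.
  - revert m H. apply (zind (fun m => _ -> zs f m = zs g m)); [easy|].
    intros m H IH Hf. rewrite !zs_S, IH, Hf by (intros; try apply Hf; lia). easy.
Qed.

Lemma zs_le f g m : 0 <= m -> (forall i, 0 <= i < m -> f i <= g i) -> zs f m <= zs g m.
Proof.
  revert m. apply (zind (fun m => _ -> zs f m <= zs g m)); [easy|].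
  intros m H IH Hf. rewrite !zs_S by lia. pose proof (Hf m ltac:(lia)).
  specialize (IH ltac:(intros; apply Hf; lia)). lia.
Qed.

Lemma zs_zero m : zs (fun _ => 0) m = 0.
Proof. unfold zs. induction (Z.to_nat m); cbn; lia. Qed.

Lemma zs_nonneg f m : 0 <= m -> (forall i, 0 <= i < m -> 0 <= f i) -> 0 <= zs f m.
Proof. intros H Hf. rewrite <- (zs_zero m). now apply zs_le. Qed.

Lemma zs_add f g m : zs (fun i => f i + g i) m = zs f m + zs g m.
Proof. unfold zs. induction (Z.to_nat m); cbn; lia. Qed.

Lemma zs_single j v m : 0 <= j < m -> zs (fun i => if i =? j then v else 0) m = v.
Proof.
  intros [H0 H]. replace m with (j + 1 + (m - j - 1)) by lia.
  assert (Hr : 0 <= m - j - 1) by lia. revert Hr. generalize (m - j - 1).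
  apply (zind (fun r => zs _ (j + 1 + r) = v)).
  - rewrite Z.add_0_r, zs_S, Z.eqb_refl by lia.
    rewrite (zs_ext _ (fun _ => 0)), zs_zero; [lia|].
    intros i Hi. destruct (Z.eqb_spec i j); lia.
  - intros r Hr IH. rewrite Z.add_assoc, zs_S, IH by lia.
    destruct (Z.eqb_spec (j + 1 + r) j); lia.
Qed.

Lemma zs_mono_len f m m' : 0 <= m <= m' -> (forall i, m <= i < m' -> 0 <= f i) ->
  zs f m <= zs f m'.
Proof.
  intros [H0 H] Hf. replace m' with (m + (m' - m)) in * by lia.
  assert (Hr : 0 <= m' - m) by lia. revert Hr Hf. generalize (m' - m). clear H.
  apply (zind (fun r => _ -> zs f m <= zs f (m + r))).
  - intros _. rewrite Z.add_0_r. lia.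
  - intros r Hr IH Hf. rewrite Z.add_assoc, zs_S by lia.
    specialize (IH ltac:(intros; apply Hf; lia)). specialize (Hf (m + r)). lia.
Qed.

Lemma zleast (P : Z -> Prop) (dec : forall i, {P i} + {~ P i}) m : 0 <= m -> P m ->
  exists i, 0 <= i <= m /\ P i /\ forall i', 0 <= i' < i -> ~ P i'.
Proof.
  intros Hm HP. assert (H : forall r, 0 <= r ->
    (exists i, 0 <= i < r /\ P i /\ forall i', 0 <= i' < i -> ~ P i')
    \/ forall i, 0 <= i < r -> ~ P i).
  { apply zind.
    - right. lia.
    - intros r Hr [(i & Hi & H)|H].
      + left. exists i. split; [lia|easy].
      + destruct (dec r).
        * left. exists r. split; [lia|easy].
        * right. intros i Hi. destruct (Z.eq_dec i r) as [->|]; [easy|apply H; lia]. }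
  destruct (H (m + 1) ltac:(lia)) as [(i & Hi & H')|H'].
  - exists i. split; [lia|easy].
  - now destruct (H' m ltac:(lia)).
Qed.

Lemma find_max (P : Z -> Prop) (dec : forall i, {P i} + {~ P i}) b :
  0 <= b -> (exists i, 1 <= i <= b /\ P i) \/ forall i, 1 <= i <= b -> ~ P i.
Proof.
  revert b. apply (zind (fun b => _ \/ _)); [right; lia|].
  intros b Hb [(i & Hi & HP)|H].
  - left. exists i. split; [lia|easy].
  - destruct (dec (b + 1)).
    + left. exists (b + 1). split; [lia|easy].
    + right. intros i Hi. destruct (Z.eq_dec i (b + 1)) as [->|]; [easy|apply H; lia].
Qed.

Lemma zchoice (R : Z -> Z -> Prop) b : 0 <= b ->
  (forall j, 0 <= j < b -> exists y, R j y) -> exists F, forall j, 0 <= j < b -> R j (F j).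
Proof.
  revert b. apply (zind (fun b => _ -> _)).
  - intros _. exists (fun _ => 0). lia.
  - intros b Hb IH H. destruct IH as [F HF]; [intros; apply H; lia|].
    destruct (H b ltac:(lia)) as [y Hy].
    exists (fun j => if j =? b then y else F j). intros j Hj.
    destruct (Z.eqb_spec j b) as [->|]; [easy|apply HF; lia].
Qed.

Lemma zs_tail0 f m m' : 0 <= m <= m' -> (forall i, m <= i < m' -> f i = 0) -> zs f m' = zs f m.
Proof.
  intros [H0 H] Hf. replace m' with (m + (m' - m)) in * by lia.
  assert (Hr : 0 <= m' - m) by lia. revert Hr Hf. generalize (m' - m). clear H.
  apply (zind (fun r => _ -> zs f (m + r) = zs f m)).
  - intros _. now rewrite Z.add_0_r.
  - intros r Hr IH Hf. rewrite Z.add_assoc, zs_S, Hf, IH by (try (intros; apply Hf); lia). lia.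
Qed.

(** A family of disjoint sets is a labelling: label [j + 1] means membership in set [j], and label 0
    in none. Disjointness is then automatic. Elements are numbered from 1, and [a 0 = 0] is a
    sentinel. *)
Definition lsum (a : Z -> Z) (f : Z -> Z) (j e : Z) : Z :=
  zs (fun x => if f x =? j + 1 then a x else 0) e.

Definition zc (v : Z -> Z) (j : Z) : Z := zs (fun i => if v i <? 1 then 1 else 0) j.

(* Empty sets are completed by the singletons [h+1, h+2, ...]. *)
Definition val (a : Z -> Z) (h : Z) (v : Z -> Z) (j : Z) : Z :=
  if v j <? 1 then a (h + 1 + zc v j) else v j.

Lemma zc_le v j j' : 0 <= j <= j' -> zc v j <= zc v j'.
Proof. intros. apply zs_mono_len; [lia|]. intros i Hi. destruct (v i <? 1); lia. Qed.

Lemma zc_bounds v j : 0 <= j -> 0 <= zc v j <= j.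
Proof.
  revert j. apply zind.
  - unfold zc. rewrite zs_0. lia.
  - intros j Hj IH. unfold zc in *. rewrite zs_S by lia. destruct (v j <? 1); lia.
Qed.

(** The final budget: [(1 + eps/5) / (1 - 3*eps/10) <= 1 + eps], which after clearing denominators
    is [3*p^2 <= 5*p*q]. *)
Lemma ratio_arith p q m M x y : 0 < p < q -> 0 < m -> m <= M ->
  10 * q * x <= (10 * q + 2 * p) * M -> (10 * q - 3 * p) * m <= 10 * q * y ->
  x * (q * m) <= (q + p) * M * y.
Proof.
  intros Hpq Hm HmM Hx Hy.
  assert (K1 : (10 * q + 2 * p) * q <= (q + p) * (10 * q - 3 * p)) by nia.
  assert (K2 : 10 * q * x * (q * m) <= (10 * q + 2 * p) * M * (q * m))
    by (apply Z.mul_le_mono_nonneg_r; nia).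
  assert (K3 : (10 * q + 2 * p) * q * (M * m) <= (q + p) * (10 * q - 3 * p) * (M * m))
    by (apply Z.mul_le_mono_nonneg_r; nia).
  assert (K4 : (q + p) * M * ((10 * q - 3 * p) * m) <= (q + p) * M * (10 * q * y))
    by (apply Z.mul_le_mono_nonneg_l; nia).
  apply (Z.mul_le_mono_pos_l _ _ (10 * q)); lia.
Qed.

Section Math.
Variables (a : Z -> Z) (n k p q E l N L : Z).
Hypothesis Hn : 1 <= n.
Hypothesis Hk : 2 <= k.
Hypothesis Hpq : 0 < p < q.
Hypothesis HE : q < E * p /\ 1 <= E.
Hypothesis Hl : 20 * k * E * E <= 2 ^ l /\ 0 <= l.
Hypothesis HN : N = l * k * E.
Hypothesis HL : L = 40 * N * E.
Hypothesis Ha0 : a 0 = 0.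
Hypothesis Hapos : forall i, 1 <= i <= n -> 0 < a i.
Hypothesis Hamon : forall i i', 1 <= i <= i' -> i' <= n -> a i <= a i'.
Hypothesis Haout : forall i, n < i -> a i = 0.

Definition wlo (h : Z) : Z := Z.max 0 (h - N).

(* Some selection [f] of elements in the window below [h], with sums of the order
   of [2 ^ t * a h], has ratio at most [U / V] after completion by singletons,
   even if its sums are perturbed up to the rounding error of the dynamic
   program; empty sets must stay empty, since they are the ones completed. *)
Definition HasCand (h t U V : Z) : Prop :=
  exists f, (forall x, f x <> 0 -> wlo h < x <= h) /\
    (forall j, 0 <= j < k -> lsum a f j (h + 1) <= 4 * (2 ^ t * a h)) /\
    forall v, (forall j, 0 <= j < k -> 0 <= v j /\
        Z.abs (v j - lsum a f j (h + 1)) * L <= N * (8 * (2 ^ t * a h)) /\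
        (lsum a f j (h + 1) = 0 -> v j = 0)) ->
      forall j j', 0 <= j < k -> 0 <= j' < k ->
        0 < val a h v j' /\ val a h v j * V <= U * val a h v j'.

Lemma a_nonneg i : 0 <= i -> 0 <= a i.
Proof.
  intros H. destruct (Z.eq_dec i 0) as [->|]; [lia|].
  destruct (Z_lt_le_dec n i); [rewrite Haout; lia|]. pose proof (Hapos i). lia.
Qed.

Lemma pow2_pos t : 0 <= t -> 0 < 2 ^ t.
Proof. intros. apply Z.pow_pos_nonneg; lia. Qed.

Lemma l_pos : 1 <= l.
Proof.
  destruct (Z.eq_dec l 0) as [H0|]; [|lia]. rewrite H0, Z.pow_0_r in Hl. nia.
Qed.

Lemma N_pos : 1 <= N.
Proof. pose proof l_pos. nia. Qed.

(** The number of indices over which a sparse sequence doubles; [N] is [l] times this. *)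
Definition D := k * E.
Lemma D_pos : 1 <= D. Proof. unfold D. nia. Qed.

(** * Growth of a sequence without [k] close consecutive elements *)

Section Sparse.
Hypothesis Hsp : forall i, 1 <= i -> i + k - 1 <= n -> (q + p) * a i < q * a (i + k - 1).

(** Each block of [k] indices adds at least [eps * a i], since the sequence has not decreased before
    it. This linear growth suffices for doubling and avoids powers of [q + p]. *)
Lemma a_lin u : 0 <= u -> forall i, 1 <= i -> i + u * k <= n ->
  (q + u * p) * a i <= q * a (i + u * k).
Proof.
  revert u. apply (zind (fun u => forall i, _ -> _ -> _)).
  - intros i Hi Hin. rewrite !Z.mul_0_l, !Z.add_0_r. lia.
  - intros u Hu IH i Hi Hin. specialize (IH i Hi ltac:(nia)).
    pose proof (Hsp (i + u * k) ltac:(nia) ltac:(nia)).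
    pose proof (Hamon (i + u * k + k - 1) (i + (u + 1) * k) ltac:(nia) ltac:(lia)).
    pose proof (Hamon i (i + u * k) ltac:(nia) ltac:(nia)). nia.
Qed.

(** [E] blocks multiply by at least [1 + E * eps], and [E * p > q]. *)
Lemma a_double i : 1 <= i -> i + D <= n -> 2 * a i <= a (i + D).
Proof.
  intros Hi Hin. pose proof (a_lin E ltac:(lia) i Hi) as H. unfold D in *.
  rewrite (Z.mul_comm k E) in *. specialize (H Hin). pose proof (Hapos i ltac:(nia)). nia.
Qed.

Lemma a_pow u : 0 <= u -> forall i, 1 <= i -> i + u * D <= n -> 2 ^ u * a i <= a (i + u * D).
Proof.
  pose proof D_pos as HD.
  revert u. apply (zind (fun u => forall i, _ -> _ -> _)).
  - intros i Hi Hin. rewrite !Z.mul_0_l, !Z.add_0_r. lia.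
  - intros u Hu IH i Hi Hin. specialize (IH i Hi ltac:(nia)).
    pose proof (a_double (i + u * D) ltac:(nia) ltac:(nia)).
    replace (i + (u + 1) * D) with (i + u * D + D) by ring.
    rewrite Z.pow_add_r, Z.pow_1_r by lia. nia.
Qed.

Lemma zs_block f m r c : 0 <= m -> 0 <= r -> (forall i, m <= i < m + r -> f i <= c) ->
  zs f (m + r) <= zs f m + r * c.
Proof.
  intros Hm Hr. revert r Hr. apply (zind (fun r => _ -> _)).
  - intros _. rewrite Z.add_0_r. lia.
  - intros r Hr IH Hf. rewrite Z.add_assoc, zs_S by lia.
    specialize (IH ltac:(intros; apply Hf; lia)). specialize (Hf (m + r)). lia.
Qed.

(** A geometric series: the last [D] elements contribute at most [D * a x], and the earlier ones at
    most [2 * D * a (x - D) <= D * a x]. *)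
Lemma a_sum : forall x, 0 <= x -> x <= n -> zs a (x + 1) <= 2 * D * a x.
Proof.
  pose proof D_pos as HD.
  apply (Zlt_0_ind (fun x => x <= n -> zs a (x + 1) <= 2 * D * a x)).
  intros x IH Hx Hxn. destruct (Z.eq_dec x 0) as [->|Hx0].
  - rewrite Z.add_0_l. change 1 with (0 + 1). rewrite zs_S, zs_0, Ha0 by lia. lia.
  - pose proof (Hapos x ltac:(lia)).
    destruct (Z_lt_le_dec x D).
    + pose proof (zs_block a 1 x (a x) ltac:(lia) ltac:(lia)) as Hb.
      rewrite (Z.add_comm 1 x) in Hb.
      change (zs a 1) with (zs a (0 + 1)) in Hb. rewrite (zs_S a 0), zs_0, Ha0 in Hb by lia.
      specialize (Hb ltac:(intros; apply Hamon; lia)). nia.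
    + pose proof (zs_block a (x - D + 1) D (a x) ltac:(lia) ltac:(lia)) as Hb.
      replace (x - D + 1 + D) with (x + 1) in Hb by ring.
      specialize (Hb ltac:(intros; apply Hamon; lia)).
      specialize (IH (x - D) ltac:(lia) ltac:(lia)).
      destruct (Z.eq_dec x D) as [->|].
      * rewrite Z.sub_diag, Ha0 in IH. rewrite Z.sub_diag in Hb. nia.
      * pose proof (a_double (x - D) ltac:(lia) ltac:(lia)) as Hd.
        replace (x - D + D) with x in Hd by ring. nia.
Qed.

(** From [h - N] to [h] the sequence doubles [l] times. With [20*k*E*E <= 2^l], everything below the
    window amounts to at most [a h / (10 * E)]. *)
Lemma a_below h : 0 <= h <= n -> 2 ^ l * zs a (wlo h + 1) <= 2 * D * a h.
Proof.
  intros Hh. pose proof D_pos. pose proof N_pos. pose proof (a_nonneg h ltac:(lia)).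
  unfold wlo. destruct (Z_lt_le_dec N h).
  - rewrite Z.max_r by lia. pose proof (a_sum (h - N) ltac:(lia) ltac:(lia)).
    pose proof (a_pow l ltac:(lia) (h - N) ltac:(lia)) as Hp.
    replace (h - N + l * D) with h in Hp by (unfold D; nia).
    specialize (Hp ltac:(lia)). pose proof (pow2_pos l ltac:(lia)). nia.
  - rewrite Z.max_l by lia. rewrite zs_S, zs_0, Ha0 by lia. nia.
Qed.

End Sparse.

(** * From a solution to a candidate *)

Lemma count_inj (big : Z -> bool) (x : Z -> Z) h h2 :
  (forall j, 0 <= j < k -> big j = true -> h < x j <= h2) ->
  (forall j j', 0 <= j < k -> 0 <= j' < k -> big j = true -> big j' = true -> x j = x j' -> j = j') ->
  h <= h2 -> zs (fun j => if big j then 1 else 0) k <= h2 - h.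
Proof.
  intros Hx Hinj Hh.
  set (js := filter big (map Z.of_nat (seq 0 (Z.to_nat k)))).
  assert (Hjs : forall j, In j js -> 0 <= j < k /\ big j = true).
  { intros j Hj. apply filter_In in Hj. destruct Hj as [Hj ?]. apply in_map_iff in Hj.
    destruct Hj as (i & <- & Hi). apply in_seq in Hi. split; [lia|easy]. }
  assert (Hlen : zs (fun j => if big j then 1 else 0) k = Z.of_nat (length js)).
  { unfold js, zs. clear. induction (Z.to_nat k) as [|m IH]; [easy|].
    rewrite seq_S, map_app, filter_app, length_app. cbn [zsn map filter]. rewrite IH, Nat.add_0_l.
    destruct (big (Z.of_nat m)); cbn [length]; lia. }
  rewrite Hlen.
  assert (Hnd : NoDup (map x js)).
  { assert (Hjn : NoDup js).
    { apply NoDup_filter, Injective_map_NoDup; [intros ? ? ?; lia|apply seq_NoDup]. }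
    revert Hjn Hjs. clearbody js. clear Hlen. induction js as [|j js IH]; intros Hjn Hjs; [constructor|].
    apply NoDup_cons_iff in Hjn. destruct Hjn as [Hj Hjn]. cbn. constructor.
    - intros Hin. apply in_map_iff in Hin. destruct Hin as (j' & He & Hin).
      destruct (Hjs j ltac:(now left)), (Hjs j' ltac:(now right)).
      apply Hinj in He; try easy. now subst.
    - apply IH; [easy|]. intros; apply Hjs; now right. }
  assert (Hincl : incl (map x js) (map (fun i => h + 1 + Z.of_nat i) (seq 0 (Z.to_nat (h2 - h))))).
  { intros y Hy. apply in_map_iff in Hy. destruct Hy as (j & <- & Hj).
    destruct (Hjs j Hj) as [H1 H2]. specialize (Hx j H1 H2).
    apply in_map_iff. exists (Z.to_nat (x j - h - 1)). split; [lia|]. apply in_seq. lia. }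
  pose proof (NoDup_incl_length Hnd Hincl) as H. rewrite !length_map, length_seq in H. lia.
Qed.

Lemma lsum_prefix_full g j e : 0 <= e <= n -> lsum a g j (e + 1) <= lsum a g j (n + 1).
Proof.
  intros He. apply zs_mono_len; [lia|]. intros i Hi. pose proof (a_nonneg i).
  destruct (g i =? j + 1); lia.
Qed.

(** The candidate leaves all sets empty below [i]. Since empty sums must stay empty under
    perturbation, completion produces exactly the singletons [i] to [i + k - 1]. *)
Lemma cand_close i M m : 1 <= i -> i + k - 1 <= n -> q * a (i + k - 1) <= (q + p) * a i ->
  0 < m <= M -> HasCand (i - 1) 0 ((q + p) * M) (q * m).
Proof.
  intros Hi Hin Hc Hm. exists (fun _ => 0).
  assert (Hl0 : forall j e, 0 <= j -> lsum a (fun _ => 0) j e = 0).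
  { intros j e Hj. unfold lsum. rewrite (zs_ext _ (fun _ => 0)); [apply zs_zero|].
    intros x _. destruct (Z.eqb_spec 0 (j + 1)); lia. }
  split; [easy|]. split.
  - intros j Hj. rewrite Hl0 by lia. pose proof (a_nonneg (i - 1) ltac:(lia)). rewrite Z.pow_0_r. lia.
  - intros v Hv.
    assert (Hval : forall j, 0 <= j < k -> a i <= val a (i - 1) v j <= a (i + k - 1)).
    { intros j Hj. unfold val.
      assert (Hv0 : v j = 0) by (apply Hv; [easy|apply Hl0; lia]). rewrite Hv0. cbn.
      pose proof (zc_bounds v j ltac:(lia)). split; apply Hamon; lia. }
    intros j j' Hj Hj'. pose proof (Hval j Hj). pose proof (Hval j' Hj').
    pose proof (Hapos i ltac:(lia)). split; [lia|].
    set (x := val a (i - 1) v j) in *. set (y := val a (i - 1) v j') in *.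
    assert (q * x <= q * a (i + k - 1)) by (apply Z.mul_le_mono_nonneg_l; lia).
    assert ((q + p) * a i <= (q + p) * y) by (apply Z.mul_le_mono_nonneg_l; lia).
    assert (q * x * m <= (q + p) * y * m) by (apply Z.mul_le_mono_nonneg_r; lia).
    assert ((q + p) * y * m <= (q + p) * y * M) by (apply Z.mul_le_mono_nonneg_l; nia).
    lia.
Qed.
Lemma lsum_ge g j x : 1 <= x <= n -> g x = j + 1 -> a x <= lsum a g j (n + 1).
Proof.
  intros Hx Hg. unfold lsum. rewrite <- (zs_single x (a x) (n + 1)) by lia.
  apply zs_le; [lia|]. intros i Hi. pose proof (a_nonneg i ltac:(lia)).
  destruct (Z.eqb_spec i x) as [->|]; [rewrite Hg, Z.eqb_refl; lia|]. destruct (g i =? j + 1); lia.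
Qed.

Lemma threshold c : exists h, 0 <= h <= n /\ (forall i, 1 <= i <= h -> a i < c) /\
  forall i, h < i <= n -> c <= a i.
Proof.
  destruct (zleast (fun i => n <= i \/ c <= a (i + 1))) with (m := n) as (h & Hh & Hp & Hlt).
  - intros i. destruct (Z_le_dec n i); [now left; left|].
    destruct (Z_le_dec c (a (i + 1))); [now left; right|right; tauto].
  - lia.
  - lia.
  - exists h. split; [easy|]. split.
    + intros i Hi. specialize (Hlt (i - 1) ltac:(lia)).
      replace (i - 1 + 1) with i in Hlt by ring. lia.
    + intros i Hi. destruct Hp as [Hp|Hp]; [lia|]. pose proof (Hamon (h + 1) i ltac:(lia) ltac:(lia)). lia.
Qed.

(** [h] is the last index with an element below [m] and [h2] the last with an element at most [M].
    Sets owning an element in [(h, h2]] become singletons, and the others are truncated to a scale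
    fixed by [m]. Every resulting value lies between [(1 - 3*eps/10) * m] and [(1 + eps/5) * M],
    even after perturbation. *)
Lemma cand_sparse g M m :
  (forall i, 1 <= i -> i + k - 1 <= n -> (q + p) * a i < q * a (i + k - 1)) ->
  0 < m -> (forall j, 0 <= j < k -> m <= lsum a g j (n + 1) <= M) ->
  exists h t, 0 <= h <= n /\ 0 <= t < l /\ HasCand h t ((q + p) * M) (q * m).
Proof.
  intros Hsp Hm Hg.
  pose proof l_pos as Hl1. pose proof N_pos as HN1. pose proof D_pos as HD1.
  assert (HmM : m <= M) by (specialize (Hg 0 ltac:(lia)); lia).
  destruct (threshold m) as (h & Hh & Hlow & Hhigh).
  destruct (threshold (M + 1)) as (h2 & Hh2 & Hlow2 & Hhigh2).
  assert (Hhh2 : h <= h2).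
  { destruct (Z_le_gt_dec h h2); [easy|]. pose proof (Hlow h ltac:(lia)).
    pose proof (Hhigh2 h ltac:(lia)). lia. }
  assert (Hahm : a h < m).
  { destruct (Z.eq_dec h 0) as [->|]; [lia|apply Hlow; lia]. }
  (* [F j] encodes both cases. A value above [h] is an element of set [j]; it is at most the sum of
     the set, hence at most [M]. A value [y <= h] cuts the set to its elements of index at most [y],
     with [y] least such that the sum reaches [m]; the last one added is below [m], so the sum is
     below [2 * m]. *)
  destruct (zchoice (fun j y => (h < y <= h2 /\ g y = j + 1) \/
     (0 <= y <= h /\ m <= lsum a g j (y + 1) < 2 * m)) k ltac:(lia)) as [F HF].
  { intros j Hj. destruct (Hg j Hj) as [Hg1 Hg2].
    destruct (find_max (fun i => h < i /\ g i = j + 1)) with (b := n) as [(x & Hx & Hx1 & Hx2)|Hno].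
    - intros i. destruct (Z_lt_dec h i), (Z.eq_dec (g i) (j + 1)); tauto.
    - lia.
    - exists x. left. split; [|easy]. split; [easy|].
      pose proof (lsum_ge g j x Hx Hx2). destruct (Z_le_gt_dec x h2); [easy|].
      pose proof (Hhigh2 x ltac:(lia)). lia.
    - assert (Hfull : lsum a g j (h + 1) = lsum a g j (n + 1)).
      { symmetry. apply zs_tail0; [lia|]. intros i Hi.
        destruct (Z.eqb_spec (g i) (j + 1)); [|easy]. exfalso. apply (Hno i ltac:(lia)). lia. }
      destruct (zleast (fun y => m <= lsum a g j (y + 1))) with (m := h) as (y & Hy & Hy1 & Hy2).
      + intros i. apply Z_le_dec.
      + lia.
      + lia.
      + exists y. right. split; [easy|]. split; [easy|].
        unfold lsum in Hy1 |- *. rewrite zs_S in Hy1 |- * by lia.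
        destruct (Z.eq_dec y 0) as [->|].
        * rewrite zs_0, Ha0 in Hy1 |- *. destruct (g 0 =? j + 1); lia.
        * specialize (Hy2 (y - 1) ltac:(lia)). unfold lsum in Hy2.
          replace (y - 1 + 1) with y in Hy2 by ring.
          pose proof (Hlow y ltac:(lia)). destruct (g y =? j + 1); lia. }
  set (big := fun j => h <? F j).
  assert (Hbig : forall j, 0 <= j < k -> big j = true -> h < F j <= h2 /\ g (F j) = j + 1).
  { intros j Hj Hb. apply Z.ltb_lt in Hb. destruct (HF j Hj); [easy|lia]. }
  assert (Hsmall : forall j, 0 <= j < k -> big j = false ->
    0 <= F j <= h /\ m <= lsum a g j (F j + 1) < 2 * m).
  { intros j Hj Hb. apply Z.ltb_ge in Hb. destruct (HF j Hj); [lia|easy]. }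
  (* The scale matters only for sets that are not big. If there is one, it has sum at least [m] from
     elements up to [h], so [m <= 2 * D * a h <= 2 ^ l * a h], and the least suitable power is below
     [l]. *)
  assert (Ht : exists t, 0 <= t < l /\ forall j, 0 <= j < k -> big j = false ->
    2 ^ t * a h < m <= 2 * (2 ^ t * a h)).
  { destruct (find_max (fun j => big (j - 1) = false)) with (b := k) as [(j & Hj & Hb)|Hno].
    - intros i. destruct (big (i - 1)); [now right|now left].
    - lia.
    - destruct (Hsmall (j - 1) ltac:(lia) Hb) as [Hf1 Hf2].
      assert (Hmy : m <= 2 * D * a h).
      { pose proof (a_sum Hsp h ltac:(lia) ltac:(lia)).
        assert (lsum a g (j - 1) (F (j - 1) + 1) <= zs a (F (j - 1) + 1)).
        { apply zs_le; [lia|]. intros i Hi. pose proof (a_nonneg i ltac:(lia)).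
          destruct (g i =? _); lia. }
        assert (zs a (F (j - 1) + 1) <= zs a (h + 1)).
        { apply zs_mono_len; [lia|]. intros i Hi. apply a_nonneg; lia. }
        lia. }
      assert (Hay : 0 < a h) by (pose proof (a_nonneg h ltac:(lia)); nia).
      destruct (zleast (fun t => m <= 2 * (2 ^ t * a h))) with (m := l - 1) as (t & Ht & Ht1 & Ht2).
      + intros i. apply Z_le_dec.
      + lia.
      + replace (2 * (2 ^ (l - 1) * a h)) with (2 ^ l * a h).
        2:{ replace l with (l - 1 + 1) at 1 by ring. rewrite Z.pow_add_r, Z.pow_1_r by lia. ring. }
        unfold D in Hmy. nia.
      + exists t. split; [lia|]. intros _ _ _. split; [|easy].
        destruct (Z.eq_dec t 0) as [->|]; [rewrite Z.pow_0_r; lia|].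
        specialize (Ht2 (t - 1) ltac:(lia)).
        replace t with (t - 1 + 1) by ring. rewrite Z.pow_add_r, Z.pow_1_r by lia. lia.
    (* All sets are big: any scale would do. *)
    - exists 0. split; [lia|]. intros j Hj Hb. exfalso. apply (Hno (j + 1) ltac:(lia)).
      now replace (j + 1 - 1) with j by ring. }
  destruct Ht as (t & Ht & Hz). exists h, t. split; [easy|]. split; [easy|].
  set (z := 2 ^ t * a h) in *.
  assert (Hz0 : 0 <= z).
  { pose proof (a_nonneg h ltac:(lia)). pose proof (pow2_pos t ltac:(lia)). unfold z. nia. }
  set (f := fun x => if (1 <=? g x) && (g x <=? k) && negb (big (g x - 1)) &&
     (x <=? F (g x - 1)) && (wlo h <? x) then g x else 0).
  assert (Hf : forall x, f x <> 0 -> f x = g x /\ 1 <= g x <= k /\ big (g x - 1) = false /\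
     x <= F (g x - 1) /\ wlo h < x).
  { intros x. unfold f. destruct ((1 <=? g x) && (g x <=? k) && negb (big (g x - 1)) &&
     (x <=? F (g x - 1)) && (wlo h <? x))%bool eqn:He; [|easy]. intros _.
    repeat (apply andb_prop in He; destruct He as [He ?]).
    rewrite negb_true_iff in *. rewrite ?Z.leb_le, ?Z.ltb_lt in *. auto. }
  assert (Hfg : forall x j, 0 <= j < k -> g x = j + 1 -> big j = false -> x <= F j -> wlo h < x -> f x = j + 1).
  { intros x j Hj Hgx Hb Hx Hw. unfold f. rewrite Hgx. replace (j + 1 - 1) with j by ring.
    rewrite Hb. replace (1 <=? j + 1) with true by lia. replace (j + 1 <=? k) with true by lia.
    apply Z.leb_le in Hx. apply Z.ltb_lt in Hw. now rewrite Hx, Hw. }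
  assert (Hsb : forall j, 0 <= j < k -> big j = true -> lsum a f j (h + 1) = 0).
  { intros j Hj Hb. transitivity (zs (fun _ => 0) (h + 1)); [|apply zs_zero]. apply zs_ext. intros x Hx.
    destruct (Z.eqb_spec (f x) (j + 1)) as [He|]; [|easy]. exfalso.
    destruct (Hf x ltac:(lia)) as (E1 & _ & E2 & _). rewrite <- E1, He in E2.
    replace (j + 1 - 1) with j in E2 by ring. congruence. }
  set (b := zs a (wlo h + 1)).
  assert (Hwl : 0 <= wlo h <= h) by (unfold wlo; lia).
  assert (Hb0 : 0 <= b) by (apply zs_nonneg; [lia|intros; apply a_nonneg; lia]).
  (* The total of all elements below the window is at most [eps * m / 10], as [a h < m] and
     [q < E * p]. *)
  assert (Hb : 10 * q * b <= p * m).
  { pose proof (a_below Hsp h Hh) as Hb. fold b in Hb. unfold D in *.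
    assert (20 * k * E * E * b <= 2 * (k * E) * m) by nia.
    assert (k * E * (10 * E * b) <= k * E * m) by lia.
    assert (10 * E * b <= m) by nia. nia. }
  assert (Hss : forall j, 0 <= j < k -> big j = false ->
     m - b <= lsum a f j (h + 1) < 2 * m /\ lsum a f j (h + 1) <= M).
  { intros j Hj Hbj. destruct (Hsmall j Hj Hbj) as [HFj Hs].
    assert (Heq : lsum a f j (h + 1) = lsum a f j (F j + 1)).
    { apply zs_tail0; [lia|]. intros x Hx. destruct (Z.eqb_spec (f x) (j + 1)) as [He|]; [|easy].
      destruct (Hf x ltac:(lia)) as (E1 & _ & E2 & E3 & _). rewrite <- E1, He in E3.
      replace (j + 1 - 1) with j in E3 by ring. lia. }
    assert (Hle : lsum a f j (F j + 1) <= lsum a g j (F j + 1)).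
    { apply zs_le; [lia|]. intros x Hx. pose proof (a_nonneg x ltac:(lia)).
      destruct (Z.eqb_spec (f x) (j + 1)) as [He|].
      - destruct (Hf x ltac:(lia)) as (E1 & _). rewrite <- E1, He, Z.eqb_refl. lia.
      - destruct (g x =? j + 1); lia. }
    assert (Hge : lsum a g j (F j + 1) <= lsum a f j (F j + 1) + b).
    (* An element of the truncated set missing from [f] must lie below the window, so [bel] accounts
       for the whole difference. *)
    { set (bel := fun x => if x <=? wlo h then a x else 0).
      assert (Hbel : zs bel (F j + 1) <= b).
      { transitivity (zs bel (h + 1)).
        - apply zs_mono_len; [lia|]. intros i Hi. unfold bel. pose proof (a_nonneg i ltac:(lia)).
          destruct (i <=? wlo h); lia.
        - rewrite (zs_tail0 bel (wlo h + 1)); [|lia|].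
          + unfold b. apply Z.eq_le_incl, zs_ext. intros i Hi. unfold bel.
            destruct (Z.leb_spec i (wlo h)); lia.
          + intros i Hi. unfold bel. destruct (Z.leb_spec i (wlo h)); lia. }
      assert (lsum a g j (F j + 1) <= lsum a f j (F j + 1) + zs bel (F j + 1)); [|lia].
      unfold lsum. rewrite <- zs_add. apply zs_le; [lia|]. intros x Hx.
      pose proof (a_nonneg x ltac:(lia)). unfold bel.
      destruct (Z.eqb_spec (g x) (j + 1)) as [He|].
      - destruct (Z.leb_spec x (wlo h)).
        + destruct (f x =? j + 1); lia.
        + rewrite (Hfg x j) by (try easy; lia). rewrite Z.eqb_refl. lia.
      - destruct (f x =? j + 1), (x <=? wlo h); lia. }
    pose proof (lsum_prefix_full g j (F j) ltac:(lia)). specialize (Hg j Hj). lia. }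
  exists f. split.
  { intros x Hx. destruct (Hf x Hx) as (E1 & E2 & E3 & E4 & E5).
    destruct (Hsmall (g x - 1) ltac:(lia) E3). lia. }
  fold z. split.
  { intros j Hj. destruct (big j) eqn:Hbj; [rewrite Hsb by easy; lia|].
    destruct (Hss j Hj Hbj). specialize (Hz j Hj Hbj). lia. }
  intros v Hv.
  assert (Hvs : forall j, 0 <= j < k -> big j = false ->
    (10 * q - 3 * p) * m <= 10 * q * v j <= (10 * q + 2 * p) * M).
  { intros j Hj Hbj. destruct (Hv j Hj) as (Hv0 & Hv1 & _). destruct (Hss j Hj Hbj) as [Hs1 Hs2].
    specialize (Hz j Hj Hbj). set (s := lsum a f j (h + 1)) in *.
    set (d := Z.abs (v j - s)) in *. assert (Hd0 : 0 <= d) by (unfold d; lia).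
    (* This is what the 40 in [L] is for: the error [8 * N * z / L] equals [z / (5 * E)], and
       [z < m]. *)
    assert (Hd : 5 * E * d <= z).
    { rewrite HL in Hv1. assert (8 * N * (5 * E * d) <= 8 * N * z) by lia. nia. }
    assert (Hd2 : 5 * q * d <= p * m).
    { assert (q * d <= E * p * d) by (apply Z.mul_le_mono_nonneg_r; lia).
      assert (p * (5 * E * d) <= p * m) by (apply Z.mul_le_mono_nonneg_l; lia). lia. }
    assert (q * b <= q * b) by lia.
    assert (v j <= s + d /\ s - d <= v j) by (unfold d; lia).
    assert (10 * q * v j <= 10 * q * (s + d)) by (apply Z.mul_le_mono_nonneg_l; lia).
    assert (10 * q * (s - d) <= 10 * q * v j) by (apply Z.mul_le_mono_nonneg_l; lia).
    assert (10 * q * (m - b) <= 10 * q * s) by (apply Z.mul_le_mono_nonneg_l; lia).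
    assert (10 * q * s <= 10 * q * M) by (apply Z.mul_le_mono_nonneg_l; lia).
    assert (p * m <= p * M) by (apply Z.mul_le_mono_nonneg_l; lia). lia. }
  (* Completion recognises the right sets: big ones are empty in [f] and stay so, the others keep a
     positive sum. *)
  assert (Hvb : forall j, 0 <= j < k -> (v j <? 1) = big j).
  { intros j Hj. destruct (big j) eqn:Hbj.
    - destruct (Hv j Hj) as (_ & _ & Hv2). rewrite Hv2; [easy|]. now apply Hsb.
    - specialize (Hvs j Hj Hbj). apply Z.ltb_ge. assert (0 < (10 * q - 3 * p) * m) by (apply Z.mul_pos_pos; lia). nia. }
  (* Disjointness makes [F] injective on big sets, so [(h, h2]] contains enough elements. The first
     ones after [h] can replace those originally used, as all of them lie between [m] and [M]. *)
  assert (Hzc : zc v k <= h2 - h).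
  { rewrite <- (count_inj big F h h2).
    - apply Z.eq_le_incl, zs_ext. intros i Hi. now rewrite Hvb.
    - intros j Hj Hbj. now apply Hbig.
    - intros j j' Hj Hj' Hbj Hbj' He. pose proof (proj2 (Hbig j Hj Hbj)) as H1.
      pose proof (proj2 (Hbig j' Hj' Hbj')) as H2. rewrite He in H1. lia.
    - easy. }
  assert (Hval : forall j, 0 <= j < k ->
    (10 * q - 3 * p) * m <= 10 * q * val a h v j <= (10 * q + 2 * p) * M).
  { intros j Hj. unfold val. destruct (v j <? 1) eqn:Hvj.
    - assert (Hzj : zc v j + 1 <= zc v k).
      { rewrite <- (zc_le v (j + 1) k) by lia. unfold zc. rewrite (zs_S _ j), Hvj by lia. lia. }
      pose proof (zc_bounds v j ltac:(lia)).
      pose proof (Hhigh (h + 1 + zc v j) ltac:(lia)).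
      pose proof (Hlow2 (h + 1 + zc v j) ltac:(lia)). nia.
    - apply Hvs; [easy|]. now rewrite <- Hvb. }
  intros j j' Hj Hj'. pose proof (Hval j Hj) as [_ H1]. pose proof (Hval j' Hj') as [H2 _].
  assert (0 < (10 * q - 3 * p) * m) by (apply Z.mul_pos_pos; lia).
  split; [nia|]. now apply ratio_arith.
Qed.

Lemma cand_exists g M m : 0 < m -> (forall j, 0 <= j < k -> m <= lsum a g j (n + 1) <= M) ->
  exists h t, 0 <= h <= n /\ 0 <= t < l /\ HasCand h t ((q + p) * M) (q * m).
Proof.
  intros Hm Hg.
  destruct (find_max (fun i => i + k - 1 <= n /\ q * a (i + k - 1) <= (q + p) * a i)) with (b := n)
    as [(i & Hi & H1 & H2)|Hno].
  - intros i. destruct (Z_le_dec (i + k - 1) n), (Z_le_dec (q * a (i + k - 1)) ((q + p) * a i)); tauto.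
  - lia.
  - exists (i - 1), 0. pose proof l_pos. split; [lia|]. split; [lia|].
    apply cand_close; try easy. specialize (Hg 0 ltac:(lia)). lia.
  - apply cand_sparse with (g := g); try easy. intros i Hi Hin.
    destruct (Z_lt_le_dec ((q + p) * a i) (q * a (i + k - 1))); [easy|].
    exfalso. apply (Hno i ltac:(lia)). easy.
Qed.
End Math.

(** * The rounded dynamic program *)

Definition updz (v : Z -> Z) (j x : Z) : Z -> Z := fun i => if i =? j then x else v i.

Section Digits.
Variable B : Z.
Hypothesis HB : 1 <= B.

Lemma digits_bound d m : 0 <= m -> (forall j, 0 <= j < m -> 0 <= d j < B) ->
  0 <= zs (fun j => d j * B ^ j) m < B ^ m.
Proof.
  revert m. apply (zind (fun m => _ -> _)); [rewrite zs_0; cbn; lia|].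
  intros m Hm IH Hd. rewrite zs_S, Z.pow_add_r, Z.pow_1_r by lia.
  specialize (IH ltac:(intros; apply Hd; lia)). specialize (Hd m ltac:(lia)). nia.
Qed.

Lemma digits_inj d d' m : 0 <= m -> (forall j, 0 <= j < m -> 0 <= d j < B) ->
  (forall j, 0 <= j < m -> 0 <= d' j < B) ->
  zs (fun j => d j * B ^ j) m = zs (fun j => d' j * B ^ j) m ->
  forall j, 0 <= j < m -> d j = d' j.
Proof.
  revert m. apply (zind (fun m => (forall j, 0 <= j < m -> 0 <= d j < B) ->
    (forall j, 0 <= j < m -> 0 <= d' j < B) -> _ -> forall j, 0 <= j < m -> d j = d' j)); [lia|].
  intros m Hm IH Hd Hd' He.
  rewrite !zs_S in He by lia.
  pose proof (digits_bound d m Hm ltac:(intros; apply Hd; lia)) as H1.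
  pose proof (digits_bound d' m Hm ltac:(intros; apply Hd'; lia)) as H2.
  assert (Htop : d m = d' m) by nia.
  rewrite Htop in He.
  intros j Hj. destruct (Z.eq_dec j m) as [->|]; [easy|].
  apply IH; try lia; intros; try apply Hd; try apply Hd'; lia.
Qed.
End Digits.

Section DP.
Variables (a : Z -> Z) (k L z h wl base : Z).
Hypothesis Hk : 1 <= k.
Hypothesis HL : 1 <= L.
Hypothesis Hz : 0 <= z.
Hypothesis Hwl : 0 <= wl <= h.
Hypothesis Ha : forall x, 0 <= a x.
Hypothesis Hap : forall x, wl < x <= h -> 0 < a x.

(** The ceiling of [s * L / (8 * z)]: with [z > 0], no positive sum shares bucket 0 with the empty
    sum. For [z = 0], which occurs at [h = 0], division by zero yields 0, and [rng] then admits only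
    the sum 0. *)
Definition bk (s : Z) : Z := (s * L + 8 * z - 1) / (8 * z).
Definition rng (s : Z) : Prop := 0 <= s /\ (s = 0 \/ s < 8 * z).
Definition enc (v : Z -> Z) : Z := zs (fun j => bk (v j) * (L + 1) ^ j) k.
Definition KK : Z := (L + 1) ^ k.

Lemma bk_0 : bk 0 = 0.
Proof.
  unfold bk. destruct (Z.eq_dec z 0) as [->|]; [apply Zdiv_0_r|].
  apply Z.div_small. lia.
Qed.

Lemma bk_spec s : 0 < z -> 8 * z * bk s < s * L + 8 * z /\ s * L <= 8 * z * bk s.
Proof.
  intros H. unfold bk. pose proof (Z.div_mod (s * L + 8 * z - 1) (8 * z) ltac:(lia)).
  pose proof (Z.mod_pos_bound (s * L + 8 * z - 1) (8 * z) ltac:(lia)). lia.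
Qed.

Lemma bk_range s : rng s -> 0 <= bk s < L + 1.
Proof.
  intros [H0 [->|H]]; [rewrite bk_0; lia|].
  pose proof (bk_spec s ltac:(lia)) as [H1 H2].
  assert (s * L <= 8 * z * L) by (apply Z.mul_le_mono_nonneg_r; lia).
  split; [apply (Z.mul_le_mono_pos_l 0 (bk s) (8 * z)); nia|].
  apply (Z.mul_lt_mono_pos_l (8 * z)); [lia|]. nia.
Qed.

(** Buckets have width [8 * z / L], and bucket 0 contains only the sum 0. *)
Lemma bk_close s s' : rng s -> rng s' -> bk s = bk s' ->
  Z.abs (s - s') * L <= 8 * z /\ (s = 0 -> s' = 0).
Proof.
  intros Hs Hs' He.
  destruct (Z.eq_dec z 0) as [->|Hz0].
  - destruct Hs as [? [?|?]], Hs' as [? [?|?]]; lia.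
  - pose proof (bk_spec s ltac:(lia)). pose proof (bk_spec s' ltac:(lia)). rewrite He in *. split.
    + destruct (Z.abs_spec (s - s')) as [[_ ->]|[_ ->]]; nia.
    + intros ->. rewrite bk_0 in He. rewrite <- He in *. destruct Hs' as [? _]. nia.
Qed.

Lemma enc_range v : (forall j, 0 <= j < k -> rng (v j)) -> 0 <= enc v < KK.
Proof. intros H. apply digits_bound; [lia|lia|]. intros j Hj. now apply bk_range, H. Qed.

Lemma enc_inj v v' : (forall j, 0 <= j < k -> rng (v j)) -> (forall j, 0 <= j < k -> rng (v' j)) ->
  enc v = enc v' -> forall j, 0 <= j < k -> bk (v j) = bk (v' j).
Proof.
  intros H H' He. apply (digits_inj (L + 1) ltac:(lia) (fun j => bk (v j)) (fun j => bk (v' j)) k);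
    [lia|..|exact He]; intros j Hj; now apply bk_range; auto.
Qed.

Lemma enc_ext v v' : (forall j, 0 <= j < k -> v j = v' j) -> enc v = enc v'.
Proof. intros H. apply zs_ext. intros j Hj. now rewrite H. Qed.

(** Lets the program find the index of a child from that of its parent without recomputing all [k]
    digits. *)
Lemma enc_upd v j x : 0 <= j < k -> enc (updz v j x) = enc v + (bk x - bk (v j)) * (L + 1) ^ j.
Proof.
  intros Hj. unfold enc. rewrite <- (zs_single j ((bk x - bk (v j)) * (L + 1) ^ j) k Hj) at 1.
  rewrite <- zs_add. apply zs_ext. intros i Hi. unfold updz.
  destruct (Z.eqb_spec i j) as [->|]; lia.
Qed.

Definition nsum (SM : Z -> Z) (c : Z) : Z -> Z := fun j => SM (c * k + j).
Definition vld (ST : Z -> Z) (c : Z) : Prop := 0 <= c < KK /\ base <= ST c.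

(* Node [c] of the dynamic program is alive iff its stamp is at least [base];
   the node with stamp [base + i] was created by element [wl + i] joining the
   set [LB c - 1] of the node [PA c].  [SM (c * k + j)] is the exact sum of set
   [j], and [c] encodes the rounded sums. *)
Definition DPI (S : Z) (ST PA LB SM : Z -> Z) : Prop :=
  ST 0 = base /\ (forall j, 0 <= j < k -> SM j = 0) /\ base <= S /\
  forall c, vld ST c ->
    ST c <= S /\ (forall j, 0 <= j < k -> rng (nsum SM c j)) /\ enc (nsum SM c) = c /\
    (c = 0 \/ (base < ST c /\ vld ST (PA c) /\ ST (PA c) < ST c /\ 1 <= LB c <= k /\
       forall j, 0 <= j < k ->
         nsum SM c j = nsum SM (PA c) j + if LB c =? j + 1 then a (wl + (ST c - base)) else 0)).

Definition adm (f : Z -> Z) : Prop :=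
  (forall x, f x <> 0 -> wl < x <= h) /\ forall j, 0 <= j < k -> lsum a f j (h + 1) <= 4 * z.

(** Nodes store exact sums, so an error arises only when a child is represented by another node of
    the same buckets. Each element adds at most one bucket width [8 * z / L], whence the factor
    [e - wl]. *)
Definition Cov (e S : Z) (ST SM : Z -> Z) : Prop :=
  forall f, adm f -> exists c, vld ST c /\ ST c < S /\
    forall j, 0 <= j < k -> Z.abs (nsum SM c j - lsum a f j (e + 1)) * L <= (e - wl) * (8 * z) /\
      (lsum a f j (e + 1) = 0 -> nsum SM c j = 0).

(** The table is updated in place during the round of an element. This relation carries facts about
    older nodes across such updates. *)
Definition Ext (S : Z) (ST SM ST' SM' : Z -> Z) : Prop :=
  (forall c, vld ST c -> ST' c = ST c /\ forall j, 0 <= j < k -> nsum SM' c j = nsum SM c j) /\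
  forall c, 0 <= c < KK -> ST' c <> ST c -> ST' c = S.

Definition child (e : Z) (SM : Z -> Z) (c j : Z) : Z := enc (updz (nsum SM c) j (nsum SM c j + a e)).

(** Progress of the sweep over nodes. Only nodes older than the current round are expanded;
    expanding new ones could use an element twice. *)
Definition Done (S e c0 : Z) (ST SM : Z -> Z) : Prop :=
  forall c, vld ST c -> ST c < S -> c < c0 -> forall j, 0 <= j < k ->
    nsum SM c j + a e < 8 * z -> vld ST (child e SM c j).

Lemma Ext_vld S ST SM ST' SM' c : Ext S ST SM ST' SM' -> vld ST c -> vld ST' c.
Proof. intros [H _] [H0 H1]. split; [easy|]. destruct (H c (conj H0 H1)) as [-> _]. easy. Qed.

Lemma Ext_old S ST SM ST' SM' c : Ext S ST SM ST' SM' -> vld ST' c -> ST' c < S -> vld ST c.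
Proof.
  intros [_ H] [H0 H1] HS. split; [easy|]. destruct (Z.eq_dec (ST' c) (ST c)) as [<-|Hne]; [easy|].
  apply H in Hne; [lia|easy].
Qed.

Lemma updz_ext v v' j x x' : (forall i, 0 <= i < k -> v i = v' i) -> x = x' ->
  forall i, 0 <= i < k -> updz v j x i = updz v' j x' i.
Proof. intros H -> i Hi. unfold updz. destruct (i =? j); auto. Qed.

Lemma chd_ext SM SM' e c j : 0 <= j < k -> (forall i, 0 <= i < k -> nsum SM' c i = nsum SM c i) ->
  child e SM' c j = child e SM c j.
Proof. intros Hj H. apply enc_ext, updz_ext; [easy|]. now rewrite H. Qed.

Lemma Done_ext S e c0 ST SM ST' SM' : Ext S ST SM ST' SM' ->
  Done S e c0 ST SM -> Done S e c0 ST' SM'.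
Proof.
  intros HE HD c Hc HS Hc0 j Hj Hlt.
  pose proof (Ext_old _ _ _ _ _ _ HE Hc HS) as Hv. destruct (proj1 HE c Hv) as [E1 E2].
  rewrite (chd_ext SM) by easy. apply (Ext_vld _ _ _ _ _ _ HE).
  apply HD; try easy; [lia|]. now rewrite <- E2.
Qed.

Lemma Cov_ext e S ST SM ST' SM' : Ext S ST SM ST' SM' -> Cov e S ST SM -> Cov e S ST' SM'.
Proof.
  intros HE HC f Hf. destruct (HC f Hf) as (c & Hc & HS & H). exists c.
  destruct (proj1 HE c Hc) as [E1 E2]. split; [|split].
  - eapply Ext_vld; eauto.
  - lia.
  - intros j Hj. rewrite E2 by easy. now apply H.
Qed.

Lemma Cov_init S ST PA LB SM : DPI S ST PA LB SM -> Cov wl (S + 1) ST SM.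
Proof.
  intros (H0 & H1 & H2 & H3) f [Hf _].
  assert (HK : 0 < KK) by (apply Z.pow_pos_nonneg; lia).
  exists 0. split; [unfold vld; lia|]. split; [lia|].
  intros j Hj. unfold nsum. rewrite Z.mul_0_l, Z.add_0_l, H1 by easy.
  assert (Hl : lsum a f j (wl + 1) = 0).
  { transitivity (zs (fun _ => 0) (wl + 1)); [|apply zs_zero]. apply zs_ext. intros x Hx.
    destruct (Z.eqb_spec (f x) (j + 1)); [|easy]. specialize (Hf x). lia. }
  rewrite Hl. lia.
Qed.

Lemma lsum_S f j e : 0 <= e -> lsum a f j (e + 1) = lsum a f j e + if f e =? j + 1 then a e else 0.
Proof. intros He. unfold lsum. now rewrite zs_S. Qed.

Lemma lsum_mono f j e e' : 0 <= e <= e' -> 0 <= lsum a f j e <= lsum a f j e'.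
Proof.
  intros He. split.
  - apply zs_nonneg; [lia|]. intros i _. destruct (f i =? j + 1); [apply Ha|lia].
  - apply zs_mono_len; [lia|]. intros i _. destruct (f i =? j + 1); [apply Ha|lia].
Qed.

(** If [f] does not use [e], the node at hand still serves. Otherwise its child does, or whichever
    node occupies the same buckets; same buckets cost one width and preserve emptiness. *)
Lemma Cov_step N S e ST PA LB SM : wl < e <= h -> h - wl <= N -> 4 * N <= L -> base < S ->
  DPI S ST PA LB SM -> Cov (e - 1) S ST SM -> Done S e KK ST SM -> Cov e (S + 1) ST SM.
Proof.
  intros He HN HNL HS HI HC HD f Hf.
  destruct (HC f Hf) as (c & Hc & HcS & Happ).
  replace (e - 1 + 1) with e in Happ by ring.
  pose proof HI as (_ & _ & _ & Hnode).
  destruct (Hnode c Hc) as (_ & Hrng & _ & _).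
  destruct (find_max (fun i => f e = i)) with (b := k) as [(j1 & Hj1 & Hfe)|Hno];
    [intros; apply Z.eq_dec|lia| |].
  - assert (Hj : 0 <= j1 - 1 < k) by lia. remember (j1 - 1) as j eqn:Ej.
    assert (Hls : forall i, lsum a f i (e + 1) = lsum a f i e + if i =? j then a e else 0).
    { intros i. rewrite lsum_S by lia. rewrite Hfe.
      destruct (Z.eqb_spec j1 (i + 1)), (Z.eqb_spec i j); try lia. }
    (* An admissible sum is at most [4 * z] and the accumulated error at most
       [N * 8 * z / L <= 2 * z], so the cutoff [8 * z] never discards this child. *)
    assert (Hlt : nsum SM c j + a e < 8 * z).
    { destruct (Happ j Hj) as [H1 H2].
      pose proof (proj2 Hf j Hj). pose proof (lsum_mono f j (e + 1) (h + 1) ltac:(lia)) as [_ Hm].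
      rewrite Hls, Z.eqb_refl in Hm.
      pose proof (lsum_mono f j e e ltac:(lia)) as [Hm0 _]. pose proof (Ha e).
      pose proof (Hap e He).
      assert (Hab : Z.abs (nsum SM c j - lsum a f j e) * L <= N * (8 * z)) by nia.
      assert (Hs : (nsum SM c j - lsum a f j e) * L <= N * (8 * z)) by nia.
      assert ((nsum SM c j + a e) * L <= 4 * z * L + N * (8 * z)) by nia.
      assert (N * (8 * z) <= 2 * z * L) by nia.
      apply (Z.mul_lt_mono_pos_r L); nia. }
    pose proof (HD c Hc HcS ltac:(apply Hc) j Hj Hlt) as Hc'.
    set (c' := child e SM c j) in *.
    destruct (Hnode c' Hc') as (HS' & Hrng' & Henc' & _).
    assert (Hru : forall i, 0 <= i < k -> rng (updz (nsum SM c) j (nsum SM c j + a e) i)).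
    { intros i Hi. unfold updz. destruct (Z.eqb_spec i j); [|now apply Hrng].
      pose proof (Hrng j Hj) as [? _]. pose proof (Ha e). split; [lia|]. now right. }
    pose proof (enc_inj _ _ Hru Hrng' (eq_sym Henc')) as Hbk.
    exists c'. split; [easy|]. split; [lia|]. intros i Hi.
    specialize (Hbk i Hi). apply bk_close in Hbk; [|now apply Hru|now apply Hrng'].
    destruct Hbk as [Hb1 Hb2]. destruct (Happ i Hi) as [H1 H2]. rewrite Hls.
    unfold updz in Hb1, Hb2. pose proof (Ha e). pose proof (lsum_mono f i e e ltac:(lia)) as [Hm0 _].
    destruct (Z.eqb_spec i j) as [Hij|Hij]; [subst i|].
    + split.
      * set (x := nsum SM c' j) in *. set (y := nsum SM c j) in *. set (u := lsum a f j e) in *.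
        assert (Z.abs (x - (u + a e)) <= Z.abs (y + a e - x) + Z.abs (y - u)) by lia.
        assert (Z.abs (x - (u + a e)) * L <= (Z.abs (y + a e - x) + Z.abs (y - u)) * L)
          by (apply Z.mul_le_mono_nonneg_r; lia). lia.
      * pose proof (Hap e He). lia.
    + rewrite Z.add_0_r. split.
      * set (x := nsum SM c' i) in *. set (y := nsum SM c i) in *. set (u := lsum a f i e) in *.
        assert (Z.abs (x - u) <= Z.abs (y - x) + Z.abs (y - u)) by lia.
        assert (Z.abs (x - u) * L <= (Z.abs (y - x) + Z.abs (y - u)) * L)
          by (apply Z.mul_le_mono_nonneg_r; lia). lia.
      * intros Hu. apply Hb2, H2, Hu.
  - exists c. split; [easy|]. split; [lia|]. intros i Hi. rewrite lsum_S by lia.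
    destruct (Z.eqb_spec (f e) (i + 1)) as [Hf1|_]; [exfalso; apply (Hno (i + 1)); lia|].
    rewrite Z.add_0_r. destruct (Happ i Hi) as [H1 H2]. split; [nia|easy].
Qed.

(** The insertion hits a dead index, so no live node changes. The parent has a smaller stamp than
    [S]; hence parent chains use strictly decreasing elements and end at node 0. *)
Lemma DPI_ins S c j ST PA LB SM ST' PA' LB' SM' :
  base < S -> wl + (S - base) <= h -> 0 <= j < k ->
  DPI S ST PA LB SM -> vld ST c -> ST c < S ->
  let e := wl + (S - base) in let nc := child e SM c j in
  nsum SM c j + a e < 8 * z -> ST nc < base ->
  ST' nc = S -> PA' nc = c -> LB' nc = j + 1 ->
  (forall c', c' <> nc -> ST' c' = ST c' /\ PA' c' = PA c' /\ LB' c' = LB c') ->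
  (forall i, 0 <= i < k -> nsum SM' nc i = updz (nsum SM c) j (nsum SM c j + a e) i) ->
  (forall c', 0 <= c' -> c' <> nc -> forall i, 0 <= i < k -> nsum SM' c' i = nsum SM c' i) ->
  DPI S ST' PA' LB' SM' /\ Ext S ST SM ST' SM'.
Proof.
  intros HS Hh Hj HI Hc HcS e nc Hlt Hnew HST HPA HLB Hoth HSM Hsm.
  destruct HI as (H0 & H1 & H2 & Hnode). destruct (Hnode c Hc) as (_ & Hrng & _ & _).
  assert (Hru : forall i, 0 <= i < k -> rng (updz (nsum SM c) j (nsum SM c j + a e) i)).
  { intros i Hi. unfold updz. destruct (Z.eqb_spec i j); [|now apply Hrng].
    pose proof (Hrng j Hj) as [? _]. pose proof (Ha e). split; [lia|]. now right. }
  pose proof (enc_range _ Hru) as Hncr. fold (child e SM c j) in Hncr. fold nc in Hncr.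
  assert (Hn0 : nc <> 0) by (intros Hx; rewrite Hx in Hnew; lia).
  assert (Hold : forall c', vld ST c' -> c' <> nc) by (intros c' [_ Hx] ->; lia).
  assert (HE : Ext S ST SM ST' SM').
  { split.
    - intros c' Hc'. specialize (Hold c' Hc'). split; [now apply Hoth|].
      intros i Hi. apply Hsm; try easy. apply Hc'.
    - intros c' Hc' Hne. destruct (Z.eq_dec c' nc) as [->|Hx]; [easy|].
      now destruct Hne; apply Hoth. }
  split; [|easy].
  split; [rewrite (proj1 (Hoth 0 ltac:(lia))); easy|].
  split. { intros i Hi. specialize (Hsm 0 ltac:(lia) ltac:(lia) i Hi). unfold nsum in Hsm.
           rewrite Z.mul_0_l, !Z.add_0_l in Hsm. rewrite Hsm. now apply H1. }
  split; [easy|].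
  intros c' Hc'. destruct (Z.eq_dec c' nc) as [->|Hne].
  - rewrite HST, HPA, HLB. split; [lia|]. split; [|split].
    + intros i Hi. rewrite HSM by easy. now apply Hru.
    + rewrite (enc_ext _ (updz (nsum SM c) j (nsum SM c j + a e))) by easy. reflexivity.
    + right. split; [easy|]. split; [eapply Ext_vld; eauto|].
      rewrite (proj1 (proj1 HE c Hc)). split; [easy|]. split; [lia|].
      intros i Hi. rewrite HSM, (proj2 (proj1 HE c Hc)) by easy. unfold updz. fold e.
      destruct (Z.eqb_spec i j), (Z.eqb_spec (j + 1) (i + 1)); try lia. subst i; lia.
  - destruct (Hoth c' Hne) as (E1 & E2 & E3).
    assert (Hv : vld ST c') by (destruct Hc'; split; [easy|lia]).
    destruct (Hnode c' Hv) as (G1 & G2 & G3 & G4).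
    assert (Esv : forall i, 0 <= i < k -> nsum SM' c' i = nsum SM c' i) by now apply HE.
    rewrite E1, E2, E3. split; [easy|]. split; [|split].
    + intros i Hi. rewrite Esv by easy. now apply G2.
    + now rewrite (enc_ext _ (nsum SM c')).
    + destruct G4 as [G4|(G4 & G5 & G6 & G7 & G8)]; [now left|right].
      split; [easy|]. split; [eapply Ext_vld; eauto|].
      rewrite (proj1 (proj1 HE _ G5)). split; [easy|]. split; [easy|].
      intros i Hi. rewrite Esv, (proj2 (proj1 HE _ G5)) by easy. now apply G8.
Qed.

Lemma Ext_refl S ST SM : Ext S ST SM ST SM.
Proof. split; [intros c _; split; reflexivity|]. intros c _ H. now destruct H. Qed.

Lemma Ext_trans S ST SM ST' SM' ST'' SM'' :
  Ext S ST SM ST' SM' -> Ext S ST' SM' ST'' SM'' -> Ext S ST SM ST'' SM''.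
Proof.
  intros H1 H2. split.
  - intros c Hc. pose proof (Ext_vld _ _ _ _ _ _ H1 Hc) as Hc'.
    destruct (proj1 H1 c Hc) as [E1 E2], (proj1 H2 c Hc') as [E3 E4].
    split; [lia|]. intros j Hj. now rewrite E4, E2.
  - intros c Hc Hne. destruct (Z.eq_dec (ST'' c) (ST' c)) as [He|Hn].
    + rewrite He in *. now apply H1.
    + now apply H2.
Qed.

Lemma DPI_mono S S' ST PA LB SM : S <= S' -> DPI S ST PA LB SM -> DPI S' ST PA LB SM.
Proof.
  intros HS (H0 & H1 & H2 & H3). split; [easy|]. split; [easy|]. split; [lia|].
  intros c Hc. destruct (H3 c Hc) as (? & ?). split; [lia|easy].
Qed.

Lemma enc_0 v : (forall j, 0 <= j < k -> v j = 0) -> enc v = 0.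
Proof.
  intros H. transitivity (zs (fun _ => 0) k); [|apply zs_zero]. apply zs_ext.
  intros j Hj. now rewrite H, bk_0.
Qed.

Lemma DPI_init ST PA LB SM : ST 0 = base -> (forall c, 0 < c < KK -> ST c < base) ->
  (forall j, 0 <= j < k -> SM j = 0) -> DPI base ST PA LB SM.
Proof.
  intros H0 Hlt H1. split; [easy|]. split; [easy|]. split; [lia|]. intros c [Hc Hs].
  destruct (Z.eq_dec c 0) as [->|]; [|specialize (Hlt c); lia].
  split; [lia|]. assert (Hsv : forall j, 0 <= j < k -> nsum SM 0 j = 0) by (intros; now apply H1).
  split; [|split].
  - intros j Hj. rewrite Hsv by easy. unfold rng. lia.
  - now apply enc_0.
  - now left.
Qed.
End DP.

(** * The program *)

Local Notation xp := 0%nat (only parsing). Local Notation xq := 1%nat (only parsing). Local Notation xn := 2%nat (only parsing).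
Local Notation xE := 3%nat (only parsing). Local Notation xP := 4%nat (only parsing). Local Notation xl := 5%nat (only parsing).
Local Notation xN := 6%nat (only parsing). Local Notation xL := 7%nat (only parsing). Local Notation xK := 8%nat (only parsing).
Local Notation xM := 9%nat (only parsing). Local Notation xm := 10%nat (only parsing). Local Notation xv := 11%nat (only parsing).
Local Notation xS := 12%nat (only parsing). Local Notation xh := 13%nat (only parsing). Local Notation xw := 14%nat (only parsing).
Local Notation xz := 15%nat (only parsing). Local Notation xt := 16%nat (only parsing). Local Notation xb := 17%nat (only parsing).
Local Notation xe := 18%nat (only parsing). Local Notation xc := 19%nat (only parsing). Local Notation xpw := 20%nat (only parsing).
Local Notation xj := 21%nat (only parsing). Local Notation xs := 22%nat (only parsing). Local Notation xns := 23%nat (only parsing).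
Local Notation xnc := 24%nat (only parsing). Local Notation xjj := 25%nat (only parsing). Local Notation xMx := 26%nat (only parsing).
Local Notation xmn := 27%nat (only parsing). Local Notation xr := 28%nat (only parsing). Local Notation xx := 29%nat (only parsing). Local Notation xy := 30%nat (only parsing).
Local Notation aA := 0%nat (only parsing). Local Notation aST := 1%nat (only parsing). Local Notation aPA := 2%nat (only parsing). Local Notation aLB := 3%nat (only parsing).
Local Notation aSM := 4%nat (only parsing). Local Notation aOUT := 5%nat (only parsing). Local Notation aFIN := 6%nat (only parsing).

Declare Scope prog_scope.
Delimit Scope prog_scope with prog.
Local Notation "a ;; b" := (Seq a b) (at level 90, right associativity).
Local Notation "x ::= e" := (Asg x e%prog) (at level 80).
Local Notation "$ x" := (Var x%nat) (at level 5) : prog_scope.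
Local Notation "# z" := (Cst z%Z) (at level 5) : prog_scope.
Local Notation "b .[ e ]" := (Arr b%nat e%prog) (at level 2, left associativity) : prog_scope.
Local Notation "b :[ e1 ] ::= e2" := (Sto b%nat e1%prog e2%prog) (at level 80, e1 at level 200).
Local Infix "+" := (Bin Add) : prog_scope.
Local Infix "-" := (Bin Sub) : prog_scope.
Local Infix "*" := (Bin Mul) : prog_scope.
Local Infix "/" := (Bin Div) : prog_scope.
Local Notation "'If' e1 < e2 'Then' c1 'Fi'" := (Ifl e1%prog e2%prog c1)
  (at level 89, e1 at level 69, e2 at level 69, c1 at level 200).
Local Notation "'While' e1 < e2 'Do' c 'Od'" := (Whl e1%prog e2%prog c)
  (at level 89, e1 at level 69, e2 at level 69, c at level 200).

Section Program.
Variable k : Z.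

Definition bkE (e : expr) : expr := ((e * $xL + #8 * $xz - #1) / (#8 * $xz))%prog.

Definition COPY : cmd :=
  xjj ::= #0 ;;
  While $xjj < #k Do
    aSM:[$xnc * #k + $xjj] ::= aSM.[$xc * #k + $xjj] ;;
    xjj ::= $xjj + #1
  Od.

Definition INSERT : cmd :=
  aST:[$xnc] ::= $xS ;; aPA:[$xnc] ::= $xc ;; aLB:[$xnc] ::= $xj + #1 ;;
  COPY ;; aSM:[$xnc * #k + $xj] ::= $xns.

Definition JBODY : cmd :=
  xs ::= aSM.[$xc * #k + $xj] ;;
  xns ::= $xs + aA.[$xe] ;;
  If $xns < #8 * $xz Then
    xnc ::= $xc + (bkE $xns - bkE $xs) * $xpw ;;
    If aST.[$xnc] < $xb Then INSERT Fi
  Fi ;;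
  xpw ::= $xpw * ($xL + #1) ;;
  xj ::= $xj + #1.

Definition JLOOP : cmd :=
  xpw ::= #1 ;; xj ::= #0 ;; While $xj < #k Do JBODY Od.

(** Guards are strict, so [base <= ST c] is expressed with [+ #1]. The second guard skips nodes
    created in the current round. *)
Definition CBODY : cmd :=
  If $xb < aST.[$xc] + #1 Then If aST.[$xc] < $xS Then JLOOP Fi Fi ;;
  xc ::= $xc + #1.

Definition EBODY : cmd :=
  xe ::= $xe + #1 ;; xS ::= $xS + #1 ;; xc ::= #0 ;;
  While $xc < $xK Do CBODY Od.

Definition DPROG : cmd :=
  xb ::= $xS ;; aST:[#0] ::= $xS ;; xe ::= $xw ;;
  While $xe < $xh Do EBODY Od.


(** The value [-1] marks a minimum not yet set. [xr] advances through the singletons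
    [h+1, h+2, ...], one for each empty set. *)
Definition SCORE : cmd :=
  xMx ::= #0 ;; xmn ::= #(-1) ;; xr ::= $xh ;; xj ::= #0 ;;
  While $xj < #k Do
    xs ::= aSM.[$xc * #k + $xj] ;;
    If $xs < #1 Then xr ::= $xr + #1 ;; xs ::= aA.[$xr] Fi ;;
    If $xMx < $xs Then xMx ::= $xs Fi ;;
    If $xmn < #0 Then xmn ::= $xs Fi ;;
    If $xs < $xmn Then xmn ::= $xs Fi ;;
    xj ::= $xj + #1
  Od.

Definition TRACE : cmd :=
  While $xb < aST.[$xnc] Do
    aOUT:[$xw + aST.[$xnc] - $xb] ::= $xS * #(k + 1) + aLB.[$xnc] ;;
    xnc ::= aPA.[$xnc]
  Od.

Definition FILL : cmd :=
  While $xj < #k Do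
    If aSM.[$xc * #k + $xj] < #1 Then
      xr ::= $xr + #1 ;; aOUT:[$xr] ::= $xS * #(k + 1) + $xj + #1
    Fi ;;
    xj ::= $xj + #1
  Od.

Definition RECORD : cmd :=
  xM ::= $xMx ;; xm ::= $xmn ;; xv ::= $xS ;; xnc ::= $xc ;;
  TRACE ;;
  xr ::= $xh ;; xj ::= #0 ;;
  FILL.

(** Ratios are compared by cross multiplication, the initial [1 / 0] being beaten by any positive
    minimum. [xS] grows at every node, so each recording has a fresh version number and the next
    dynamic program starts above all old stamps. *)
Definition VBODY : cmd :=
  If $xb < aST.[$xc] + #1 Then
    SCORE ;; If $xMx * $xm < $xM * $xmn Then RECORD Fi
  Fi ;;
  xS ::= $xS + #1 ;; xc ::= $xc + #1.

Definition ELOOP : cmd := xc ::= #0 ;; While $xc < $xK Do VBODY Od.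

Definition TBODY : cmd := DPROG ;; ELOOP ;; xz ::= $xz + $xz ;; xt ::= $xt + #1.

Definition HBODY : cmd :=
  xw ::= #0 ;; If $xN < $xh Then xw ::= $xh - $xN Fi ;;
  xz ::= aA.[$xh] ;; xt ::= #0 ;;
  While $xt < $xl Do TBODY Od ;;
  xh ::= $xh + #1.

Definition MAIN : cmd := xh ::= #0 ;; While $xh < $xn + #1 Do HBODY Od.

(** The elements in cells below 61 are already in [aA] when this starts, so copying begins at cell
    [zR]. Cell [x] holds element [x - 2]. *)
Definition INIT : cmd :=
  xE ::= $xq / $xp + #1 ;;
  xP ::= #1 ;; xl ::= #0 ;;
  While $xP < #(20 * k) * $xE * $xE Do xP ::= $xP + $xP ;; xl ::= $xl + #1 Od ;;
  xN ::= $xl * #k * $xE ;;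
  xL ::= #40 * $xN * $xE ;;
  xK ::= #1 ;; xj ::= #0 ;;
  While $xj < #k Do xK ::= $xK * ($xL + #1) ;; xj ::= $xj + #1 Od ;;
  xM ::= #1 ;; xm ::= #0 ;; xv ::= #0 ;; xS ::= #1 ;;
  xx ::= #zR ;;
  While $xx < $xn + #3 Do
    Rld xs xx ;; aA:[$xx - #2] ::= $xs ;; xx ::= $xx + #1
  Od.

(** The output cell of element [x] is [n + 2 + x]. If it is below 61 it is in use as a register or
    stack cell, so labels are also kept in [aFIN], indexed by the number of the cell, from which
    these cells are filled at the very end. *)
Definition FINAL : cmd :=
  xx ::= #1 ;;
  While $xx < $xn + #1 Do
    xs ::= #0 ;;
    If $xv * #(k + 1) < aOUT.[$xx] Then xs ::= aOUT.[$xx] - $xv * #(k + 1) Fi ;;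
    xy ::= $xn + #2 + $xx ;;
    aFIN:[$xy] ::= $xs ;;
    If #(zR - 1) < $xy Then Rst xy xs Fi ;;
    xx ::= $xx + #1
  Od.

Definition PROG : cmd := INIT ;; MAIN ;; FINAL.

End Program.

(** * Verification of the dynamic program *)

Ltac simpg := cbn [rg ar raw setr seta setraw ev evop ok Nat.eqb].

Lemma idx_inj k c c' i i' : 0 <= i < k -> 0 <= i' < k -> c * k + i = c' * k + i' -> c = c'.
Proof.
  intros Hi Hi' H. transitivity ((c * k + i) / k).
  - apply (Z.div_unique _ k c i); lia.
  - symmetry. apply (Z.div_unique _ k c' i'); lia.
Qed.

Section Verif.
Variables (Y lo hi : Z) (a : Z -> Z) (n k l N L : Z).
Hypothesis Hk : 1 <= k.
Hypothesis HL : 1 <= L.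
Hypothesis Ha : forall x, 0 <= a x.
Notation K := (KK k L).
Notation T := (T Y lo hi).

Definition genv (s : st) : Prop :=
  rg s xn = n /\ rg s xN = N /\ rg s xL = L /\ rg s xK = K /\ rg s xl = l /\
  forall i, 0 <= i -> ar s aA i = a i.

Lemma env0_fr c s s' : frame c s s' ->
  wv xn c || wv xN c || wv xL c || wv xK c || wv xl c || wa aA c = false -> genv s -> genv s'.
Proof.
  intros (Hv & Hw & _) H (E1 & E2 & E3 & E4 & E5 & E6).
  repeat (apply Bool.orb_false_elim in H; destruct H as [H ?]).
  unfold genv. rewrite !Hv, Hw by assumption. easy.
Qed.

Section HT.
Variables (h wl z base : Z).
Hypothesis Hz : 0 <= z.
Hypothesis Hwl : 0 <= wl <= h.
Hypothesis Hap : forall x, wl < x <= h -> 0 < a x.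

Notation DPI := (DPI a k L z wl base).
Notation Ext := (Ext k L base).
Notation vld := (vld k L base).
Notation Cov := (Cov a k L z h wl base).
Notation Done := (Done a k L z base).
Notation chd := (child a k L z).
Notation sv := (nsum k).

Definition dpst (S : Z) (s : st) : Prop := DPI S (ar s aST) (ar s aPA) (ar s aLB) (ar s aSM).

Definition henv (s : st) : Prop :=
  genv s /\ rg s xh = h /\ rg s xw = wl /\ rg s xz = z /\ rg s xb = base.

Lemma env1_fr c s s' : frame c s s' ->
  wv xn c || wv xN c || wv xL c || wv xK c || wv xl c || wa aA c = false ->
  wv xh c || wv xw c || wv xz c || wv xb c = false -> henv s -> henv s'.
Proof.
  intros Hf H H' (E0 & E1 & E2 & E3 & E4). split; [eapply env0_fr; eauto|].
  destruct Hf as (Hv & _).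
  repeat (apply Bool.orb_false_elim in H'; destruct H' as [H' ?]).
  rewrite !Hv by assumption. easy.
Qed.

Variable amx : Z.
Hypothesis Hamx : forall x, a x <= amx.
Hypothesis HYz : 8 * z + amx + k + K + 10 <= Y.

Lemma basics : 1 <= K /\ 0 <= amx /\ k + 10 <= Y /\ 8 * z + amx <= Y /\ K <= Y.
Proof.
  pose proof (Z.pow_pos_nonneg (L + 1) k ltac:(lia) ltac:(lia)). unfold KK in *.
  pose proof (Ha 0). pose proof (Hamx 0). lia.
Qed.

Lemma COPY_ok s c nc :
  rg s xc = c -> rg s xnc = nc -> 0 <= c -> 0 <= nc -> c <> nc ->
  (forall j, 0 <= j < k -> Z.abs (sv (ar s aSM) c j) <= Y) ->
  spec Y lo hi (COPY k) s (3 * k + 2) (fun s' => (forall j, 0 <= j < k -> sv (ar s' aSM) nc j = sv (ar s aSM) c j) /\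
     (forall c', 0 <= c' -> c' <> nc -> forall j, 0 <= j < k -> sv (ar s' aSM) c' j = sv (ar s aSM) c' j)).
Proof.
  intros Hc Hnc Hc0 Hnc0 Hne Hb. pose proof basics as HBS.
  apply spec_intro. intros t Ht.
  unfold COPY. apply T_asg'; simpg; [easy|lia|].
  eapply T_while with (mu := fun s' => k - rg s' xjj) (tb := 2)
    (I := fun s' => 0 <= rg s' xjj <= k /\
       (forall j, 0 <= j < rg s' xjj -> sv (ar s' aSM) nc j = sv (ar s aSM) c j) /\
       (forall c', 0 <= c' -> c' <> nc -> forall j, 0 <= j < k -> sv (ar s' aSM) c' j = sv (ar s aSM) c' j)).
  - lia.
  - intros s' (Hj & H1 & H2) Hf. simpg.
    assert (E1 : rg s' xc = c) by (rewrite (proj1 Hf xc eq_refl); exact Hc).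
    assert (E2 : rg s' xnc = nc) by (rewrite (proj1 Hf xnc eq_refl); exact Hnc).
    set (jj := rg s' xjj) in *.
    split; [lia|]. split; [easy|]. split; [easy|]. split.
    + intros Hlt. fold jj.
      assert (Hread : ar s' aSM (c * k + jj) = sv (ar s aSM) c jj).
      { apply (H2 c Hc0 Hne). lia. }
      apply T_sto'; simpg; rewrite ?E1, ?E2; fold jj.
      * split; [easy|split; easy].
      * split; [split; [split; easy|easy]|]. nia.
      * nia.
      * rewrite Hread. apply Hb. lia.
      * rewrite Hread. apply T_asg; simpg; fold jj; [easy|lia|lia|].
        intros _. split; [|lia]. split; [lia|]. split.
        -- intros j Hj'. unfold nsum. destruct (Z.eqb_spec (nc * k + j) (nc * k + jj)).
           ++ assert (j = jj) by lia. now subst j.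
           ++ apply H1. lia.
        -- intros c' Hc' Hne' j Hj'. unfold nsum. destruct (Z.eqb_spec (c' * k + j) (nc * k + jj)).
           ++ exfalso. apply Hne'. eapply (idx_inj k); [exact Hj'| |eassumption]. lia.
           ++ now apply H2.
    + intros Hge. split; [|easy]. intros j Hj'. apply H1. lia.
  - simpg. split; [lia|]. split; [intros j Hj; lia|easy].
  - simpg. lia.
Qed.

Section Elem.
Variables (e S : Z).
Hypothesis He : e = wl + (S - base).
Hypothesis HS : base < S.
Hypothesis Heh : e <= h.
Hypothesis HSY : 0 <= S <= Y.

Definition eenv (s : st) : Prop := henv s /\ rg s xe = e /\ rg s xS = S.

Lemma env2_fr c s s' : frame c s s' ->
  wv xn c || wv xN c || wv xL c || wv xK c || wv xl c || wa aA c = false ->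
  wv xh c || wv xw c || wv xz c || wv xb c = false ->
  wv xe c || wv xS c = false -> eenv s -> eenv s'.
Proof.
  intros Hf H H' H'' (E0 & E1 & E2). split; [eapply env1_fr; eauto|].
  destruct Hf as (Hv & _).
  repeat (apply Bool.orb_false_elim in H''; destruct H'' as [H'' ?]).
  rewrite !Hv by assumption. easy.
Qed.

Lemma pow_K j : 0 <= j <= k -> 1 <= (L + 1) ^ j <= K.
Proof.
  intros Hj. unfold KK. split.
  - pose proof (Z.pow_pos_nonneg (L + 1) j ltac:(lia) ltac:(lia)). lia.
  - apply Z.pow_le_mono_r; lia.
Qed.

(** Three outcomes: the sum exceeds the cutoff, the index of the child is already alive, or it is
    dead and the child is inserted. In the last two the child index ends up alive, which is all that
    [Done] asks. *)
Lemma JBODY_ok s c j :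
  eenv s -> rg s xc = c -> rg s xj = j -> rg s xpw = (L + 1) ^ j -> 0 <= j < k ->
  dpst S s -> vld (ar s aST) c -> ar s aST c < S ->
  spec Y lo hi (JBODY k) s (3 * k + 15) (fun s' => dpst S s' /\
     Ext S (ar s aST) (ar s aSM) (ar s' aST) (ar s' aSM) /\
     (sv (ar s aSM) c j + a e < 8 * z -> vld (ar s' aST) (chd e (ar s aSM) c j)) /\
     rg s' xj = j + 1 /\ rg s' xpw = (L + 1) ^ (j + 1)).
Proof.
  intros Henv Hc Hj Hpw Hjk HI Hv HcS. pose proof basics as HBS.
  apply spec_intro. intros t Ht.
  destruct Henv as ((Henv0 & E1 & E2 & E3 & E4) & E5 & E6).
  destruct Henv0 as (F1 & F2 & F3 & F4 & F5 & F6).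
  pose proof HI as (H0 & Hr0 & HbS & Hnode).
  destruct (Hnode c Hv) as (Hst & Hrng & Henc & _).
  assert (Hc0 : 0 <= c < K) by apply Hv.
  pose proof (Hrng j Hjk) as Hrj. destruct Hrj as [Hr1 Hr2].
  assert (Hrk : 0 <= amx) by (pose proof (Ha 0); pose proof (Hamx 0); lia).
  assert (He0 : 0 <= e) by lia.
  set (sj := sv (ar s aSM) c j) in *.
  assert (Hread : ar s aSM (c * k + j) = sj) by reflexivity.
  pose proof (Ha e) as Hae. pose proof (Hamx e) as Hae'.
  unfold JBODY.
  apply T_asg'; simpg; rewrite ?Hc, ?Hj.
  { split; [split; [split; easy|easy]|]. nia. }
  { rewrite Hread. lia. }
  rewrite Hread.
  apply T_asg'; simpg; rewrite ?E5, ?F6 by lia.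
  { split; [easy|]. split; [easy|lia]. }
  { lia. }
  assert (Hpwj : (L + 1) ^ (j + 1) = (L + 1) ^ j * (L + 1)) by (rewrite Z.pow_add_r, Z.pow_1_r by lia; ring).
  assert (Hpwb : Z.abs ((L + 1) ^ j * (L + 1)) <= Y).
  { rewrite <- Hpwj. pose proof (pow_K (j + 1) ltac:(lia)). lia. }
  assert (Hid : Ext S (ar s aST) (ar s aSM) (ar s aST) (ar s aSM)).
  { split; [easy|]. now intros c' _ []. }
  apply T_if'; simpg; rewrite ?E3; [easy|easy| |].
  - intros Hlt. apply T_assoc. set (nc := chd e (ar s aSM) c j).
    assert (Hru : forall i, 0 <= i < k -> rng z (updz (sv (ar s aSM) c) j (sj + a e) i)).
    { intros i Hi. unfold updz. destruct (Z.eqb_spec i j); [|now apply Hrng]. split; [lia|now right]. }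
    assert (Hncr : 0 <= nc < K) by (apply (enc_range k L z); try lia; apply Hru).
    assert (Hnc : c + ((((sj + a e) * L + 8 * z - 1) / (8 * z)) - ((sj * L + 8 * z - 1) / (8 * z))) * (L + 1) ^ j = nc).
    { unfold nc, child. rewrite enc_upd by lia. rewrite Henc. reflexivity. }
    apply T_asg'; unfold bkE; simpg; rewrite ?Hc, ?F3, ?E3, ?Hpw.
    { easy. }
    { rewrite Hnc. lia. }
    rewrite Hnc.
    apply T_if'; simpg; rewrite ?E4; [lia|easy| |].
    + intros Hnew. unfold INSERT. apply T_assoc.
      apply T_sto'; simpg; rewrite ?E6; [easy|easy|lia|lia|]. apply T_assoc.
      apply T_sto'; simpg; rewrite ?Hc; [easy|easy|lia|lia|]. apply T_assoc.
      apply T_sto'; simpg; rewrite ?Hj; [easy|easy|lia|lia|]. apply T_assoc.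
      assert (Hcn : c <> nc) by (intros Hx; rewrite <- Hx in Hnew; destruct Hv; lia).
      eapply (T_seq Y lo hi (3 * k + 2)), (COPY_ok _ c nc); simpg; try easy; try lia.
      { intros i Hi. specialize (Hrng i Hi). destruct Hrng as [? [?|?]]; lia. }
      intros s' Hf (HC1 & HC2). simpg.
      assert (G1 : rg s' xns = sj + a e) by now rewrite (proj1 Hf xns eq_refl).
      assert (G2 : rg s' xnc = nc) by now rewrite (proj1 Hf xnc eq_refl).
      assert (G3 : rg s' xj = j) by (rewrite (proj1 Hf xj eq_refl); exact Hj).
      assert (G4 : rg s' xpw = (L + 1) ^ j) by (rewrite (proj1 Hf xpw eq_refl); exact Hpw).
      assert (G5 : rg s' xL = L) by (rewrite (proj1 Hf xL eq_refl); exact F3).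
      pose proof (proj1 (proj2 Hf) aST eq_refl) as A1.
      pose proof (proj1 (proj2 Hf) aPA eq_refl) as A2.
      pose proof (proj1 (proj2 Hf) aLB eq_refl) as A3.
      cbn [rg ar raw setr seta setraw ev evop ok Nat.eqb] in A1, A2, A3, HC1, HC2.
      apply T_sto'; simpg; rewrite ?G1, ?G2, ?G3; [easy|easy|nia|lia|].
      apply T_asg'; simpg; rewrite ?G4, ?G5; [easy|easy|].
      apply T_asg; simpg; rewrite ?G3; [easy|lia|lia|].
      destruct (DPI_ins a k L z h wl base Hk HL Hz Ha S c j
        (ar s aST) (ar s aPA) (ar s aLB) (ar s aSM)
        (ar s' aST) (ar s' aPA) (ar s' aLB)
        (fun i => if i =? nc * k + j then sj + a e else ar s' aSM i)) as [HI' HE'];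
        try rewrite <- He; try easy; try lia.
      * fold nc. rewrite A1. now rewrite Z.eqb_refl.
      * fold nc. rewrite A2. now rewrite Z.eqb_refl.
      * fold nc. rewrite A3. now rewrite Z.eqb_refl.
      * fold nc. intros c' Hc'. rewrite A1, A2, A3. apply Z.eqb_neq in Hc'. now rewrite Hc'.
      * fold nc sj. intros i Hi. unfold nsum at 1, updz.
        destruct (Z.eqb_spec (nc * k + i) (nc * k + j)), (Z.eqb_spec i j); try lia. now apply HC1.
      * fold nc. intros c' Hc' Hne i Hi. unfold nsum.
        destruct (Z.eqb_spec (c' * k + i) (nc * k + j)); [exfalso; apply Hne; eapply idx_inj; [exact Hi|exact Hjk|eassumption]|].
        now apply HC2.
      * split; [exact HI'|]. split; [exact HE'|]. split; [|now rewrite Hpwj].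
        intros _. fold nc. split; [easy|]. rewrite A1, Z.eqb_refl. lia.
    + intros Hold.
      apply T_asg'; simpg; rewrite ?Hpw, ?F3; [easy|easy|].
      apply T_asg; simpg; rewrite ?Hj; [easy|lia|lia|].
      split; [exact HI|]. split; [exact Hid|]. split; [|now rewrite Hpwj].
      intros _. fold nc. now split.
  - intros Hge.
    apply T_asg'; simpg; rewrite ?Hpw, ?F3; [easy|easy|].
    apply T_asg; simpg; rewrite ?Hj; [easy|lia|lia|].
    split; [exact HI|]. split; [exact Hid|]. split; [lia|now rewrite Hpwj].
Qed.

Definition tJ : Z := 3 * k * k + 16 * k + 3.

Lemma JLOOP_ok s c :
  eenv s -> rg s xc = c -> dpst S s -> vld (ar s aST) c -> ar s aST c < S ->
  Cov (e - 1) S (ar s aST) (ar s aSM) -> Done S e c (ar s aST) (ar s aSM) ->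
  spec Y lo hi (JLOOP k) s tJ (fun s' => dpst S s' /\
     Cov (e - 1) S (ar s' aST) (ar s' aSM) /\ Done S e (c + 1) (ar s' aST) (ar s' aSM)).
Proof.
  intros Henv Hc HI Hv HcS HC HD. pose proof basics as HBS.
  apply spec_intro. intros t Ht.
  unfold JLOOP. apply T_asg'; simpg; [easy|lia|]. apply T_asg'; simpg; [easy|lia|].
  eapply T_while with (mu := fun s' => k - rg s' xj) (tb := 3 * k + 15)
    (I := fun s' => 0 <= rg s' xj <= k /\ rg s' xpw = (L + 1) ^ rg s' xj /\ dpst S s' /\
       Ext S (ar s aST) (ar s aSM) (ar s' aST) (ar s' aSM) /\
       forall j, 0 <= j < rg s' xj -> sv (ar s aSM) c j + a e < 8 * z ->
         vld (ar s' aST) (chd e (ar s aSM) c j)).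
  - lia.
  - intros s' (Hj & Hpw & HI' & HE & Hd) Hf. simpg.
    split; [lia|]. split; [easy|]. split; [easy|]. split.
    + intros Hlt. destruct (proj1 HE c Hv) as [E1 E2].
      eapply JBODY_ok with (c := c) (j := rg s' xj); try easy; try lia.
      * eapply env2_fr; [exact Hf|reflexivity..|exact Henv].
      * rewrite (proj1 Hf xc eq_refl). exact Hc.
      * eapply Ext_vld; eassumption.
      * intros s2 Hf2 (HI2 & HE2 & Hch & Hj2 & Hpw2) _. split; [|lia].
        split; [lia|]. split; [now rewrite Hj2|]. split; [exact HI2|].
        split; [eapply Ext_trans; eassumption|].
        (* Children are described by the sums at loop entry; since [c] is alive, its sums have not
           changed since. *)
        intros j Hjj Hlt'. rewrite Hj2 in Hjj. destruct (Z.eq_dec j (rg s' xj)) as [->|].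
        -- rewrite <- (chd_ext a k L z _ (ar s' aSM)); [|lia|exact E2].
           apply Hch. now rewrite E2 by lia.
        -- eapply Ext_vld; [exact HE2|]. apply Hd; [lia|easy].
    + intros Hge. split; [exact HI'|]. split; [eapply Cov_ext; eassumption|].
      pose proof (Done_ext a k L z base S e c _ _ _ _ HE HD) as HD'.
      intros c' Hc' Hs' Hcc j Hjk Hlt. destruct (Z.eq_dec c' c) as [->|].
      * destruct (proj1 HE c Hv) as [E1 E2].
        rewrite (chd_ext a k L z (ar s aSM)); [|easy|exact E2].
        apply Hd; [lia|]. now rewrite <- E2.
      * apply HD'; try easy. lia.
  - simpg. split; [lia|]. split; [now rewrite Z.pow_0_r|]. split; [exact HI|].
    split; [apply Ext_refl|]. intros j Hj; lia.
  - simpg. unfold tJ in Ht. lia.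
Qed.

Definition tC : Z := tJ + 3.

Lemma CBODY_ok s c :
  eenv s -> rg s xc = c -> 0 <= c < K -> dpst S s ->
  Cov (e - 1) S (ar s aST) (ar s aSM) -> Done S e c (ar s aST) (ar s aSM) ->
  spec Y lo hi (CBODY k) s tC (fun s' => rg s' xc = c + 1 /\ dpst S s' /\
     Cov (e - 1) S (ar s' aST) (ar s' aSM) /\ Done S e (c + 1) (ar s' aST) (ar s' aSM)).
Proof.
  intros Henv Hc Hck HI HC HD. pose proof basics as HBS.
  apply spec_intro. intros t Ht.
  pose proof Henv as ((Henv0 & E1 & E2 & E3 & E4) & E5 & E6).
  assert (HtJ : 0 <= tJ) by (unfold tJ; nia). unfold tC in Ht.
  assert (Hskip : forall t', 1 <= t' -> (ar s aST c < base \/ S <= ar s aST c) ->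
    T (xc ::= $xc + #1) s t' (fun s' => rg s' xc = c + 1 /\ dpst S s' /\
     Cov (e - 1) S (ar s' aST) (ar s' aSM) /\ Done S e (c + 1) (ar s' aST) (ar s' aSM))).
  { intros t' Ht' Hdead. apply T_asg; simpg; rewrite ?Hc; [easy|lia|lia|].
    split; [easy|]. split; [exact HI|]. split; [exact HC|].
    intros c' Hc' HcS Hcc. destruct (Z.eq_dec c' c) as [->|].
    - destruct Hc' as [_ Hc']. lia.
    - apply HD; try easy. lia. }
  unfold CBODY. apply T_if'; simpg; rewrite ?Hc, ?E4; [easy|split; [split; [easy|lia]|easy]| |].
  - intros Hb. apply T_if'; simpg; rewrite ?Hc, ?E6; [split; [easy|lia]|easy| |].
    + intros HS'. eapply (T_seq Y lo hi tJ), JLOOP_ok; try eassumption.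
      * split; [easy|lia].
      * lia.
      * intros s' Hf (HI' & HC' & HD'). apply T_asg; simpg; rewrite ?(proj1 Hf xc eq_refl), ?Hc;
          [easy|lia|lia|]. auto.
    + intros HS'. apply Hskip; lia.
  - intros Hb. apply Hskip; lia.
Qed.

Definition tE : Z := 4 + K * (tC + 1).

Lemma EBODY_ok s :
  wl < e -> h - wl <= N -> 4 * N <= L ->
  henv s -> rg s xe = e - 1 -> rg s xS = S - 1 -> dpst (S - 1) s ->
  Cov (e - 1) S (ar s aST) (ar s aSM) -> h <= Y ->
  spec Y lo hi (EBODY k) s tE (fun s' => rg s' xe = e /\ rg s' xS = S /\ dpst S s' /\
     Cov e (S + 1) (ar s' aST) (ar s' aSM)).
Proof.
  intros Hwe HN1 HN2 Henv Hxe HxS HI HC HhY. pose proof basics as HBS.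
  apply spec_intro. intros t Ht.
  assert (HtC : 0 <= tC) by (unfold tC, tJ; nia). unfold tE in Ht.
  unfold EBODY. apply T_asg'; simpg; rewrite ?Hxe; [easy|lia|].
  apply T_asg'; simpg; rewrite ?HxS; [easy|lia|].
  apply T_asg'; simpg; [easy|lia|].
  replace (e - 1 + 1) with e by ring. replace (S - 1 + 1) with S by ring.
  set (s0 := setr _ _ _).
  assert (Henv2 : eenv s0).
  { unfold s0, eenv, henv, genv in *. simpg. easy. }
  eapply T_while with (mu := fun s' => K - rg s' xc) (tb := tC)
    (I := fun s' => 0 <= rg s' xc <= K /\ dpst S s' /\
       Cov (e - 1) S (ar s' aST) (ar s' aSM) /\ Done S e (rg s' xc) (ar s' aST) (ar s' aSM)).
  - lia.
  - intros s' (Hc & HI' & HC' & HD') Hf. simpg.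
    assert (Henv' : eenv s') by (eapply env2_fr; [exact Hf|reflexivity..|exact Henv2]).
    pose proof Henv' as (((F1 & F2 & F3 & F4 & F5 & F6) & _) & G1 & G2). rewrite F4.
    split; [lia|]. split; [easy|]. split; [easy|]. split.
    + intros Hlt. eapply CBODY_ok with (c := rg s' xc); try easy; try lia.
      intros s2 Hf2 (Hc2 & HI2 & HC2 & HD2) _. rewrite Hc2. split; [|lia]. split; [lia|]. easy.
    + intros Hge. split; [easy|]. split; [easy|]. split; [exact HI'|].
      eapply (Cov_step a k L z h wl base) with (N := N); try eassumption; try lia; try easy.
      assert (Hcc : rg s' xc = K) by lia. now rewrite <- Hcc.
  - unfold s0. simpg. split; [lia|]. split; [|split; [exact HC|]].
    + apply DPI_mono with (S := S - 1); [lia|exact HI].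
    + intros c Hc _ Hc0. destruct Hc. lia.
  - unfold s0. simpg. lia.
Qed.

End Elem.

Definition tD : Z := 4 + N * (tE + 1).

(** No initialization of the table: all earlier stamps are below [base], so every node but 0 counts
    as dead. Node 0 keeps zero sums throughout. *)
Lemma DPROG_ok s :
  h - wl <= N -> 4 * N <= L -> 0 <= base -> base + N <= Y -> h <= Y ->
  genv s -> rg s xh = h -> rg s xw = wl -> rg s xz = z -> rg s xS = base ->
  (forall c, 0 <= c < K -> ar s aST c < base) -> (forall j, 0 <= j < k -> ar s aSM j = 0) ->
  spec Y lo hi (DPROG k) s tD (fun s' => henv s' /\ rg s' xS = base + (h - wl) /\
     dpst (base + (h - wl)) s' /\ (forall c, 0 <= c < K -> ar s' aST c <= base + (h - wl)) /\
     Cov h (base + (h - wl) + 1) (ar s' aST) (ar s' aSM)).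
Proof.
  intros HN1 HN2 Hb0 HbY HhY Henv Hh Hw Hxz HxS Hst Hsm. pose proof basics as HBS.
  apply spec_intro. intros t Ht.
  assert (HtE : 0 <= tE) by (unfold tE, tC, tJ; nia). unfold tD in Ht.
  unfold DPROG. apply T_asg'; simpg; rewrite ?HxS; [easy|lia|].
  apply T_sto'; simpg; rewrite ?HxS; [easy|easy|lia|lia|].
  apply T_asg'; simpg; rewrite ?Hw; [easy|lia|].
  set (s0 := setr _ _ _).
  assert (Henv1 : henv s0).
  { unfold s0, henv, genv in *. simpg. easy. }
  eapply T_while with (mu := fun s' => h - rg s' xe) (tb := tE)
    (I := fun s' => wl <= rg s' xe <= h /\ rg s' xS = base + (rg s' xe - wl) /\
       dpst (rg s' xS) s' /\ (forall c, 0 <= c < K -> ar s' aST c <= rg s' xS) /\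
       Cov (rg s' xe) (rg s' xS + 1) (ar s' aST) (ar s' aSM)).
  - lia.
  - intros s' (He & HS & HI' & Hle & HC') Hf. simpg.
    assert (Henv' : henv s') by (eapply env1_fr; [exact Hf|reflexivity..|exact Henv1]).
    pose proof Henv' as (Henv0 & F1 & F2 & F3 & F4). rewrite F1.
    split; [lia|]. split; [easy|]. split; [easy|]. split.
    + intros Hlt. eapply EBODY_ok with (e := rg s' xe + 1) (S := rg s' xS + 1); try easy; try lia.
      * now replace (rg s' xS + 1 - 1) with (rg s' xS) by ring.
      * now replace (rg s' xe + 1 - 1) with (rg s' xe) by ring.
      * intros s2 Hf2 (He2 & HS2 & HI2 & HC2) _. rewrite He2, HS2. split; [|lia].
        split; [lia|]. split; [lia|]. split; [exact HI2|]. split; [|exact HC2].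
        intros c Hc. destruct (Z_le_gt_dec base (ar s2 aST c)) as [Hv|]; [|lia].
        destruct HI2 as (_ & _ & _ & HI2). now destruct (HI2 c (conj Hc Hv)).
    + intros Hge. assert (Heh : rg s' xe = h) by lia. rewrite Heh in *. rewrite <- HS. auto.
  - unfold s0. simpg. split; [lia|]. split; [lia|]. rewrite HxS.
    assert (HI0 : DPI base (fun i' => if i' =? 0 then base else ar s aST i') (ar s aPA) (ar s aLB) (ar s aSM)).
    { apply DPI_init; try lia; try easy. intros c Hc. destruct (Z.eqb_spec c 0); [lia|]. apply Hst. lia. }
    split; [exact HI0|]. split.
    + intros c Hc. destruct (c =? 0); [lia|]. specialize (Hst c Hc). lia.
    + eapply Cov_init; [..|exact HI0]; try lia.
  - unfold s0. simpg. nia.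
Qed.


Hypothesis Haout : forall x, n < x -> a x = 0.
Hypothesis Hhn : h <= n.
Hypothesis HnY : n + k + 10 <= Y.

Lemma SCORE_ok s c :
  henv s -> rg s xc = c -> 0 <= c ->
  (forall j, 0 <= j < k -> rng z (sv (ar s aSM) c j)) ->
  let V := val a h (sv (ar s aSM) c) in
  spec Y lo hi (SCORE k) s (12 * k + 5) (fun s' => 0 <= rg s' xMx <= Y /\ 0 <= rg s' xmn <= Y /\
     (forall i, 0 <= i < k -> rg s' xmn <= V i <= rg s' xMx) /\
     (exists i, 0 <= i < k /\ V i = rg s' xMx) /\ (exists i, 0 <= i < k /\ V i = rg s' xmn)).
Proof.
  intros Henv Hc Hc0 Hrng V. pose proof basics as HBS.
  apply spec_intro. intros t Ht.
  pose proof Henv as (Henv0 & E1 & E2 & E3 & E4).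
  unfold SCORE.
  apply T_asg'; simpg; [easy|lia|]. apply T_asg'; simpg; [easy|lia|].
  apply T_asg'; simpg; rewrite ?E1; [easy|lia|]. apply T_asg'; simpg; [easy|lia|].
  assert (HV : forall j, 0 <= j < k -> 0 <= V j <= Y).
  { intros j Hj. unfold V, val. destruct (Hrng j Hj) as [H1 H2]. destruct (Z.ltb_spec (sv (ar s aSM) c j) 1).
    - pose proof (Ha (h + 1 + zc (sv (ar s aSM) c) j)). pose proof (Hamx (h + 1 + zc (sv (ar s aSM) c) j)). lia.
    - lia. }
  eapply T_while with (mu := fun s' => k - rg s' xj) (tb := 11)
    (I := fun s' => 0 <= rg s' xj <= k /\ rg s' xr = h + zc (sv (ar s aSM) c) (rg s' xj) /\
       0 <= rg s' xMx <= Y /\ -1 <= rg s' xmn <= Y /\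
       (forall i, 0 <= i < rg s' xj -> rg s' xmn <= V i <= rg s' xMx) /\
       (rg s' xj = 0 /\ rg s' xmn = -1 /\ rg s' xMx = 0 \/
        (exists i, 0 <= i < rg s' xj /\ V i = rg s' xMx) /\
        (exists i, 0 <= i < rg s' xj /\ V i = rg s' xmn))).
  - lia.
  - intros s' (Hj & Hr & HM & Hm & Hall & Hex) Hf. simpg.
    split; [lia|]. split; [easy|]. split; [easy|]. split.
    + intros Hlt.
      assert (Henv' : henv s') by (eapply env1_fr; [exact Hf|reflexivity..|]; unfold henv, genv in *; simpg; easy).
      pose proof Henv' as ((_ & _ & _ & _ & _ & G6) & _).
      assert (Hc' : rg s' xc = c) by (rewrite (proj1 Hf xc eq_refl); exact Hc).
      assert (HSM : ar s' aSM = ar s aSM) by (rewrite (proj1 (proj2 Hf) aSM eq_refl); reflexivity).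
      set (j := rg s' xj) in *. set (v := sv (ar s aSM) c) in *.
      assert (Hvj : ar s' aSM (c * k + j) = v j) by (rewrite HSM; reflexivity).
      assert (Hjk : 0 <= j < k) by lia.
      pose proof (HV j Hjk) as HVj. destruct (Hrng j Hjk) as [Hv0 Hv1].
      pose proof (zc_bounds v j ltac:(lia)) as Hzc.
      apply T_asg'; simpg; rewrite ?Hc'; fold j.
      { split; [split; [split; easy|easy]|]. nia. }
      { rewrite Hvj. lia. }
      rewrite Hvj.
      assert (Hzc1 : zc v (j + 1) = zc v j + if v j <? 1 then 1 else 0) by (unfold zc; now rewrite zs_S by lia).
      assert (HVeq : V j = if v j <? 1 then a (h + 1 + zc v j) else v j) by reflexivity.
      set (P := fun s3 => (0 <= rg s3 xj <= k /\ rg s3 xr = h + zc v (rg s3 xj) /\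
             0 <= rg s3 xMx <= Y /\ -1 <= rg s3 xmn <= Y /\
             (forall i, 0 <= i < rg s3 xj -> rg s3 xmn <= V i <= rg s3 xMx) /\
             (rg s3 xj = 0 /\ rg s3 xmn = -1 /\ rg s3 xMx = 0 \/
              (exists i, 0 <= i < rg s3 xj /\ V i = rg s3 xMx) /\
              (exists i, 0 <= i < rg s3 xj /\ V i = rg s3 xmn))) /\ k - rg s3 xj < k - j).
      (* The invariant is re-established from inequalities between old and new extremes only, so
         that the branches of the three conditionals reduce to linear arithmetic. *)
      assert (Hend : forall s3, rg s3 xj = j + 1 -> rg s3 xr = h + zc v (j + 1) ->
        rg s3 xmn <= V j <= rg s3 xMx -> rg s' xMx <= rg s3 xMx ->
        (0 <= rg s' xmn -> rg s3 xmn <= rg s' xmn) ->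
        (rg s3 xMx = V j \/ rg s3 xMx = rg s' xMx) ->
        (rg s3 xmn = V j \/ (rg s3 xmn = rg s' xmn /\ 0 <= rg s' xmn)) -> P s3).
      { intros s3 S1 S2 B3 B4 B5 B6 B7. unfold P. rewrite S1, S2.
        split; [|lia]. split; [lia|]. split; [easy|]. split; [lia|]. split; [lia|]. split.
        - intros i Hi. destruct (Z.eq_dec i j) as [->|Hne]; [lia|].
          specialize (Hall i ltac:(lia)).
          destruct Hex as [(X1 & X2 & X3)|(_ & (i2 & X1 & X2))]; [lia|].
          pose proof (HV i2 ltac:(lia)). lia.
        - right. split.
          + destruct B6 as [B6|B6].
            * exists j. split; [lia|easy].
            * destruct Hex as [(X1 & X2 & X3)|((i & X1 & X2) & _)].
              -- exists j. split; lia.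
              -- exists i. split; [lia|]. now rewrite B6.
          + destruct B7 as [B7|[B7 B8]].
            * exists j. split; [lia|easy].
            * destruct Hex as [(X1 & X2 & X3)|(_ & (i & X1 & X2))]; [lia|].
              exists i. split; [lia|]. now rewrite B7. }
      assert (Hrest : forall s2, rg s2 xs = V j -> rg s2 xj = j -> rg s2 xMx = rg s' xMx ->
        rg s2 xmn = rg s' xmn -> rg s2 xr = h + zc v (j + 1) ->
        T (If $xMx < $xs Then xMx ::= $xs Fi ;;
           If $xmn < #0 Then xmn ::= $xs Fi ;;
           If $xs < $xmn Then xmn ::= $xs Fi ;;
           xj ::= $xj + #1) s2 7 P).
      { clearbody P. intros s2 K1 K2 K3 K4 K5.
        apply T_if'; simpg; rewrite ?K1, ?K3;
          [easy|easy
          |intros C1; apply T_asg'; simpg; rewrite ?K1; [easy|lia|]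
          |intros C1];
        (apply T_if'; simpg; rewrite ?K1, ?K4;
          [easy|easy
          |intros C2; apply T_asg'; simpg; rewrite ?K1; [easy|lia|]
          |intros C2]);
        (apply T_if'; simpg; rewrite ?K1, ?K4;
          [easy|easy
          |intros C3; apply T_asg'; simpg; rewrite ?K1; [easy|lia|]
          |intros C3]);
        (apply T_asg; simpg; rewrite ?K2; [easy|lia|lia|]);
        apply Hend; simpg; rewrite ?K1, ?K3, ?K4, ?K5; try reflexivity; lia. }
      apply T_if'; simpg; [easy|easy| |]; intros Hs1.
      * apply T_assoc. assert (Hlt1 : v j <? 1 = true) by lia. rewrite Hlt1 in *; cbv iota in Hzc1, HVeq.
        assert (HA : a (h + zc v j + 1) = V j) by (rewrite HVeq; f_equal; ring).
        apply T_asg'; simpg; rewrite ?Hr; [easy|lia|].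
        apply T_asg'; simpg; rewrite ?G6 by lia; [split; [easy|lia]| |].
        { rewrite HA. lia. }
        rewrite HA.
        eapply T_weak with (t := 7) (Q := P);
          [apply Hrest; simpg; first [reflexivity|lia]|lia|intros s3 _ H3 _; exact H3].
      * assert (Hlt1 : v j <? 1 = false) by lia. rewrite Hlt1 in *; cbv iota in Hzc1, HVeq.
        eapply T_weak with (t := 7) (Q := P);
          [apply Hrest; simpg; first [reflexivity|lia]|lia|intros s3 _ H3 _; exact H3].
    + intros Hge. assert (Hjk : rg s' xj = k) by lia. rewrite Hjk in *.
      destruct Hex as [?|[HM' (i & Hi & Hm')]]; [lia|]. pose proof (HV i Hi).
      split; [easy|]. split; [lia|]. split; [easy|]. split; [easy|]. now exists i.
  - simpg. split; [lia|]. split; [unfold zc; rewrite zs_0; lia|]. split; [lia|]. split; [lia|].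
    split; [intros i Hi; lia|now left].
  - simpg. lia.
Qed.

End HT.
End Verif.

(** * Evaluating candidates *)

Lemma lsum_upd a f e v j n : 0 <= e <= n -> f e <> j + 1 ->
  lsum a (updz f e v) j (n + 1) = lsum a f j (n + 1) + if v =? j + 1 then a e else 0.
Proof.
  intros He Hf. unfold lsum. destruct (Z.eqb_spec v (j + 1)) as [->|Hv].
  - rewrite <- (zs_single e (a e) (n + 1)) at 1 by lia. rewrite <- zs_add. apply zs_ext.
    intros x Hx. unfold updz. destruct (Z.eqb_spec x e) as [->|].
    + rewrite Z.eqb_refl. apply Z.eqb_neq in Hf. rewrite Hf. lia.
    + lia.
  - rewrite Z.add_0_r. apply zs_ext. intros x Hx. unfold updz.
    destruct (Z.eqb_spec x e) as [->|]; [|easy].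
    apply Z.eqb_neq in Hf, Hv. now rewrite Hf, Hv.
Qed.

Lemma lsum_ext a f g j e : (forall x, 0 <= x < e -> f x = g x) -> lsum a f j e = lsum a g j e.
Proof. intros H. apply zs_ext. intros x Hx. now rewrite H. Qed.

(** A strictly smaller ratio inherits every bound. The value [m = 0], an infinite ratio, is allowed:
    it satisfies no bound, as [M * V > 0]. *)
Lemma better_bnd M m M' m' U V : 1 <= M -> 0 <= m -> 0 <= M' -> M' * m < M * m' ->
  0 < V -> M * V <= U * m -> M' * V <= U * m'.
Proof.
  intros H1 H2 H3 H4 H5 H6. assert (0 < M * V) by (apply Z.mul_pos_pos; lia).
  assert (HU : 0 < U) by nia.
  apply (Z.mul_le_mono_pos_r _ _ M); [lia|].
  assert (M' * (M * V) <= M' * (U * m)) by (apply Z.mul_le_mono_nonneg_l; lia).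
  assert (U * (M' * m) <= U * (M * m')) by (apply Z.mul_le_mono_nonneg_l; lia). lia.
Qed.

Lemma worse_bnd M m M' m' U V : 0 < m' -> 0 <= m -> 0 <= V -> M * m' <= M' * m ->
  M' * V <= U * m' -> M * V <= U * m.
Proof.
  intros H1 H2 H3 H4 H5. apply (Z.mul_le_mono_pos_r _ _ m'); [lia|].
  assert (V * (M * m') <= V * (M' * m)) by (apply Z.mul_le_mono_nonneg_l; lia).
  assert (m * (M' * V) <= m * (U * m')) by (apply Z.mul_le_mono_nonneg_l; lia). lia.
Qed.

Ltac nonneg := repeat (apply Z.add_nonneg_nonneg || apply Z.mul_nonneg_nonneg); lia.

Section Verif2.
Variables (Y lo hi : Z) (a : Z -> Z) (n k l N L : Z).
Hypothesis Hk : 1 <= k.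
Hypothesis HL : 1 <= L.
Hypothesis Ha : forall x, 0 <= a x.
Hypothesis Haout : forall x, n < x -> a x = 0.
Variable amx : Z.
Hypothesis Hamx : forall x, a x <= amx.
Hypothesis HnY : n + k + 10 <= Y.
Notation K := (KK k L).
Notation T := (T Y lo hi).
Notation env0 := (genv a n k l N L).
Notation sv := (nsum k).

(* Labels carry the version number of the solution they belong to; labels of
   older solutions read as 0. *)
Definition lab (v : Z) (OUT : Z -> Z) (x : Z) : Z :=
  if v * (k + 1) <? OUT x then OUT x - v * (k + 1) else 0.

(** [xm = 0] means that nothing has been recorded. Labels of version [v] are at most
    [v * (k + 1) + k], hence do not exceed [(v + 1) * (k + 1)] and vanish for all later versions. *)
Definition Sol (s : st) : Prop :=
  1 <= rg s xM /\ 0 <= rg s xm /\ 0 <= rg s xv < rg s xS /\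
  (forall x, 0 <= x -> 0 <= ar s aOUT x <= rg s xv * (k + 1) + k) /\
  (rg s xm = 0 \/ forall j, 0 <= j < k ->
     rg s xm <= lsum a (lab (rg s xv) (ar s aOUT)) j (n + 1) <= rg s xM).

(* The ratio [rg s xM / rg s xm] of the recorded solution is at most [U / V]. *)
Definition bnd (s : st) (U V : Z) : Prop := rg s xM * V <= U * rg s xm.

Section HT.
Variables (h wl z base cur : Z).
Hypothesis Hz : 0 <= z.
Hypothesis Hwl : 0 <= wl <= h.
Hypothesis Hhn : h <= n.
Hypothesis HYz : 8 * z + amx + k + K + 10 <= Y.
Hypothesis HwN : h - wl <= N.
Hypothesis Hcur : cur = base + (h - wl).
Hypothesis Hbase : 0 <= base.

Notation vld := (vld k L base).
Notation env1 := (henv a n k l N L h wl z base).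
Notation dpi := (dpst a k L wl z base).

(** Along the parent chain, the sums of the labels written so far plus the sums of the current node
    equal those of [c]. Stamps decrease, so each label goes to an element not yet labelled; node 0
    contributes nothing. *)
Lemma TRACE_ok s c S :
  env1 s -> dpi cur s -> vld (ar s aST) c -> rg s xnc = c -> rg s xS = S -> 0 <= S ->
  S * (k + 1) + k <= Y -> cur <= Y ->
  (forall x, 0 <= x -> 0 <= ar s aOUT x <= S * (k + 1)) ->
  spec Y lo hi (TRACE k) s (3 * N + 1) (fun s' =>
     (forall x, 0 <= x -> 0 <= ar s' aOUT x <= S * (k + 1) + k) /\
     (forall j, 0 <= j < k -> lsum a (lab S (ar s' aOUT)) j (n + 1) = sv (ar s aSM) c j) /\
     (forall x, 0 <= x -> lab S (ar s' aOUT) x <> 0 -> x <= h)).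
Proof.
  intros Henv HI Hc Hnc HS HS0 HSY HcY Hout.
  pose proof (basics Y a k L Hk HL Ha z Hz amx Hamx HYz) as HBS.
  apply spec_intro. intros t Ht.
  pose proof HI as (HI0 & HI1 & HI2 & Hnode).
  destruct (Hnode c Hc) as (Hcc & _).
  unfold TRACE.
  eapply T_while with (mu := fun s' => ar s aST (rg s' xnc) - base) (tb := 2)
    (I := fun s' => vld (ar s aST) (rg s' xnc) /\
     (forall x, 0 <= x -> 0 <= ar s' aOUT x <= S * (k + 1) + k) /\
     (forall j, 0 <= j < k -> lsum a (lab S (ar s' aOUT)) j (n + 1) + sv (ar s aSM) (rg s' xnc) j
        = sv (ar s aSM) c j) /\
     (forall x, 0 <= x -> lab S (ar s' aOUT) x <> 0 -> wl + (ar s aST (rg s' xnc) - base) < x <= h)).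
  - lia.
  - intros s' (Hv & Hb & Hsum & Hlab) Hf.
    assert (Henv' : env1 s') by (eapply env1_fr; [exact Hwl|exact Hf|reflexivity..|exact Henv]).
    pose proof Henv' as (_ & E1 & E2 & E3 & E4).
    pose proof (proj1 (proj2 Hf) aST eq_refl) as A1.
    pose proof (proj1 (proj2 Hf) aPA eq_refl) as A2.
    pose proof (proj1 (proj2 Hf) aLB eq_refl) as A3.
    assert (HS' : rg s' xS = S) by (rewrite (proj1 Hf xS eq_refl); exact HS).
    set (c' := rg s' xnc) in *. destruct (Hnode c' Hv) as (G1 & G2 & G3 & G4).
    simpg. rewrite ?E2, ?E4, ?HS', ?A1, ?A2, ?A3. fold c'.
    destruct Hv as [Hv1 Hv2].
    split; [lia|]. split; [easy|]. split; [lia|]. split.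
    + intros Hlt. destruct G4 as [G4|(G4 & G5 & G6 & G7 & G8)]; [rewrite G4, HI0 in Hlt; lia|].
      set (e := wl + (ar s aST c' - base)) in *.
      assert (He : wl + ar s aST c' - base = e) by (unfold e; lia).
      assert (HeR : 0 <= e <= h) by (unfold e; lia).
      apply T_sto'; simpg; rewrite ?E2, ?E4, ?HS', ?A1, ?A2, ?A3; fold c'; rewrite ?He; [|lia|lia|lia|].
      { repeat split; lia. }
      apply T_asg; simpg; rewrite ?A2; fold c'; [lia|destruct G5; lia|lia|].
      intros _. rewrite ?A2. fold c'. split; [|lia].
      split; [easy|].
      assert (Hlab0 : lab S (ar s' aOUT) e = 0).
      { destruct (Z.eq_dec (lab S (ar s' aOUT) e) 0) as [|Hne]; [easy|].
        apply Hlab in Hne; [|lia]. unfold e in Hne. lia. }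
      assert (Hl2 : forall x, lab S (fun i' => if i' =? e then S * (k + 1) + ar s aLB c' else ar s' aOUT i') x
          = updz (lab S (ar s' aOUT)) e (ar s aLB c') x).
      { intros x. unfold lab, updz. destruct (Z.eqb_spec x e) as [->|]; [|easy].
        destruct (Z.ltb_spec (S * (k + 1)) (S * (k + 1) + ar s aLB c')); lia. }
      split; [|split].
      * intros x Hx. destruct (x =? e); [lia|]. now apply Hb.
      * intros j Hj. rewrite (lsum_ext _ _ (updz (lab S (ar s' aOUT)) e (ar s aLB c'))) by (intros; apply Hl2).
        rewrite lsum_upd by lia. rewrite <- (Hsum j Hj), (G8 j Hj). fold e. lia.
      * intros x Hx. rewrite Hl2. unfold updz. destruct (Z.eqb_spec x e) as [->|Hne].
        -- intros _. unfold e. lia.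
        -- intros Hnz. apply Hlab in Hnz; [|easy]. lia.
    + intros Hge. destruct G4 as [G4|G4]; [|lia].
      split; [exact Hb|]. split.
      * intros j Hj. rewrite <- Hsum by easy.
        assert (sv (ar s aSM) c' j = 0) by (rewrite G4; unfold nsum; now rewrite Z.mul_0_l, HI1 by easy).
        lia.
      * intros x Hx Hnz. apply Hlab in Hnz; [|easy]. lia.
  - rewrite Hnc. split; [exact Hc|]. split; [intros x Hx; specialize (Hout x Hx); lia|].
    assert (Hl0 : forall x, 0 <= x -> lab S (ar s aOUT) x = 0).
    { intros x Hx. specialize (Hout x Hx). unfold lab.
      destruct (Z.ltb_spec (S * (k + 1)) (ar s aOUT x)); lia. }
    split.
    + intros j Hj. rewrite (lsum_ext _ _ (fun _ => 0)) by (intros; apply Hl0; lia).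
      unfold lsum. rewrite (zs_ext _ (fun _ => 0)), zs_zero; [lia|].
      intros x _. destruct (Z.eqb_spec 0 (j + 1)); lia.
    + intros x Hx Hnz. now rewrite Hl0 in Hnz.
  - rewrite Hnc. lia.
Qed.

Lemma FILL_ok s c S :
  env1 s -> (forall j, 0 <= j < k -> rng z (sv (ar s aSM) c j)) -> 0 <= c ->
  rg s xc = c -> rg s xr = h -> rg s xj = 0 -> rg s xS = S -> 0 <= S ->
  S * (k + 1) + k <= Y ->
  (forall j, 0 <= j < k -> 0 < val a h (sv (ar s aSM) c) j) ->
  (forall x, 0 <= x -> 0 <= ar s aOUT x <= S * (k + 1) + k) ->
  (forall j, 0 <= j < k -> lsum a (lab S (ar s aOUT)) j (n + 1) = sv (ar s aSM) c j) ->
  (forall x, 0 <= x -> lab S (ar s aOUT) x <> 0 -> x <= h) ->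
  spec Y lo hi (FILL k) s (5 * k + 1) (fun s' =>
     (forall x, 0 <= x -> 0 <= ar s' aOUT x <= S * (k + 1) + k) /\
     (forall j, 0 <= j < k ->
        lsum a (lab S (ar s' aOUT)) j (n + 1) = val a h (sv (ar s aSM) c) j)).
Proof.
  intros Henv Hrng Hc0 Hc Hr Hj HS HS0 HSY Hval Hout Hsum Hlab.
  pose proof (basics Y a k L Hk HL Ha z Hz amx Hamx HYz) as HBS.
  set (v := sv (ar s aSM) c) in *.
  apply spec_intro. intros t Ht.
  unfold FILL.
  eapply T_while with (mu := fun s' => k - rg s' xj) (tb := 4)
    (I := fun s' => 0 <= rg s' xj <= k /\ rg s' xr = h + zc v (rg s' xj) /\
     (forall x, 0 <= x -> 0 <= ar s' aOUT x <= S * (k + 1) + k) /\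
     (forall i, 0 <= i < k -> lsum a (lab S (ar s' aOUT)) i (n + 1) = if i <? rg s' xj then val a h v i else v i) /\
     (forall x, 0 <= x -> lab S (ar s' aOUT) x <> 0 -> x <= rg s' xr)).
  - lia.
  - intros s' (Hj' & Hr' & Hb & Hs' & Hl') Hf. simpg.
    split; [lia|]. split; [easy|]. split; [easy|]. split.
    + intros Hlt.
      assert (HSM : ar s' aSM = ar s aSM) by (rewrite (proj1 (proj2 Hf) aSM eq_refl); reflexivity).
      assert (Hc' : rg s' xc = c) by (rewrite (proj1 Hf xc eq_refl); exact Hc).
      assert (HS' : rg s' xS = S) by (rewrite (proj1 Hf xS eq_refl); exact HS).
      set (j := rg s' xj) in *. assert (Hjk : 0 <= j < k) by lia.
      assert (Hvj : ar s' aSM (c * k + j) = v j) by (rewrite HSM; reflexivity).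
      destruct (Hrng j Hjk) as [Hv0 Hv1].
      pose proof (zc_bounds v j ltac:(lia)) as Hzc.
      assert (Hzc1 : zc v (j + 1) = zc v j + if v j <? 1 then 1 else 0) by (unfold zc; now rewrite zs_S by lia).
      pose proof (Hval j Hjk) as Hvalj. unfold val in Hvalj.
      apply T_if'; simpg; rewrite ?Hc'; fold j; rewrite ?Hvj; [|easy| |].
      { split; [split; [split; easy|easy]|]. nia. }
      * intros Hs1. apply T_assoc. assert (Hlt1 : v j <? 1 = true) by lia. rewrite Hlt1 in *.
        set (e := h + 1 + zc v j) in *.
        (* An index past the end would give the value 0, excluded by the positivity of all completed
           sums. *)
        assert (Hen : e <= n).
        { destruct (Z_le_gt_dec e n); [easy|]. rewrite Haout in Hvalj; lia. }
        apply T_asg'; simpg; rewrite ?Hr'; [easy|lia|].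
        replace (h + zc v j + 1) with e by (unfold e; ring).
        apply T_sto'; simpg; rewrite ?HS'; fold j; [easy|easy|lia|lia|].
        apply T_asg; simpg; fold j; [easy|lia|lia|].
        intros _. fold j. split; [|lia]. split; [lia|]. split; [lia|].
        assert (Hlab0 : lab S (ar s' aOUT) e = 0).
        { destruct (Z.eq_dec (lab S (ar s' aOUT) e) 0) as [|Hne]; [easy|].
          apply Hl' in Hne; lia. }
        assert (Hl2 : forall x, lab S (fun i' => if i' =? e then S * (k + 1) + j + 1 else ar s' aOUT i') x
          = updz (lab S (ar s' aOUT)) e (j + 1) x).
        { intros x. unfold lab, updz. destruct (Z.eqb_spec x e) as [->|]; [|easy].
          destruct (Z.ltb_spec (S * (k + 1)) (S * (k + 1) + j + 1)); lia. }
        split; [|split].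
        -- intros x Hx. destruct (x =? e); [lia|]. now apply Hb.
        -- intros i Hi. rewrite (lsum_ext _ _ (updz (lab S (ar s' aOUT)) e (j + 1))) by (intros; apply Hl2).
           rewrite lsum_upd, Hs' by lia.
           destruct (Z.ltb_spec i (j + 1)), (Z.ltb_spec i j), (Z.eqb_spec (j + 1) (i + 1)); try lia.
           assert (i = j) by lia. subst i. unfold val. rewrite Hlt1. fold e. lia.
        -- intros x Hx. rewrite Hl2. unfold updz. destruct (Z.eqb_spec x e) as [->|Hne]; [lia|].
           intros Hnz. apply Hl' in Hnz; lia.
      * intros Hs1. assert (Hlt1 : v j <? 1 = false) by lia. rewrite Hlt1 in *.
        apply T_asg; simpg; fold j; [easy|lia|lia|].
        intros _. fold j. split; [|lia]. split; [lia|]. split; [lia|]. split; [exact Hb|]. split; [|exact Hl'].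
        intros i Hi. rewrite Hs' by easy.
        destruct (Z.ltb_spec i (j + 1)), (Z.ltb_spec i j); try lia.
        assert (i = j) by lia. subst i. unfold val. now rewrite Hlt1.
    + intros Hge. split; [exact Hb|]. intros i Hi. rewrite Hs' by easy.
      destruct (Z.ltb_spec i (rg s' xj)); [easy|lia].
  - rewrite Hj. split; [lia|]. split; [unfold zc; rewrite zs_0; lia|]. split; [exact Hout|]. split.
    + intros i Hi. rewrite Hsum by easy. destruct (Z.ltb_spec i 0); [lia|easy].
    + now rewrite Hr.
  - rewrite Hj. lia.
Qed.

Definition tV : Z := 17 * k + 3 * N + 20.

Lemma RECORD_ok s c S :
  env1 s -> dpi cur s -> vld (ar s aST) c -> rg s xc = c -> rg s xS = S -> 0 < S ->
  S * (k + 1) + k <= Y -> cur <= Y ->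
  (forall x, 0 <= x -> 0 <= ar s aOUT x <= S * (k + 1)) ->
  Z.abs (rg s xMx) <= Y -> Z.abs (rg s xmn) <= Y ->
  (forall j, 0 <= j < k -> 0 < val a h (sv (ar s aSM) c) j) ->
  spec Y lo hi (RECORD k) s (5 * k + 3 * N + 8) (fun s' =>
     rg s' xM = rg s xMx /\ rg s' xm = rg s xmn /\ rg s' xv = S /\
     (forall x, 0 <= x -> 0 <= ar s' aOUT x <= S * (k + 1) + k) /\
     (forall j, 0 <= j < k ->
        lsum a (lab S (ar s' aOUT)) j (n + 1) = val a h (sv (ar s aSM) c) j)).
Proof.
  intros Henv HI Hv Hc HS HS0 HSY HcY Hout HMx Hmn Hval.
  pose proof (basics Y a k L Hk HL Ha z Hz amx Hamx HYz) as HBS.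
  apply spec_intro. intros t Ht.
  pose proof Henv as (Henv0 & E1 & E2 & E3 & E4).
  assert (Hc0 : 0 <= c < K) by apply Hv.
  unfold RECORD.
  apply T_asg'; simpg; [easy|lia|]. apply T_asg'; simpg; [easy|lia|].
  apply T_asg'; simpg; [easy|lia|]. apply T_asg'; simpg; [easy|lia|]. rewrite Hc, HS.
  eapply (T_seq Y lo hi (3 * N + 1)), (TRACE_ok _ c S); simpg; try easy; try lia.
  intros s1 Hf1 (Hb1 & Hs1 & Hl1). cbn [rg ar raw setr seta setraw Nat.eqb] in Hs1.
  assert (F1 : rg s1 xh = h) by (rewrite (proj1 Hf1 xh eq_refl); exact E1).
  apply T_asg'; simpg; rewrite ?F1; [easy|lia|]. apply T_asg'; simpg; [easy|lia|].
  assert (HSM : ar s1 aSM = ar s aSM) by (rewrite (proj1 (proj2 Hf1) aSM eq_refl); reflexivity).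
  assert (Hc1 : rg s1 xc = c) by (rewrite (proj1 Hf1 xc eq_refl); exact Hc).
  assert (HS1 : rg s1 xS = S) by (rewrite (proj1 Hf1 xS eq_refl); exact HS).
  assert (R1 : rg s1 xM = rg s xMx) by (rewrite (proj1 Hf1 xM eq_refl); reflexivity).
  assert (R2 : rg s1 xm = rg s xmn) by (rewrite (proj1 Hf1 xm eq_refl); reflexivity).
  assert (R3 : rg s1 xv = S) by (rewrite (proj1 Hf1 xv eq_refl); reflexivity).
  assert (Henv1 : env1 s1).
  { eapply env1_fr; [exact Hwl|exact Hf1|reflexivity..|]. unfold henv, genv in *; simpg; easy. }
  eapply (FILL_ok _ c S); simpg; rewrite ?HSM; try easy; try lia.
  - destruct HI as (_ & _ & _ & HI). intros j Hj. now apply (HI c Hv).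
  - intros s2 Hf2 (Hb2 & Hs2).
    rewrite (proj1 Hf2 xM eq_refl), (proj1 Hf2 xm eq_refl), (proj1 Hf2 xv eq_refl). simpg. auto.
Qed.

(** Whichever way the comparison goes, the recorded ratio afterwards is at most the old one and, for
    a live node, at most that of the completed node. *)
Lemma VBODY_ok s c S :
  env1 s -> dpi cur s -> 0 <= c < K -> rg s xc = c -> rg s xS = S ->
  S * (k + 1) + k < Y -> cur <= Y -> Sol s ->
  let val' := val a h (sv (ar s aSM) c) in
  spec Y lo hi (VBODY k) s tV (fun s' => rg s' xc = c + 1 /\ rg s' xS = S + 1 /\ Sol s' /\
     (forall U V, 0 < V -> bnd s U V -> bnd s' U V) /\
     (vld (ar s aST) c -> forall U V, 0 < V ->
        (forall j j', 0 <= j < k -> 0 <= j' < k -> 0 < val' j' /\ val' j * V <= U * val' j') -> bnd s' U V)).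
Proof.
  intros Henv HI Hc0 Hc HS HSY HcY HSol val'.
  pose proof (basics Y a k L Hk HL Ha z Hz amx Hamx HYz) as HBS.
  apply spec_intro. intros t Ht.
  set (P := fun s' => rg s' xc = c + 1 /\ rg s' xS = S + 1 /\ Sol s' /\
     (forall U V, 0 < V -> bnd s U V -> bnd s' U V) /\
     (vld (ar s aST) c -> forall U V, 0 < V ->
        (forall j j', 0 <= j < k -> 0 <= j' < k -> 0 < val' j' /\ val' j * V <= U * val' j') -> bnd s' U V)).
  pose proof Henv as (Henv0 & E1 & E2 & E3 & E4).
  pose proof HSol as (S1 & S2 & S3 & S4 & S5). rewrite HS in S3.
  assert (HN0 : 0 <= N) by lia. unfold tV in Ht.
  assert (Htail : forall s1 t', 2 <= t' -> rg s1 xc = c -> rg s1 xS = S ->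
    (forall s2, rg s2 xc = c + 1 -> rg s2 xS = S + 1 -> rg s2 xM = rg s1 xM -> rg s2 xm = rg s1 xm ->
       rg s2 xv = rg s1 xv -> ar s2 aOUT = ar s1 aOUT -> P s2) ->
    T (xS ::= $xS + #1 ;; xc ::= $xc + #1) s1 t' P).
  { clearbody P. intros s1 t' Ht' F1 F2 HP.
    apply T_asg'; simpg; rewrite ?F2; [easy|nia|].
    apply T_asg; simpg; rewrite ?F1; [easy|lia|lia|]. apply HP; simpg; reflexivity. }
  unfold VBODY. apply T_if'; simpg; rewrite ?Hc, ?E4; [easy|split; [split; [easy|lia]|easy]| |].
  - intros Hb. apply T_assoc.
    assert (Hv : vld (ar s aST) c) by (split; [easy|lia]).
    pose proof HI as (_ & _ & _ & Hnode). destruct (Hnode c Hv) as (_ & Hrng & _ & _).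
    eapply (T_seq Y lo hi (12 * k + 5)), (SCORE_ok Y lo hi a n k l N L Hk HL Ha h wl z base Hz Hwl amx Hamx HYz Hhn HnY s c); try easy; try lia.
    intros s1 Hf1 (HMx & Hmn & Hall & (i1 & Hi1 & Hm1) & (i2 & Hi2 & Hm2)). fold val' in Hall, Hm1, Hm2.
    assert (Hc1 : rg s1 xc = c) by (rewrite (proj1 Hf1 xc eq_refl); exact Hc).
    assert (HS1 : rg s1 xS = S) by (rewrite (proj1 Hf1 xS eq_refl); exact HS).
    assert (R1 : rg s1 xM = rg s xM) by (rewrite (proj1 Hf1 xM eq_refl); reflexivity).
    assert (R2 : rg s1 xm = rg s xm) by (rewrite (proj1 Hf1 xm eq_refl); reflexivity).
    assert (R3 : rg s1 xv = rg s xv) by (rewrite (proj1 Hf1 xv eq_refl); reflexivity).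
    pose proof (proj1 (proj2 Hf1) aST eq_refl) as A1.
    pose proof (proj1 (proj2 Hf1) aPA eq_refl) as A2.
    pose proof (proj1 (proj2 Hf1) aLB eq_refl) as A3.
    pose proof (proj1 (proj2 Hf1) aSM eq_refl) as A4.
    pose proof (proj1 (proj2 Hf1) aOUT eq_refl) as A5.
    assert (Henv1 : env1 s1) by (eapply env1_fr; [exact Hwl|exact Hf1|reflexivity..|exact Henv]).
    set (Mx := rg s1 xMx) in *. set (mn := rg s1 xmn) in *.
    apply T_if'; simpg; rewrite ?R1, ?R2; fold Mx mn; [easy|easy| |].
    + intros Himp.
      (* A strict improvement over [xM / xm] forces a positive minimum, so a node completed beyond
         the input is never recorded. *)
      assert (Hmn0 : 0 < mn) by nia.
      eapply (T_seq Y lo hi (5 * k + 3 * N + 8)), RECORD_ok with (c := c) (S := S); rewrite ?A1, ?A4, ?A5; try easy; try lia.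
      * unfold dpst in *. now rewrite A1, A2, A3, A4.
      * intros x Hx. specialize (S4 x Hx). nia.
      * fold val'. intros j Hj. pose proof (Hall j Hj). lia.
      * fold val' Mx mn. intros s2 Hf2 (G1 & G2 & G3 & G4 & G5).
        apply Htail; [lia|now rewrite (proj1 Hf2 xc eq_refl)|now rewrite (proj1 Hf2 xS eq_refl)|].
        intros s3 B1 B2 B3 B4 B5 B6. rewrite G1 in B3. rewrite G2 in B4. rewrite G3 in B5.
        split; [easy|]. split; [easy|]. split; [|split].
        -- unfold Sol. rewrite B2, B3, B4, B5, B6. pose proof (Hall i1 Hi1).
           split; [lia|]. split; [lia|]. split; [lia|]. split; [exact G4|]. right.
           intros j Hj. rewrite G5 by easy. now apply Hall.
        -- intros U V HV. unfold bnd. rewrite B3, B4. intros Hbn.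
           eapply better_bnd; [| | |exact Himp|exact HV|exact Hbn]; lia.
        -- intros _ U V HV HUV. unfold bnd. rewrite B3, B4. rewrite <- Hm1, <- Hm2. now apply HUV.
    + intros Hnimp. apply Htail; [lia|easy|easy|].
      intros s3 B1 B2 B3 B4 B5 B6. rewrite R1 in B3. rewrite R2 in B4. rewrite R3 in B5. rewrite A5 in B6.
      split; [easy|]. split; [easy|]. split; [|split].
      * unfold Sol. rewrite B2, B3, B4, B5, B6. repeat split; try lia; try apply S4; easy.
      * intros U V HV. unfold bnd. now rewrite B3, B4.
      * intros _ U V HV HUV. unfold bnd. rewrite B3, B4.
        destruct (HUV i1 i2 Hi1 Hi2) as [X1 X2]. rewrite Hm1, Hm2 in *.
        eapply worse_bnd; [| | | |exact X2]; lia.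
  - intros Hb. apply Htail; [lia|easy|easy|].
    intros s3 B1 B2 B3 B4 B5 B6.
    split; [easy|]. split; [easy|]. split; [|split].
    + unfold Sol. rewrite B2, B3, B4, B5, B6. repeat split; try lia; try apply S4; easy.
    + intros U V HV. unfold bnd. now rewrite B3, B4.
    + intros [_ Hv]. lia.
Qed.

Definition tL : Z := 2 + K * (tV + 1).

Lemma ELOOP_ok s S :
  env1 s -> dpi cur s -> rg s xS = S ->
  (S + K) * (k + 1) + k < Y -> cur <= Y -> Sol s ->
  let cand := fun c U V => forall j j', 0 <= j < k -> 0 <= j' < k ->
     0 < val a h (sv (ar s aSM) c) j' /\
     val a h (sv (ar s aSM) c) j * V <= U * val a h (sv (ar s aSM) c) j' in
  spec Y lo hi (ELOOP k) s tL (fun s' => rg s' xS = S + K /\ Sol s' /\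
     (forall U V, 0 < V -> bnd s U V -> bnd s' U V) /\
     (forall c, vld (ar s aST) c -> forall U V, 0 < V -> cand c U V -> bnd s' U V)).
Proof.
  intros Henv HI HS HSY HcY HSol cand.
  pose proof (basics Y a k L Hk HL Ha z Hz amx Hamx HYz) as HBS.
  apply spec_intro. intros t Ht.
  assert (HtV : 0 <= tV) by (unfold tV; lia). unfold tL in Ht.
  unfold ELOOP. apply T_asg'; simpg; [easy|lia|].
  eapply T_while with (mu := fun s' => K - rg s' xc) (tb := tV)
    (I := fun s' => 0 <= rg s' xc <= K /\ rg s' xS = S + rg s' xc /\ Sol s' /\
     (forall U V, 0 < V -> bnd s U V -> bnd s' U V) /\
     (forall c, vld (ar s aST) c -> c < rg s' xc -> forall U V, 0 < V -> cand c U V -> bnd s' U V)).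
  - lia.
  - intros s' (Hc & HS' & HSol' & Hmon & Hcand) Hf.
    assert (Henv' : env1 s').
    { eapply env1_fr; [exact Hwl|exact Hf|reflexivity..|]. unfold henv, genv in *; simpg; easy. }
    pose proof Henv' as ((F1 & F2 & F3 & F4 & F5 & F6) & _).
    pose proof (proj1 (proj2 Hf) aST eq_refl) as A1.
    pose proof (proj1 (proj2 Hf) aPA eq_refl) as A2.
    pose proof (proj1 (proj2 Hf) aLB eq_refl) as A3.
    pose proof (proj1 (proj2 Hf) aSM eq_refl) as A4.
    cbn [rg ar raw setr] in A1, A2, A3, A4.
    simpg. rewrite F4. split; [lia|]. split; [easy|]. split; [easy|]. split.
    + intros Hlt.
      assert (HSc : (S + rg s' xc) * (k + 1) + k < Y).
      { assert ((S + rg s' xc) * (k + 1) <= (S + K) * (k + 1)) by (apply Z.mul_le_mono_nonneg_r; lia). lia. }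
      eapply (VBODY_ok s' (rg s' xc) (S + rg s' xc)); try easy; try lia.
      * unfold dpst in *. now rewrite A1, A2, A3, A4.
      * intros s2 Hf2 (Hc2 & HS2 & HSol2 & Hmon2 & Hcand2) _. rewrite A1, A4 in Hcand2.
        rewrite Hc2, HS2. split; [|lia]. split; [lia|]. split; [lia|]. split; [easy|]. split.
        -- intros U V HV Hb. now apply Hmon2, Hmon.
        -- intros c' Hv' Hlt' U V HV HUV. destruct (Z.eq_dec c' (rg s' xc)) as [->|Hne].
           ++ now apply Hcand2.
           ++ apply Hmon2; [easy|]. apply (Hcand c' Hv' ltac:(lia)); easy.
    + intros Hge. assert (Hck : rg s' xc = K) by lia. rewrite Hck in *.
      split; [easy|]. split; [easy|]. split; [easy|].
      intros c' Hv'. apply Hcand; [easy|apply Hv'].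
  - simpg. split; [lia|]. split; [lia|]. split; [exact HSol|]. split; [easy|].
    intros c' [Hc' _] Hlt. lia.
  - simpg. lia.
Qed.

End HT.

Hypothesis Hapos : forall x, 1 <= x <= n -> 0 < a x.
Hypothesis Hl : 1 <= l.
Hypothesis HN : 1 <= N.
Hypothesis HNL : 4 * N <= L.
Hypothesis HlY : l <= Y.
Hypothesis HNY : N <= Y.
Hypothesis HYP : 8 * (2 ^ l * amx) + amx + k + K + 10 <= Y.
Hypothesis HSm : (1 + (n + 1) * l * (N + K)) * (k + 1) + k < Y.

Notation HasCand := (HasCand a k N L).

(** Holds between two dynamic programs: every stamp is below the counter, so the table is empty for
    the next one. *)
Definition Main (s : st) : Prop :=
  env0 s /\ 0 < rg s xS /\ (forall c, 0 <= c < K -> ar s aST c < rg s xS) /\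
  (forall j, 0 <= j < k -> ar s aSM j = 0) /\ Sol s.

Lemma amx_nonneg : 0 <= amx.
Proof. pose proof (Ha 0). pose proof (Hamx 0). lia. Qed.

Lemma z_bound h t : 0 <= t <= l -> 0 <= 2 ^ t * a h <= 2 ^ l * amx.
Proof.
  intros Ht. pose proof (Ha h). pose proof (Hamx h).
  assert (2 ^ t <= 2 ^ l) by (apply Z.pow_le_mono_r; lia).
  pose proof (Z.pow_pos_nonneg 2 t ltac:(lia) ltac:(lia)). split; [nia|].
  apply Z.mul_le_mono_nonneg; lia.
Qed.

Definition tT : Z := tD k N L + tL + 2.

(** The labelling behind a candidate is admissible, so [Cov] provides a live node close to it. The
    exact sums of that node are one of the perturbations [v] that [HasCand] quantifies over. Each
    pair [(h, t)] consumes at most [N + K] values of the counter, which keeps it bounded. *)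
Lemma TBODY_ok s h t :
  Main s -> 0 <= h <= n -> 0 <= t < l -> rg s xh = h -> rg s xw = wlo N h ->
  rg s xz = 2 ^ t * a h -> rg s xt = t -> rg s xS <= 1 + (h * l + t) * (N + K) ->
  spec Y lo hi (TBODY k) s tT (fun s' => Main s' /\ rg s' xz = 2 ^ (t + 1) * a h /\
     rg s' xt = t + 1 /\ rg s' xS <= 1 + (h * l + (t + 1)) * (N + K) /\
     (forall U V, 0 < V -> bnd s U V -> bnd s' U V) /\
     (forall U V, 0 < V -> HasCand h t U V -> bnd s' U V)).
Proof.
  intros (Henv & HS0 & Hst & Hsm & HSol) Hh Ht Hxh Hxw Hxz Hxt HSb.
  pose proof (z_bound h t ltac:(lia)) as Hzb. pose proof amx_nonneg as Hamx0.
  assert (HYz : 8 * (2 ^ t * a h) + amx + k + K + 10 <= Y) by lia.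
  pose proof (basics Y a k L Hk HL Ha _ (proj1 Hzb) amx Hamx HYz) as HBS.
  set (S := rg s xS) in *. set (wl := wlo N h) in *. set (z := 2 ^ t * a h) in *.
  assert (Hwl : 0 <= wl <= h) by (unfold wl, wlo; lia).
  assert (HwN : h - wl <= N) by (unfold wl, wlo; lia).
  assert (HSmax : S + (N + K) <= 1 + (n + 1) * l * (N + K)).
  { assert ((h + 1) * l <= (n + 1) * l) by (apply Z.mul_le_mono_nonneg_r; lia).
    assert ((h * l + t + 1) * (N + K) <= (n + 1) * l * (N + K)) by (apply Z.mul_le_mono_nonneg_r; lia). lia. }
  assert (HSY : (S + (N + K)) * (k + 1) + k < Y).
  { assert ((S + (N + K)) * (k + 1) <= (1 + (n + 1) * l * (N + K)) * (k + 1))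
      by (apply Z.mul_le_mono_nonneg_r; lia). lia. }
  assert (HSY' : S + (N + K) <= Y).
  { assert ((S + (N + K)) * 1 <= (S + (N + K)) * (k + 1)) by (apply Z.mul_le_mono_nonneg_l; lia). lia. }
  assert (HSY2 : (S + (h - wl) + K) * (k + 1) + k < Y).
  { assert ((S + (h - wl) + K) * (k + 1) <= (S + (N + K)) * (k + 1)) by (apply Z.mul_le_mono_nonneg_r; lia). lia. }
  apply spec_intro. intros tm Htm.
  set (P := fun s' => Main s' /\ rg s' xz = 2 ^ (t + 1) * a h /\
     rg s' xt = t + 1 /\ rg s' xS <= 1 + (h * l + (t + 1)) * (N + K) /\
     (forall U V, 0 < V -> bnd s U V -> bnd s' U V) /\
     (forall U V, 0 < V -> HasCand h t U V -> bnd s' U V)).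
  unfold tT in Htm. unfold TBODY.
  eapply (T_seq Y lo hi (tD k N L)),
    (DPROG_ok Y lo hi a n k l N L Hk HL Ha h wl z S (proj1 Hzb) Hwl); try easy; try lia.
  { intros x Hx. apply Hapos. lia. }
  intros s1 Hf1 (Henv1 & HS1 & HI1 & Hst1 & HC1).
  assert (R1 : rg s1 xM = rg s xM) by (rewrite (proj1 Hf1 xM eq_refl); reflexivity).
  assert (R2 : rg s1 xm = rg s xm) by (rewrite (proj1 Hf1 xm eq_refl); reflexivity).
  assert (R3 : rg s1 xv = rg s xv) by (rewrite (proj1 Hf1 xv eq_refl); reflexivity).
  assert (R4 : rg s1 xt = rg s xt) by (rewrite (proj1 Hf1 xt eq_refl); reflexivity).
  pose proof (proj1 (proj2 Hf1) aOUT eq_refl) as A5.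
  assert (HSol1 : Sol s1).
  { unfold Sol in *. rewrite R1, R2, R3, A5, HS1. fold S in HSol.
    destruct HSol as (B1 & B2 & B3 & B4 & B5). repeat split; try lia; try apply B4; easy. }
  assert (HtL : 0 <= tL) by (unfold tL, tV; nonneg).
  eapply (T_seq Y lo hi tL),
    (ELOOP_ok h wl z S (S + (h - wl)) (proj1 Hzb) Hwl (proj2 Hh) HYz HwN eq_refl (Z.lt_le_incl _ _ HS0)
      s1 (S + (h - wl))); try easy; try lia.
  intros s2 Hf2 (HS2 & HSol2 & Hmon2 & Hcand2).
  assert (Henv2 : henv a n k l N L h wl z S s2) by (eapply env1_fr; [exact Hwl|exact Hf2|reflexivity..|exact Henv1]).
  destruct Henv2 as (Henv02 & G1 & G2 & G3 & G4).
  assert (R5 : rg s2 xt = t) by (rewrite (proj1 Hf2 xt eq_refl); lia).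
  apply T_asg'; simpg; rewrite ?G3; [easy|lia|].
  apply T_asg; simpg; rewrite ?R5; [easy| |lia|].
  { lia. }
  unfold P. simpg. split; [|split; [|split; [|split; [|split]]]].
  - unfold Main. split; [|split; [|split; [|split]]]; simpg.
    + unfold genv in *. simpg. easy.
    + lia.
    + intros c Hc. rewrite (proj1 (proj2 Hf2) aST eq_refl), HS2. specialize (Hst1 c Hc). lia.
    + intros j Hj. rewrite (proj1 (proj2 Hf2) aSM eq_refl). now apply HI1.
    + exact HSol2.
  - rewrite Z.pow_add_r, Z.pow_1_r by lia. unfold z. ring.
  - easy.
  - rewrite HS2. lia.
  - intros U V HV Hb. apply Hmon2; [easy|]. unfold bnd in *. now rewrite R1, R2.
  - intros U V HV (f & Hf & Hfz & HfV).
    destruct (HC1 f) as (c & Hc & _ & Hcs). { split; easy. }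
    apply (Hcand2 c Hc U V HV). apply HfV. intros j Hj. fold z. destruct (Hcs j Hj) as [K1 K2].
    split; [|split; [|exact K2]].
    (* The accumulated error is at most that of a full window. *)
    2:{ assert ((h - wl) * (8 * z) <= N * (8 * z)) by (apply Z.mul_le_mono_nonneg_r; lia). fold wl in K1. lia. }
    destruct HI1 as (_ & _ & _ & HI1). destruct (HI1 c Hc) as (_ & Hr & _). now apply Hr.
Qed.

Definition tH : Z := 8 + l * (tT + 1).

Lemma HBODY_ok s h :
  Main s -> 0 <= h <= n -> rg s xh = h -> rg s xS <= 1 + h * l * (N + K) ->
  spec Y lo hi (HBODY k) s tH (fun s' => Main s' /\ rg s' xh = h + 1 /\
     rg s' xS <= 1 + (h + 1) * l * (N + K) /\
     (forall U V, 0 < V -> bnd s U V -> bnd s' U V) /\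
     (forall t U V, 0 <= t < l -> 0 < V -> HasCand h t U V -> bnd s' U V)).
Proof.
  intros HM Hh Hxh HSb.
  pose proof (z_bound h 0 ltac:(lia)) as Hzb. pose proof amx_nonneg as Hamx0.
  assert (HK : 1 <= K).
  { pose proof (Z.pow_pos_nonneg (L + 1) k ltac:(lia) ltac:(lia)). unfold KK. lia. }
  apply spec_intro. intros tm Htm.
  set (P := fun s' => Main s' /\ rg s' xh = h + 1 /\
     rg s' xS <= 1 + (h + 1) * l * (N + K) /\
     (forall U V, 0 < V -> bnd s U V -> bnd s' U V) /\
     (forall t U V, 0 <= t < l -> 0 < V -> HasCand h t U V -> bnd s' U V)).
  assert (HtT : 0 <= tT) by (unfold tT, tL, tV, tD, tE, tC, tJ; nonneg).
  unfold tH in Htm.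
  assert (Hrest : forall s1 tm', 4 + l * (tT + 1) <= tm' ->
    Main s1 -> rg s1 xh = h -> rg s1 xw = wlo N h -> rg s1 xS = rg s xS ->
    rg s1 xM = rg s xM -> rg s1 xm = rg s xm ->
    T (xz ::= aA.[$xh] ;; xt ::= #0 ;; While $xt < $xl Do TBODY k Od ;; xh ::= $xh + #1) s1 tm' P).
  { intros s1 tm' Htm' HM1 F1 F2 F3 F4 F5.
    pose proof HM1 as ((E1 & E2 & E3 & E4 & E5 & E6) & _). pose proof (Ha h). pose proof (Hamx h).
    apply T_asg'; simpg; rewrite ?F1, ?E6 by lia; [split; [easy|lia]|lia|].
    apply T_asg'; simpg; [easy|lia|].
    eapply (T_seq Y lo hi (l * (tT + 1) + 1)).
    eapply T_while with (mu := fun s' => l - rg s' xt) (tb := tT)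
      (I := fun s' => 0 <= rg s' xt <= l /\ Main s' /\ rg s' xz = 2 ^ rg s' xt * a h /\
        rg s' xS <= 1 + (h * l + rg s' xt) * (N + K) /\
        (forall U V, 0 < V -> bnd s U V -> bnd s' U V) /\
        (forall t U V, 0 <= t < rg s' xt -> 0 < V -> HasCand h t U V -> bnd s' U V)).
    - lia.
    - intros s' (Ht & HM' & Hz' & HS' & Hmon & Hcand) Hf.
      pose proof HM' as ((G1 & G2 & G3 & G4 & G5 & G6) & _).
      assert (Hh' : rg s' xh = h) by (rewrite (proj1 Hf xh eq_refl); exact F1).
      assert (Hw' : rg s' xw = wlo N h) by (rewrite (proj1 Hf xw eq_refl); exact F2).
      simpg. rewrite G5. split; [lia|]. split; [easy|]. split; [easy|]. split.
      + intros Hlt. eapply (TBODY_ok s' h (rg s' xt)); try easy; try lia.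
        intros s2 Hf2 (HM2 & Hz2 & Ht2 & HS2 & Hmon2 & Hcand2) _. rewrite Ht2. split; [|lia].
        split; [lia|]. split; [easy|]. split; [easy|]. split; [easy|]. split.
        * intros U V HV Hb. now apply Hmon2, Hmon.
        * intros t' U V Ht' HV HUV. destruct (Z.eq_dec t' (rg s' xt)) as [->|Hne].
          -- now apply Hcand2.
          -- apply Hmon2; [easy|]. apply (Hcand t'); try easy. lia.
      + intros Hge. assert (Htl : rg s' xt = l) by lia. rewrite Htl in *.
        apply T_asg; simpg; rewrite ?Hh'; [easy|lia|lia|].
        unfold P. simpg. split; [exact HM'|]. split; [easy|].
        split; [lia|]. split; [exact Hmon|exact Hcand].
    - simpg. split; [lia|]. split; [exact HM1|]. split; [rewrite Z.pow_0_r; lia|].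
      split; [lia|]. split; [|intros; lia]. intros U V HV Hb. unfold bnd in *. simpg. now rewrite F4, F5.
    - simpg. lia. }
  pose proof HM as ((E1 & E2 & E3 & E4 & E5 & E6) & _).
  unfold HBODY. apply T_asg'; simpg; [easy|lia|].
  apply T_if'; simpg; rewrite ?E2, ?Hxh; [easy|easy| |]; intros Hlt.
  - apply T_asg'; simpg; rewrite ?E2, ?Hxh; [easy|lia|].
    apply Hrest; simpg; try easy; try lia. unfold wlo. lia.
  - apply Hrest; simpg; try easy; try lia. unfold wlo. lia.
Qed.

Definition tM : Z := 2 + (n + 1) * (tH + 1).

Lemma MAIN_ok s :
  Main s -> 1 <= n -> rg s xS = 1 ->
  spec Y lo hi (MAIN k) s tM (fun s' => env0 s' /\ Sol s' /\
    (forall h t U V, 0 <= h <= n -> 0 <= t < l -> 0 < V -> HasCand h t U V -> bnd s' U V)).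
Proof.
  intros HM Hn HS. pose proof amx_nonneg as Hamx0.
  assert (HK : 1 <= K).
  { pose proof (Z.pow_pos_nonneg (L + 1) k ltac:(lia) ltac:(lia)). unfold KK. lia. }
  assert (HtH : 0 <= tH) by (unfold tH, tT, tL, tV, tD, tE, tC, tJ; nonneg).
  apply spec_intro. intros tm Htm. unfold tM in Htm.
  unfold MAIN. apply T_asg'; simpg; [easy|lia|].
  eapply T_while with (mu := fun s' => n + 1 - rg s' xh) (tb := tH)
    (I := fun s' => 0 <= rg s' xh <= n + 1 /\ Main s' /\ rg s' xS <= 1 + rg s' xh * l * (N + K) /\
      (forall h t U V, 0 <= h < rg s' xh -> 0 <= t < l -> 0 < V -> HasCand h t U V -> bnd s' U V)).
  - lia.
  - intros s' (Hh & HM' & HS' & Hcand) Hf.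
    pose proof HM' as ((G1 & G2 & G3 & G4 & G5 & G6) & _).
    simpg. rewrite G1. split; [lia|]. split; [easy|]. split; [easy|]. split.
    + intros Hlt. eapply (HBODY_ok s' (rg s' xh)); try easy; try lia.
      intros s2 Hf2 (HM2 & Hh2 & HS2 & Hmon2 & Hcand2) _. rewrite Hh2. split; [|lia].
      split; [lia|]. split; [easy|]. split; [easy|].
      intros h t U V Hh' Ht HV HUV. destruct (Z.eq_dec h (rg s' xh)) as [->|Hne].
      * now apply (Hcand2 t).
      * apply Hmon2; [easy|]. apply (Hcand h t); try easy. lia.
    + intros Hge. split; [apply HM'|]. split; [apply HM'|].
      intros h t U V Hh' Ht HV HUV. apply (Hcand h t); try easy. lia.
  - simpg. split; [lia|]. split; [exact HM|]. split; [lia|]. intros; lia.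
  - simpg. lia.
Qed.
End Verif2.

(** * Initialization and output *)

Section Params.
Variables (k p q : Z).
Hypothesis Hpq : 0 < p < q.

(** Strictly more than [q/p], yet at most [2 * q / p]: the first serves the approximation, the
    second the running time. *)
Definition cE : Z := q / p + 1.
Definition cl : Z := Z.log2_up (20 * k * cE * cE).
Definition cN : Z := cl * k * cE.
Definition cL : Z := 40 * cN * cE.
Notation E := cE. Notation l := cl. Notation N := cN. Notation L := cL.
Notation K := (KK k cL).

Lemma E_bounds : 2 <= E /\ q < E * p.
Proof.
  unfold cE. pose proof (Z.div_mod q p ltac:(lia)). pose proof (Z.mod_pos_bound q p ltac:(lia)).
  assert (1 <= q / p) by (apply Z.div_le_lower_bound; lia).
  split; [lia|]. rewrite Z.mul_add_distr_r. lia.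
Qed.

Hypothesis Hk : 2 <= k.

Lemma l_spec : 1 <= l /\ 20 * k * E * E <= 2 ^ l /\ forall i, 0 <= i < l -> 2 ^ i < 20 * k * E * E.
Proof.
  destruct E_bounds as [H1 H2]. assert (H3 : 1 < 20 * k * E * E) by (clear - H1 Hk; nia).
  unfold cl. pose proof (Z.log2_up_spec _ H3) as [H4 H5].
  pose proof (Z.log2_up_pos _ H3). split; [lia|]. split; [easy|].
  intros i Hi. eapply Z.le_lt_trans; [|exact H4]. apply Z.pow_le_mono_r; lia.
Qed.

Lemma N_bounds : 1 <= N /\ l <= N.
Proof. destruct E_bounds as [H1 _], l_spec as [H2 _]. unfold cN.
  assert (1 <= k * cE) by (clear - H1 Hk; nia).
  assert (cl * 1 <= cl * (k * cE)) by (apply Z.mul_le_mono_nonneg_l; lia). lia.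
Qed.

Lemma L_bounds : 1 <= L /\ 4 * N <= L.
Proof. destruct E_bounds as [H1 _], N_bounds as [H2 _]. unfold cL.
  assert (cN * 2 <= cN * cE) by (apply Z.mul_le_mono_nonneg_l; lia). lia.
Qed.

Lemma K_bounds : 1 <= K.
Proof.
  destruct L_bounds. pose proof (Z.pow_pos_nonneg (L + 1) k ltac:(lia) ltac:(lia)). unfold KK. lia.
Qed.

End Params.

Section Verif3.
Variables (Y hi : Z) (a : Z -> Z) (n k p q : Z).
Hypothesis Hn : 1 <= n.
Hypothesis Hk : 2 <= k.
Hypothesis Hpq : 0 < p < q.
Hypothesis Ha0 : a 0 = 0.
Hypothesis Hapos : forall x, 1 <= x <= n -> 0 < a x.
Hypothesis Haout : forall x, n < x -> a x = 0.
Hypothesis Haneg : forall x, x < 0 -> a x = 0.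
Variable amx : Z.
Hypothesis Hamx : forall x, a x <= amx.

Notation E := (cE p q). Notation l := (cl k p q). Notation N := (cN k p q). Notation L := (cL k p q).
Notation K := (KK k L).
Notation T := (T Y zR hi).

Hypothesis HnY : 2 * n + 20 * k + 100 <= Y.
Hypothesis HhiY : 2 * n + 3 + zR <= hi <= Y.
Hypothesis HEY : E <= Y.
Hypothesis HlY : l <= Y.
Hypothesis HNY : N <= Y.
Hypothesis HLY : L <= Y.
Hypothesis HPY : 2 ^ l <= Y.
Hypothesis HYP : 8 * (2 ^ l * amx) + amx + k + K + 10 <= Y.
Hypothesis HSm : (1 + (n + 1) * l * (N + K)) * (k + 1) + k < Y.

Lemma Ha : forall x, 0 <= a x.
Proof.
  intros x. destruct (Z_lt_le_dec x 0); [rewrite Haneg; lia|].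
  destruct (Z.eq_dec x 0) as [->|]; [lia|].
  destruct (Z_lt_le_dec n x); [rewrite Haout; lia|]. pose proof (Hapos x). lia.
Qed.

(** The state left by the relocation: elements 1 to 58, formerly in cells 3 to 60, are in [aA]; the
    others are still in their cells. *)
Definition init_ok (s : st) : Prop :=
  rg s xp = p /\ rg s xq = q /\ rg s xn = n /\
  (forall i, 0 <= i -> ar s aA i = if i <? zR - 2 then a i else 0) /\
  (forall b i, (1 <= b < 8)%nat -> 0 <= i -> ar s b i = 0) /\
  (forall i, zR <= i < hi -> raw s i = a (i - 2)).

Definition tI : Z := 30 + 3 * l + 3 * k + 4 * n.

Lemma INIT_ok s : init_ok s ->
  spec Y zR hi (INIT k) s tI (fun s' => Main a n k l N L s' /\ rg s' xS = 1).
Proof.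
  intros (H1 & H2 & H3 & H4 & H5 & H6).
  pose proof (E_bounds p q Hpq) as [BE1 BE2]. pose proof (l_spec k p q Hpq Hk) as (Bl1 & Bl2 & Bl3).
  pose proof (N_bounds k p q Hpq Hk) as [BN1 BN2]. pose proof (L_bounds k p q Hpq Hk) as [BL1 BL2]. pose proof (K_bounds k p q Hpq Hk) as BK.
  assert (Hamx0 : 0 <= amx) by (specialize (Hamx 0); lia).
  assert (HKY : K <= Y).
  { assert (0 <= 2 ^ l * amx) by (apply Z.mul_nonneg_nonneg; lia). lia. }
  apply spec_intro. intros tm Htm.
  unfold tI in Htm. unfold INIT.
  apply T_asg'; simpg; rewrite ?H1, ?H2; fold (cE p q); [easy|lia|].
  apply T_asg'; simpg; [easy|lia|]. apply T_asg'; simpg; [easy|lia|].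
  set (s1 := setr _ _ _).
  eapply (T_seq Y zR hi (3 * l + 1)).
  eapply T_while with (mu := fun s' => l - rg s' xl) (tb := 2)
    (I := fun s' => 0 <= rg s' xl <= l /\ rg s' xP = 2 ^ rg s' xl).
  { lia. }
  2:{ unfold s1. simpg. split; [lia|]. now rewrite Z.pow_0_r. }
  2:{ unfold s1. simpg. lia. }
  intros s2 [Hl HP] Hf2. simpg.
  assert (F1 : rg s2 xE = E) by now rewrite (proj1 Hf2 xE eq_refl).
  rewrite F1. split; [lia|]. split; [easy|]. split; [easy|]. split.
  { intros Hlt. rewrite HP in *.
    assert (Hll : rg s2 xl < l).
    { destruct (Z.eq_dec (rg s2 xl) l) as [He|]; [rewrite He in Hlt; lia|lia]. }
    assert (Hdbl : 2 ^ (rg s2 xl + 1) = 2 ^ rg s2 xl + 2 ^ rg s2 xl)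
      by (rewrite Z.pow_add_r, Z.pow_1_r by lia; ring).
    assert (2 ^ (rg s2 xl + 1) <= 2 ^ l) by (apply Z.pow_le_mono_r; lia).
    pose proof (Z.pow_pos_nonneg 2 (rg s2 xl) ltac:(lia) ltac:(lia)).
    apply T_asg'; simpg; rewrite ?HP; [easy|lia|].
    apply T_asg; simpg; [easy|lia|lia|]. intros _. split; [|lia]. split; [lia|]. lia. }
  intros Hge.
  (* Doubling stops exactly at [l], since all smaller powers of 2 are below [20 * k * E * E]. *)
  assert (Hll : rg s2 xl = l).
  { destruct (Z_lt_le_dec (rg s2 xl) l) as [Hlt|]; [|lia]. specialize (Bl3 (rg s2 xl)). lia. }
  apply T_asg'; simpg; rewrite ?Hll, ?F1; fold (cN k p q); [easy|lia|].
  apply T_asg'; simpg; rewrite ?F1; fold (cL k p q); [easy|lia|].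
  apply T_asg'; simpg; [easy|lia|]. apply T_asg'; simpg; [easy|lia|].
  set (s3 := setr _ _ _).
  eapply (T_seq Y zR hi (3 * k + 1)).
  eapply T_while with (mu := fun s' => k - rg s' xj) (tb := 2)
    (I := fun s' => 0 <= rg s' xj <= k /\ rg s' xK = (L + 1) ^ rg s' xj).
  { lia. }
  2:{ unfold s3. simpg. split; [lia|]. now rewrite Z.pow_0_r. }
  2:{ unfold s3. simpg. lia. }
  intros s4 [Hj HKj] Hf4. simpg.
  assert (F2 : rg s4 xL = L) by now rewrite (proj1 Hf4 xL eq_refl).
  split; [lia|]. split; [easy|]. split; [easy|]. split.
  { intros Hlt.
    assert (Hdbl : (L + 1) ^ (rg s4 xj + 1) = (L + 1) ^ rg s4 xj * (L + 1))
      by (rewrite Z.pow_add_r, Z.pow_1_r by lia; ring).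
    assert ((L + 1) ^ (rg s4 xj + 1) <= K) by (apply Z.pow_le_mono_r; lia).
    pose proof (Z.pow_pos_nonneg (L + 1) (rg s4 xj + 1) ltac:(lia) ltac:(lia)).
    apply T_asg'; simpg; rewrite ?HKj, ?F2; [easy|lia|].
    apply T_asg; simpg; [easy|lia|lia|]. intros _. split; [|lia]. split; [lia|]. lia. }
  intros Hge2. assert (Hjk : rg s4 xj = k) by lia. rewrite Hjk in HKj. fold (KK k (cL k p q)) in HKj.
  apply T_asg'; simpg; [easy|lia|]. apply T_asg'; simpg; [easy|lia|].
  apply T_asg'; simpg; [easy|lia|]. apply T_asg'; simpg; [easy|lia|].
  apply T_asg'; simpg; [easy|unfold zR; lia|].
  set (s5 := setr _ _ _).
  assert (Har : forall b, ar s5 b = ar s b).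
  { intros b. unfold s5. simpg.
    rewrite (proj1 (proj2 Hf4) b eq_refl). unfold s3. simpg.
    now rewrite (proj1 (proj2 Hf2) b eq_refl). }
  assert (Hraw : raw s5 = raw s).
  { unfold s5. simpg. rewrite (proj2 (proj2 Hf4) eq_refl). unfold s3. simpg.
    now rewrite (proj2 (proj2 Hf2) eq_refl). }
  assert (Hn5 : rg s5 xn = n).
  { unfold s5. simpg. rewrite (proj1 Hf4 xn eq_refl). unfold s3. simpg.
    rewrite (proj1 Hf2 xn eq_refl). exact H3. }
  (* For a short input the loop does not run at all and [xx] stays at [zR], possibly beyond [n + 3];
     hence the maximum and the disjunction. *)
  eapply T_while with (mu := fun s' => Z.max 0 (n + 3 - rg s' xx)) (tb := 3)
    (I := fun s' => zR <= rg s' xx /\ (rg s' xx <= n + 3 \/ rg s' xx = zR) /\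
      forall i, 0 <= i -> ar s' aA i = if i <? rg s' xx - 2 then a i else 0).
  - lia.
  - intros s6 (Hx & Hx' & HA) Hf6. simpg.
    assert (F3 : rg s6 xn = n) by now rewrite (proj1 Hf6 xn eq_refl).
    rewrite F3. split; [lia|]. split; [easy|]. split; [easy|]. unfold zR in *. split.
    + intros Hlt.
      assert (Hr : raw s6 (rg s6 xx) = a (rg s6 xx - 2)).
      { rewrite (proj2 (proj2 Hf6) eq_refl), Hraw. apply H6. lia. }
      apply (T_seq Y 61 hi 1), T_rld; [lia|lia|]. simpg. rewrite Hr.
      pose proof (Ha (rg s6 xx - 2)). pose proof (Hamx (rg s6 xx - 2)).
      apply T_sto'; simpg; [easy|easy|lia|lia|].
      apply T_asg; simpg; [easy|lia|lia|].
      intros _. split; [|lia]. split; [lia|]. split; [lia|].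
      intros i Hi. rewrite HA by easy.
      destruct (Z.eqb_spec i (rg s6 xx - 2)) as [->|];
        destruct (Z.ltb_spec (rg s6 xx - 2) (rg s6 xx + 1 - 2)); try lia;
        destruct (Z.ltb_spec i (rg s6 xx + 1 - 2)), (Z.ltb_spec i (rg s6 xx - 2)); lia.
    + intros Hge3.
      assert (S1 : rg s6 xM = 1) by now rewrite (proj1 Hf6 xM eq_refl).
      assert (S2 : rg s6 xm = 0) by now rewrite (proj1 Hf6 xm eq_refl).
      assert (S3 : rg s6 xv = 0) by now rewrite (proj1 Hf6 xv eq_refl).
      assert (S4 : rg s6 xS = 1) by now rewrite (proj1 Hf6 xS eq_refl).
      assert (S5 : rg s6 xK = K) by (rewrite (proj1 Hf6 xK eq_refl); exact HKj).
      assert (S6 : rg s6 xL = L) by (rewrite (proj1 Hf6 xL eq_refl); exact F2).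
      assert (S7 : rg s6 xN = N).
      { rewrite (proj1 Hf6 xN eq_refl). unfold s5. simpg. now rewrite (proj1 Hf4 xN eq_refl). }
      assert (S8 : rg s6 xl = l).
      { rewrite (proj1 Hf6 xl eq_refl). unfold s5. simpg. rewrite (proj1 Hf4 xl eq_refl). exact Hll. }
      split; [|exact S4]. unfold Main, genv, Sol.
      rewrite S1, S2, S3, S4.
      rewrite (proj1 (proj2 Hf6) aST eq_refl), (proj1 (proj2 Hf6) aSM eq_refl),
        (proj1 (proj2 Hf6) aOUT eq_refl), !Har.
      split; [|split; [lia|split; [|split; [|split; [lia|split; [lia|split; [lia|split; [|now left]]]]]]]].
      * split; [easy|]. split; [easy|]. split; [easy|]. split; [easy|]. split; [easy|].
        intros i Hi. rewrite HA by easy. destruct (Z.ltb_spec i (rg s6 xx - 2)); [easy|].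
        symmetry. apply Haout. lia.
      * intros c Hc. rewrite H5; lia.
      * intros j Hj2. apply H5; lia.
      * intros x Hx2. rewrite H5; lia.
  - unfold s5 at 1 2 3. simpg. split; [lia|]. split; [now right|].
    rewrite Har. unfold s5. simpg. exact H4.
  - unfold s5. simpg. unfold zR in *. lia.
Qed.

Definition tF : Z := 2 + 9 * n.

Lemma FINAL_ok s v : rg s xn = n -> rg s xv = v ->
  (forall x, 0 <= x -> 0 <= ar s aOUT x <= v * (k + 1) + k) ->
  spec Y zR hi (FINAL k) s tF (fun s' => forall x, 1 <= x <= n ->
      ar s' aFIN (n + 2 + x) = lab k v (ar s aOUT) x /\
      (zR <= n + 2 + x -> raw s' (n + 2 + x) = lab k v (ar s aOUT) x)).
Proof.
  intros Hsn Hv Hout.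
  apply spec_intro. intros tm Htm.
  unfold tF in Htm. unfold FINAL. apply T_asg'; simpg; [easy|lia|].
  eapply T_while with (mu := fun s' => n + 1 - rg s' xx) (tb := 8)
    (I := fun s' => 1 <= rg s' xx <= n + 1 /\ forall x, 1 <= x < rg s' xx ->
      ar s' aFIN (n + 2 + x) = lab k v (ar s aOUT) x /\
      (zR <= n + 2 + x -> raw s' (n + 2 + x) = lab k v (ar s aOUT) x)).
  - lia.
  - intros s1 (Hx & HI) Hf. simpg.
    assert (F1 : rg s1 xn = n) by (rewrite (proj1 Hf xn eq_refl); exact Hsn).
    assert (F2 : rg s1 xv = v) by (rewrite (proj1 Hf xv eq_refl); exact Hv).
    assert (F3 : ar s1 aOUT = ar s aOUT) by (rewrite (proj1 (proj2 Hf) aOUT eq_refl); reflexivity).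
    rewrite F1. split; [lia|]. split; [easy|]. split; [easy|]. split.
    + intros Hlt. set (x := rg s1 xx) in *. specialize (Hout x ltac:(lia)).
      assert (Hrest : forall s2 tm', 5 <= tm' -> rg s2 xs = lab k v (ar s aOUT) x -> rg s2 xx = x ->
        rg s2 xn = n -> ar s2 aFIN = ar s1 aFIN -> raw s2 = raw s1 ->
        T (xy ::= $xn + #2 + $xx ;; aFIN:[$xy] ::= $xs ;;
           If #(zR - 1) < $xy Then Rst xy xs Fi ;; xx ::= $xx + #1) s2 tm'
         (fun s' => frame (xs ::= #0 ;;
             If $xv * #(k + 1) < aOUT.[$xx] Then xs ::= aOUT.[$xx] - $xv * #(k + 1) Fi ;;
             xy ::= $xn + #2 + $xx ;; aFIN:[$xy] ::= $xs ;;
             If #(zR - 1) < $xy Then Rst xy xs Fi ;; xx ::= $xx + #1) (setr s xx 1) s' ->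
           (1 <= rg s' xx <= n + 1 /\ (forall x0, 1 <= x0 < rg s' xx ->
            ar s' aFIN (n + 2 + x0) = lab k v (ar s aOUT) x0 /\
           (zR <= n + 2 + x0 -> raw s' (n + 2 + x0) = lab k v (ar s aOUT) x0))) /\
           n + 1 - rg s' xx < n + 1 - x)).
      { intros s2 tm' Htm' G1 G2 G3 G4 G5.
        assert (Hlabb : 0 <= lab k v (ar s aOUT) x <= k).
        { unfold lab. destruct (Z.ltb_spec (v * (k + 1)) (ar s aOUT x)); lia. }
        set (lx := lab k v (ar s aOUT) x) in *.
        apply T_asg'; simpg; rewrite ?G2, ?G3; [easy|lia|].
        apply T_sto'; simpg; rewrite ?G1; [easy|easy|lia|lia|].
        apply T_if'; simpg; [easy|easy| |]; intros Hcase.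
        - apply (T_seq Y zR hi 1), T_rst; simpg; [unfold zR in *; lia|lia|].
          apply T_asg; simpg; rewrite ?G2; [easy|lia|lia|].
          intros _. split; [|lia]. split; [lia|]. intros x0 Hx0. rewrite G4, G5.
          destruct (Z.eqb_spec (n + 2 + x0) (n + 2 + x)) as [He|Hne].
          + assert (x0 = x) by lia. subst x0. auto.
          + apply HI. lia.
        - apply T_asg; simpg; rewrite ?G2; [easy|lia|lia|].
          intros _. split; [|lia]. split; [lia|]. intros x0 Hx0. rewrite G4, G5.
          destruct (Z.eqb_spec (n + 2 + x0) (n + 2 + x)) as [He|Hne].
          + assert (x0 = x) by lia. subst x0. split; [easy|]. unfold zR in *. lia.
          + apply HI. lia. }
      apply T_asg'; simpg; [easy|lia|].
      apply T_if'; simpg; rewrite ?F2, ?F3; fold x; [easy|split; [easy|lia]| |]; intros Hcase.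
      * apply T_asg'; simpg; rewrite ?F2, ?F3; fold x.
        { repeat split; easy || lia. }
        { lia. }
        apply Hrest; simpg; try easy; try lia. unfold lab. apply Z.ltb_lt in Hcase. now rewrite Hcase.
      * apply Hrest; simpg; try easy; try lia. unfold lab. apply Z.ltb_ge in Hcase. now rewrite Hcase.
    + intros Hge x Hx2. apply HI. lia.
  - simpg. split; [lia|]. intros; lia.
  - simpg. lia.
Qed.

Notation tM := (tM n k l N L).
Definition tP : Z := tI + tM + tF.

Lemma PROG_ok s : init_ok s ->
  T (PROG k) s tP (fun s' => exists g M m, 1 <= M /\ 0 <= m /\
    (forall x, 1 <= x <= n -> ar s' aFIN (n + 2 + x) = g x /\
      (zR <= n + 2 + x -> raw s' (n + 2 + x) = g x)) /\
    (m = 0 \/ forall j, 0 <= j < k -> m <= lsum a g j (n + 1) <= M) /\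
    (forall h t U V, 0 <= h <= n -> 0 <= t < l -> 0 < V -> HasCand a k N L h t U V -> M * V <= U * m)).
Proof.
  intros Hs.
  pose proof (E_bounds p q Hpq) as [BE1 BE2]. pose proof (l_spec k p q Hpq Hk) as (Bl1 & Bl2 & Bl3).
  pose proof (N_bounds k p q Hpq Hk) as [BN1 BN2]. pose proof (L_bounds k p q Hpq Hk) as [BL1 BL2]. pose proof (K_bounds k p q Hpq Hk) as BK.
  pose proof Ha as Ha'.
  unfold tP, PROG. apply (T_seq Y zR hi tI), INIT_ok; [exact Hs|lia|]. intros s1 _ (HM & HS).
  eapply (T_seq Y zR hi tM), (MAIN_ok Y zR hi a n k l N L) with (amx := amx); try easy; try lia.
  intros s2 _ (Henv & HSol & Hb). destruct HSol as (S1 & S2 & S3 & S4 & S5).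
  eapply FINAL_ok with (v := rg s2 xv); [apply Henv|easy|exact S4|lia|].
  intros s3 _ Hout. exists (lab k (rg s2 xv) (ar s2 aOUT)), (rg s2 xM), (rg s2 xm). auto.
Qed.
End Verif3.

(** * Relocating the input *)

Definition save (i : nat) : list instr := [IAdd 0 0 3; IStore 0 (4 + i)].
Definition restore (i : nat) : list instr := [ILoad (3 + i) 0; IAdd 0 0 1].

(* The cells used as registers hold part of the input: it is moved first to
   where the array [aA] will be.  Only cell 0 is available as a pointer, and
   multiplying [n] by a power of 2 takes it beyond the input. *)
Definition prologue : list instr :=
  repeat (IAdd 0 0 0) 7 ++
  [IStore 0 3; IConst 3 0; IJlt 3 0 11; IHalt; IConst 3 8] ++
  flat_map save (seq 0 57) ++
  [IConst 4 456; ISub 0 0 4; IConst 4 128; IDiv 3 0 4; IConst 4 8; ISub 0 0 4].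

(** [base + 30] is [base + 8 * 3 + 6], the address of entry 3 of [aFIN]. The 58 loads fill cells 3
    to 60. *)
Definition epilogue : list instr :=
  [IConst 1 30; IAdd 0 0 1; IConst 1 8] ++ flat_map restore (seq 0 58) ++ [IHalt].

Definition full (k : Z) : program := prologue ++ cc 132 (PROG k) ++ epilogue.

Section Mach.
Variables (w : Z) (prog : program) (Y B kap : Z).
Hypothesis HY : 1000 <= Y.
Hypothesis HB : 1000 * Y <= B.
Hypothesis Hkap : forall vs, Forall (fun v => Z.abs v <= B) vs -> op_cost w vs <= kap.

Notation reach := (reach w prog).

Lemma kpos : 1 <= kap.
Proof. exact (kap_pos w B kap Hkap). Qed.

Lemma r_add pc m d a b : nth_error prog pc = Some (IAdd d a b) ->
  Z.abs (m a) <= B -> Z.abs (m b) <= B -> Z.abs (m a + m b) <= B ->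
  reach (mkState pc m) (mkState (S pc) (upd m d (m a + m b))) kap.
Proof. exact (r_op w prog B kap Hkap Add pc m d a b). Qed.

Lemma r_sub pc m d a b : nth_error prog pc = Some (ISub d a b) ->
  Z.abs (m a) <= B -> Z.abs (m b) <= B -> Z.abs (m a - m b) <= B ->
  reach (mkState pc m) (mkState (S pc) (upd m d (m a - m b))) kap.
Proof. exact (r_op w prog B kap Hkap Sub pc m d a b). Qed.

Lemma r_div pc m d a b : nth_error prog pc = Some (IDiv d a b) ->
  Z.abs (m a) <= B -> Z.abs (m b) <= B -> Z.abs (m a / m b) <= B ->
  reach (mkState pc m) (mkState (S pc) (upd m d (m a / m b))) kap.
Proof. exact (r_op w prog B kap Hkap Div pc m d a b). Qed.

Lemma doubling c : forall pc m, code_at prog pc (repeat (IAdd 0 0 0) c) ->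
  0 <= m O -> 2 ^ Z.of_nat c * m O <= B ->
  exists m', reach (mkState pc m) (mkState (pc + c) m') (Z.of_nat c * kap) /\
    m' O = 2 ^ Z.of_nat c * m O /\ forall x, x <> O -> m' x = m x.
Proof.
  pose proof kpos. induction c as [|c IH]; intros pc m Hc H0 Hb.
  - exists m. rewrite Nat.add_0_r. split; [apply reach_refl; lia|]. split; [|easy].
    change (2 ^ Z.of_nat 0) with 1. lia.
  - cbn [repeat] in Hc. apply code_at_cons in Hc. destruct Hc as [C1 C2].
    replace (Z.of_nat (S c)) with (Z.of_nat c + 1) in * by lia.
    rewrite Z.pow_add_r, Z.pow_1_r in Hb |- * by lia.
    pose proof (Z.pow_pos_nonneg 2 (Z.of_nat c) ltac:(lia) ltac:(lia)).
    assert (Hm2 : m O + m O <= B) by nia.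
    destruct (IH (S pc) (upd m 0 (m O + m O)) C2) as (m' & R & E & HS).
    + rewrite upd_same. lia.
    + rewrite upd_same. lia.
    + exists m'. rewrite upd_same in E. split; [|split].
      * replace (pc + S c)%nat with (S pc + c)%nat by lia.
        eapply reach_trans; [eapply r_add; [exact C1|lia|lia|lia]|exact R|lia].
      * rewrite E. ring.
      * intros x Hx. rewrite HS, upd_diff by easy. easy.
Qed.

(** All targets lie above cell 60, so no source is overwritten before it is saved. *)
Lemma saving b0 cnt : forall i pc m, code_at prog pc (flat_map save (seq i cnt)) ->
  (i + cnt <= 57)%nat -> m O = b0 + 8 * Z.of_nat i -> m 3%nat = 8 -> 61 <= b0 -> b0 + 500 <= B ->
  (forall x, x <> O -> Z.abs (m x) <= B) ->
  exists m', reach (mkState pc m) (mkState (pc + 2 * cnt) m') (2 * Z.of_nat cnt * kap) /\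
    m' O = b0 + 8 * Z.of_nat (i + cnt) /\
    (forall j, (i <= j < i + cnt)%nat -> m' (Z.to_nat (b0 + 8 * (Z.of_nat j + 1))) = m (4 + j)%nat) /\
    (forall x, x <> O -> (forall j, (i <= j < i + cnt)%nat -> Z.of_nat x <> b0 + 8 * (Z.of_nat j + 1)) ->
       m' x = m x).
Proof.
  pose proof kpos. induction cnt as [|cnt IH]; intros i pc m Hc Hi H0 H3 Hb0 HbB Hm.
  - exists m. rewrite Nat.mul_0_r, !Nat.add_0_r. split; [apply reach_refl; lia|].
    split; [easy|]. split; [lia|easy].
  - cbn [seq flat_map] in Hc. apply code_at_app in Hc. destruct Hc as [C1 C2].
    apply code_at_cons in C1. destruct C1 as [C0 C1].
    apply code_at_cons in C1. destruct C1 as [C1 _].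
    cbn [length save] in C2.
    assert (Hx : m O + m 3%nat = b0 + 8 * (Z.of_nat i + 1)) by lia.
    set (m1 := upd m 0 (b0 + 8 * (Z.of_nat i + 1))).
    set (m2 := upd m1 (Z.to_nat (b0 + 8 * (Z.of_nat i + 1))) (m (4 + i)%nat)).
    destruct (IH (S i) (pc + 2)%nat m2 C2) as (m' & R & E0 & E1 & E2).
    + lia.
    + unfold m2, m1. rewrite upd_diff, upd_same by lia. lia.
    + unfold m2, m1. rewrite !upd_diff by lia. easy.
    + easy.
    + easy.
    + intros x Hx0. unfold m2, m1, upd. destruct (Nat.eqb x _); [apply Hm; lia|].
      destruct (Nat.eqb_spec x 0); [lia|now apply Hm].
    + exists m'. split; [|split; [|split]].
      * replace (pc + 2 * S cnt)%nat with (pc + 2 + 2 * cnt)%nat by lia.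
        refine (reach_trans _ _ _ _ _ kap (kap + 2 * Z.of_nat cnt * kap) _ _ _ _).
        { eapply r_add; [exact C0|..].
          - rewrite H0. lia.
          - rewrite H3. lia.
          - rewrite Hx. lia. }
        { rewrite Hx. fold m1. refine (reach_trans _ _ _ _ _ kap (2 * Z.of_nat cnt * kap) _ _ _ _).
          - eapply r_store; [exact Hkap|exact C1|..].
            + unfold m1. rewrite upd_same. lia.
            + unfold m1. rewrite upd_diff by lia. apply Hm. lia.
          - assert (K1 : m1 O = b0 + 8 * (Z.of_nat i + 1)) by apply upd_same.
            assert (K2 : m1 (4 + i)%nat = m (4 + i)%nat) by (apply upd_diff; lia).
            rewrite K1, K2. fold m2.
            replace (S (S pc)) with (pc + 2)%nat by lia. exact R.
          - lia. }
        lia.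
      * rewrite E0. f_equal. f_equal. lia.
      * intros j Hj. destruct (Nat.eq_dec j i) as [->|Hne].
        -- rewrite E2; [unfold m2; now rewrite upd_same|lia|]. intros j' Hj'. lia.
        -- rewrite E1 by lia. unfold m2, m1. now rewrite !upd_diff by lia.
      * intros x Hx0 Hxj. rewrite E2; [|easy|].
        -- unfold m2, m1. rewrite !upd_diff; [easy|easy|]. specialize (Hxj i ltac:(lia)). lia.
        -- intros j Hj. apply Hxj. lia.
Qed.

(** [base = 128 * n - 8] puts entry 1 of [aA] at [128 * n]. Seven doublings are needed: [64 * n - 8]
    would fall among the working cells when [n = 1]. After 57 steps the pointer is [128 * n + 456],
    from which both [n] and [base] are recovered. Cells 1 and 2 hold [p] and [q], already in the
    places of variables [xp] and [xq]. *)
Lemma prologue_ok n m : code_at prog 0 prologue -> 1 <= n -> m O = n ->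
  (forall x, Z.abs (m x) <= Y) -> 128 * n + 1000 <= Y ->
  exists m', reach (mkState 0 m) (mkState 132 m') (132 * kap) /\
    m' O = 128 * n - 8 /\ m' 1%nat = m 1%nat /\ m' 2%nat = m 2%nat /\ m' 3%nat = n /\
    (forall j, (j <= 57)%nat -> m' (Z.to_nat (128 * n + 8 * Z.of_nat j)) = m (3 + j)%nat) /\
    (forall x, (5 <= x)%nat -> (forall j, (j <= 57)%nat -> Z.of_nat x <> 128 * n + 8 * Z.of_nat j) ->
       m' x = m x) /\
    (forall x, Z.abs (m' x) <= Y).
Proof.
  intros Hc Hn H0 Hm HnY. pose proof kpos. unfold prologue in Hc.
  apply code_at_app in Hc. destruct Hc as [C1 Hc]. rewrite repeat_length in Hc.
  destruct (doubling 7 0 m C1) as (m1 & R1 & E1 & F1); [lia|change (2 ^ Z.of_nat 7) with 128; lia|].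
  change (2 ^ Z.of_nat 7) with 128 in E1. rewrite H0 in E1. cbn [Nat.add] in R1, Hc.
  apply code_at_app in Hc. destruct Hc as [C2 Hc]. cbn [length Nat.add] in Hc.
  apply code_at_cons in C2. destruct C2 as [D1 C2].
  apply code_at_cons in C2. destruct C2 as [D2 C2].
  apply code_at_cons in C2. destruct C2 as [D3 C2].
  apply code_at_cons in C2. destruct C2 as [_ C2].
  apply code_at_cons in C2. destruct C2 as [D4 _].
  apply code_at_app in Hc. destruct Hc as [C3 Hc].
  assert (Hm1 : forall x, x <> O -> Z.abs (m1 x) <= Y) by (intros x Hx; rewrite F1; auto).
  set (m2 := upd m1 (Z.to_nat (128 * n)) (m 3%nat)).
  set (m3 := upd m2 3 0). set (m4 := upd m3 3 8).
  assert (R2 : reach (mkState 7 m1) (mkState 12 m4) (4 * kap)).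
  { refine (reach_trans _ _ _ _ _ kap (3 * kap) _ _ _ _).
    - eapply r_store; [exact Hkap|exact D1|lia|]. rewrite F1 by lia. specialize (Hm 3%nat). lia.
    - rewrite E1, (F1 3%nat) by lia. fold m2.
      refine (reach_trans _ _ _ _ _ kap (2 * kap) _ _ _ _).
      + eapply r_const; [exact Hkap|exact D2|lia].
      + fold m3. assert (G1 : m3 3%nat = 0) by apply upd_same.
        assert (G2 : m3 O = 128 * n) by (unfold m3, m2; rewrite !upd_diff by lia; easy).
        refine (reach_trans _ _ _ _ _ kap kap _ _ _ _).
        * eapply r_jlt; [exact Hkap|exact D3|lia|lia].
        * rewrite G1, G2. replace (0 <? 128 * n) with true by lia.
          eapply r_const; [exact Hkap|exact D4|lia].
        * lia.
      + lia.
    - lia. }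
  assert (G0 : m4 O = 128 * n) by (unfold m4, m3, m2; rewrite !upd_diff by lia; easy).
  assert (Hm4 : forall x, x <> O -> Z.abs (m4 x) <= Y).
  { intros x Hx. unfold m4, m3, m2, upd. destruct (Nat.eqb x 3); [lia|]. destruct (Nat.eqb x _); auto. }
  destruct (saving (128 * n) 57 0 12 m4 C3) as (m5 & R3 & E3 & E4 & E5).
  { lia. } { rewrite G0. lia. } { apply upd_same. } { lia. } { lia. }
  { intros x Hx. specialize (Hm4 x Hx). lia. }
  assert (Hlen : length (flat_map save (seq 0 57)) = 114%nat) by reflexivity.
  rewrite Hlen in Hc. cbn [Nat.add Nat.mul] in Hc, R3, E3, E4, E5.
  repeat (apply code_at_cons in Hc; let D := fresh "D" in destruct Hc as [D Hc]).
  set (m6 := upd m5 4 456). set (m7 := upd m6 0 (128 * n)). set (m8 := upd m7 4 128).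
  set (m9 := upd m8 3 n). set (m10 := upd m9 4 8). set (m11 := upd m10 0 (128 * n - 8)).
  assert (R4 : reach (mkState 126 m5) (mkState 132 m11) (6 * kap)).
  { refine (reach_trans _ _ _ _ _ kap (5 * kap) _ _ _ _);
      [eapply r_const; [exact Hkap|eassumption|lia]| |lia]. fold m6.
    assert (K1 : m6 O = 128 * n + 456) by (unfold m6; rewrite upd_diff by lia; lia).
    assert (K2 : m6 4%nat = 456) by apply upd_same.
    refine (reach_trans _ _ _ _ _ kap (4 * kap) _ _ _ _);
      [eapply r_sub; [eassumption|lia|lia|lia]| |lia].
    rewrite K1, K2. replace (128 * n + 456 - 456) with (128 * n) by ring. fold m7.
    refine (reach_trans _ _ _ _ _ kap (3 * kap) _ _ _ _);
      [eapply r_const; [exact Hkap|eassumption|lia]| |lia]. fold m8.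
    assert (K3 : m8 O = 128 * n) by (unfold m8, m7; rewrite upd_diff, upd_same by lia; lia).
    assert (K4 : m8 4%nat = 128) by apply upd_same.
    assert (K5 : m8 O / m8 4%nat = n) by (rewrite K3, K4, Z.mul_comm, Z.div_mul; lia).
    refine (reach_trans _ _ _ _ _ kap (2 * kap) _ _ _ _);
      [eapply r_div; [eassumption|lia|lia|lia]| |lia].
    rewrite K5. fold m9.
    refine (reach_trans _ _ _ _ _ kap kap _ _ _ _);
      [eapply r_const; [exact Hkap|eassumption|lia]| |lia]. fold m10.
    assert (K6 : m10 O = 128 * n) by (unfold m10, m9; rewrite !upd_diff by lia; lia).
    assert (K7 : m10 4%nat = 8) by apply upd_same.
    unfold m11. rewrite <- K6, <- K7. eapply r_sub; [eassumption|lia|lia|lia]. }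
  assert (Hm11 : forall x, x <> O -> x <> 3%nat -> x <> 4%nat -> m11 x = m5 x).
  { intros x X0 X3 X4. unfold m11, m10, m9, m8, m7, m6. now rewrite !upd_diff by easy. }
  assert (Hsv : forall j, (j <= 57)%nat -> m5 (Z.to_nat (128 * n + 8 * Z.of_nat j)) = m (3 + j)%nat).
  { intros j Hj. destruct j as [|j].
    - rewrite E5; [|lia|lia]. unfold m4, m3. rewrite !upd_diff by lia. unfold m2.
      replace (128 * n + 8 * Z.of_nat 0) with (128 * n) by lia. now rewrite upd_same.
    - replace (Z.of_nat (S j)) with (Z.of_nat j + 1) by lia. rewrite E4 by lia.
      unfold m4, m3, m2. rewrite !upd_diff by lia. rewrite F1 by lia. f_equal. }
  assert (Hot : forall x, (5 <= x)%nat ->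
     (forall j, (j <= 57)%nat -> Z.of_nat x <> 128 * n + 8 * Z.of_nat j) -> m5 x = m x).
  { intros x Hx Hxj. rewrite E5; [|lia|].
    - unfold m4, m3, m2. specialize (Hxj 0%nat ltac:(lia)). rewrite !upd_diff by lia. apply F1. lia.
    - intros j Hj. specialize (Hxj (S j) ltac:(lia)). lia. }
  exists m11. repeat match goal with |- _ /\ _ => split end.
  - eapply reach_trans; [exact R1|eapply reach_trans; [exact R2|eapply reach_trans; [exact R3|exact R4|apply Z.le_refl]|apply Z.le_refl]|lia].
  - apply upd_same.
  - rewrite Hm11, E5 by lia. unfold m4, m3, m2. rewrite !upd_diff by lia. apply F1; lia.
  - rewrite Hm11, E5 by lia. unfold m4, m3, m2. rewrite !upd_diff by lia. apply F1; lia.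
  - unfold m11, m10. rewrite !upd_diff by lia. apply upd_same.
  - intros j Hj. rewrite Hm11 by lia. now apply Hsv.
  - intros x Hx Hxj. rewrite Hm11 by lia. now apply Hot.
  - intros x. destruct (Nat.eq_dec x 0) as [->|X0]; [unfold m11; rewrite upd_same; lia|].
    destruct (Nat.eq_dec x 3) as [->|X3].
    { unfold m11, m10. rewrite !upd_diff by lia. unfold m9. rewrite upd_same. lia. }
    destruct (Nat.eq_dec x 4) as [->|X4].
    { unfold m11. rewrite !upd_diff by lia. unfold m10. rewrite upd_same. lia. }
    rewrite Hm11 by easy.
    destruct (find_max (fun i => Z.of_nat x = 128 * n + 8 * (i - 1))) with (b := 58) as [(i & Hi & Hx)|Hno].
    + intros i. apply Z.eq_dec.
    + lia.
    + assert (Hxe : x = Z.to_nat (128 * n + 8 * Z.of_nat (Z.to_nat (i - 1)))) by lia.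
      rewrite Hxe, Hsv by lia. apply Hm.
    + rewrite E5; [now apply Hm4|easy|]. intros j Hj Hx. apply (Hno (Z.of_nat j + 2)); lia.
Qed.

Lemma prologue_0 m : code_at prog 0 prologue -> m O = 0 -> m 3%nat = 0 ->
  exists m', reach (mkState 0 m) (mkState 10 m') (132 * kap) /\ nth_error prog 10 = Some IHalt.
Proof.
  intros Hc H0 H3. pose proof kpos. unfold prologue in Hc.
  apply code_at_app in Hc. destruct Hc as [C1 Hc]. rewrite repeat_length in Hc.
  destruct (doubling 7 0 m C1) as (m1 & R1 & E1 & F1); [lia|rewrite H0; lia|].
  rewrite H0, Z.mul_0_r in E1. cbn [Nat.add] in R1, Hc.
  apply code_at_app in Hc. destruct Hc as [C2 Hc].
  apply code_at_cons in C2. destruct C2 as [D1 C2].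
  apply code_at_cons in C2. destruct C2 as [D2 C2].
  apply code_at_cons in C2. destruct C2 as [D3 C2].
  apply code_at_cons in C2. destruct C2 as [D4 C2].
  set (m2 := upd m1 0 0). set (m3 := upd m2 3 0).
  exists m3. split; [|exact D4].
  eapply reach_trans; [exact R1| |].
  - refine (reach_trans _ _ _ _ _ kap (2 * kap) _ _ _ _).
    + eapply r_store; [exact Hkap|exact D1|lia|]. rewrite F1 by lia. lia.
    + rewrite E1, (F1 3%nat), H3 by lia. cbn [Z.to_nat]. fold m2.
      refine (reach_trans _ _ _ _ _ kap kap _ _ _ _).
      * eapply r_const; [exact Hkap|exact D2|lia].
      * fold m3. assert (G1 : m3 3%nat = 0) by apply upd_same.
        assert (G2 : m3 O = 0) by reflexivity.
        assert (R : reach (mkState 9 m3) (mkState (if m3 3%nat <? m3 O then 11%nat else 10%nat) m3) kap)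
          by (eapply r_jlt; [exact Hkap|exact D3|lia|lia]).
        rewrite G1, G2 in R. exact R.
      * lia.
    + apply Z.le_refl.
  - lia.
Qed.

(** Sources lie above cell 60 and targets at or below it; cells 0 and 1, holding pointer and stride,
    are not targets. *)
Lemma restoring b cnt : forall i pc m, code_at prog pc (flat_map restore (seq i cnt)) ->
  (i + cnt <= 58)%nat -> m O = b + 8 * (3 + Z.of_nat i) -> m 1%nat = 8 -> 61 <= b -> b + 1000 <= B ->
  (forall c, (3 <= c < 61)%nat -> Z.abs (m (Z.to_nat (b + 8 * Z.of_nat c))) <= B) ->
  exists m', reach (mkState pc m) (mkState (pc + 2 * cnt) m') (2 * Z.of_nat cnt * kap) /\
    (forall c, (3 + i <= c < 3 + i + cnt)%nat -> m' c = m (Z.to_nat (b + 8 * Z.of_nat c))) /\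
    (forall x, (61 <= x)%nat \/ (2 <= x < 3 + i)%nat -> m' x = m x).
Proof.
  pose proof kpos. induction cnt as [|cnt IH]; intros i pc m Hc Hi H0 H1 Hb HbB Hm.
  - exists m. rewrite Nat.mul_0_r, !Nat.add_0_r. split; [apply reach_refl; lia|]. split; [lia|easy].
  - cbn [seq flat_map] in Hc. apply code_at_app in Hc. destruct Hc as [C1 C2].
    apply code_at_cons in C1. destruct C1 as [C0 C1].
    apply code_at_cons in C1. destruct C1 as [C1 _].
    cbn [length restore] in C2.
    assert (Hx : m O = b + 8 * Z.of_nat (3 + i)) by lia.
    set (v := m (Z.to_nat (b + 8 * Z.of_nat (3 + i)))).
    set (m1 := upd m (3 + i) v).
    set (m2 := upd m1 0 (b + 8 * Z.of_nat (3 + i) + 8)).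
    destruct (IH (S i) (pc + 2)%nat m2 C2) as (m' & R & E1 & E2).
    + lia.
    + unfold m2. rewrite upd_same. lia.
    + unfold m2, m1. rewrite !upd_diff by lia. easy.
    + easy.
    + easy.
    + intros c Hcc. unfold m2, m1. rewrite !upd_diff by lia. now apply Hm.
    + exists m'. split; [|split].
      * replace (pc + 2 * S cnt)%nat with (pc + 2 + 2 * cnt)%nat by lia.
        refine (reach_trans _ _ _ _ _ kap (kap + 2 * Z.of_nat cnt * kap) _ _ _ _).
        { eapply r_load; [exact Hkap|exact C0|..].
          - rewrite Hx. lia.
          - rewrite Hx. apply Hm. lia. }
        { rewrite Hx. fold v m1. refine (reach_trans _ _ _ _ _ kap (2 * Z.of_nat cnt * kap) _ _ _ _).
          - assert (K1 : m1 O = b + 8 * Z.of_nat (3 + i)) by (unfold m1; rewrite upd_diff by lia; lia).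
            assert (K2 : m1 1%nat = 8) by (unfold m1; rewrite upd_diff by lia; lia).
            eapply r_add; [exact C1|lia|lia|lia].
          - assert (K1 : m1 O + m1 1%nat = b + 8 * Z.of_nat (3 + i) + 8).
            { unfold m1. rewrite !upd_diff by lia. lia. }
            rewrite K1. fold m2.
            replace (S (S pc)) with (pc + 2)%nat by lia. exact R.
          - lia. }
        lia.
      * intros c Hcc. destruct (Nat.eq_dec c (3 + i)) as [->|Hne].
        -- rewrite E2 by lia. unfold m2, m1. rewrite upd_diff, upd_same by lia. reflexivity.
        -- rewrite E1 by lia. unfold m2, m1. now rewrite !upd_diff by lia.
      * intros x Hx2. rewrite E2 by lia. unfold m2, m1. now rewrite !upd_diff by lia.
Qed.

Lemma epilogue_ok base pc m : code_at prog pc epilogue -> m O = base -> 61 <= base -> base + 2000 <= B ->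
  (forall c, (3 <= c < 61)%nat -> Z.abs (m (Z.to_nat (base + 8 * Z.of_nat c + 6))) <= B) ->
  exists m', reach (mkState pc m) (mkState (pc + 119) m') (119 * kap) /\
    nth_error prog (pc + 119) = Some IHalt /\
    (forall c, (3 <= c < 61)%nat -> m' c = m (Z.to_nat (base + 8 * Z.of_nat c + 6))) /\
    (forall x, (61 <= x)%nat -> m' x = m x).
Proof.
  intros Hc H0 Hb HbB Hm. pose proof kpos. unfold epilogue in Hc.
  apply code_at_app in Hc. destruct Hc as [C1 Hc].
  apply code_at_cons in C1. destruct C1 as [D1 C1].
  apply code_at_cons in C1. destruct C1 as [D2 C1].
  apply code_at_cons in C1. destruct C1 as [D3 _].
  apply code_at_app in Hc. destruct Hc as [C2 Hc].
  assert (Hlen : length (flat_map restore (seq 0 58)) = 116%nat) by reflexivity.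
  rewrite Hlen in Hc. cbn [length] in Hc, C2.
  set (m1 := upd m 1 30). set (m2 := upd m1 0 (base + 30)). set (m3 := upd m2 1 8).
  assert (R1 : reach (mkState pc m) (mkState (pc + 3) m3) (3 * kap)).
  { refine (reach_trans _ _ _ _ _ kap (2 * kap) _ _ _ _);
      [eapply r_const; [exact Hkap|exact D1|lia]| |lia]. fold m1.
    assert (K1 : m1 O = base) by (unfold m1; rewrite upd_diff by lia; lia).
    assert (K2 : m1 1%nat = 30) by apply upd_same.
    refine (reach_trans _ _ _ _ _ kap kap _ _ _ _);
      [eapply r_add; [exact D2|lia|lia|lia]| |lia].
    rewrite K1, K2. fold m2. replace (pc + 3)%nat with (S (S (S pc))) by lia.
    eapply r_const; [exact Hkap|exact D3|lia]. }
  destruct (restoring (base + 6) 58 0 (pc + 3) m3 C2) as (m' & R2 & E1 & E2).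
  - lia.
  - unfold m3, m2. rewrite upd_diff, upd_same by lia. lia.
  - apply upd_same.
  - lia.
  - lia.
  - intros c Hcc. unfold m3, m2, m1. rewrite !upd_diff by lia.
    replace (base + 6 + 8 * Z.of_nat c) with (base + 8 * Z.of_nat c + 6) by ring. now apply Hm.
  - exists m'. split; [|split; [|split]].
    + eapply reach_trans; [exact R1| |].
      * replace (pc + 119)%nat with (pc + 3 + 2 * 58)%nat by lia. exact R2.
      * lia.
    + apply code_at_cons in Hc. destruct Hc as [D4 _].
      replace (pc + 119)%nat with (pc + 3 + 116)%nat by lia. exact D4.
    + intros c Hcc. rewrite E1 by lia. unfold m3, m2, m1. rewrite !upd_diff by lia. f_equal. f_equal. ring.
    + intros x Hx. rewrite E2 by lia. unfold m3, m2, m1. now rewrite !upd_diff by lia.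
Qed.
End Mach.

(** * Sizes of numbers *)

(** Such numbers have at most [be * w + 1] bits, that is at most [be + 1] words. *)
Lemma op_cost_le w be vs : 1 <= w -> 0 <= be ->
  Forall (fun v => Z.abs v <= 2 ^ (be * w)) vs -> op_cost w vs <= (be + 1) * (be + 1).
Proof.
  intros Hw Hbe Hvs. unfold op_cost. set (b := fold_right Z.max 0 (map bits vs)).
  assert (Hb : 0 <= b <= be * w + 1).
  { unfold b. induction Hvs as [|v vs Hv Hvs IH]; cbn [map fold_right]; [lia|].
    assert (bits v <= be * w + 1).
    { unfold bits. apply Z.add_le_mono_r. rewrite <- (Z.log2_pow2 (be * w)) by lia.
      now apply Z.log2_le_mono. }
    unfold bits in *. pose proof (Z.log2_nonneg (Z.abs v)). lia. }
  assert (Hm : 0 <= (b + w - 1) / w <= be + 1).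
  { split; [apply Z.div_pos; lia|]. apply Z.div_le_upper_bound; lia. }
  cbv zeta. nia.
Qed.

Section Bounds.
Variables (n k p q w amx : Z).
Hypothesis Hn : 0 <= n < 2 ^ w.
Hypothesis Hk : 2 <= k.
Hypothesis Hpq : 0 < p < q.
Hypothesis Hqw : q < 2 ^ w.
Hypothesis Hamx : 0 <= amx < 2 ^ w.
Hypothesis Hw : 1 <= w.
Notation E := (cE p q).
Notation l := (cl k p q).
Notation N := (cN k p q).
Notation L := (cL k p q).
Notation K := (KK k L).

(** Every stored number fits in [alpha * w] bits. The dominant part comes from [K], which has about
    [(12 + 2*k + 4*w) * k] bits, and from its products with [n], [l] and [k] in the counter;
    [w >= 1] turns constants into multiples of [w]. *)
Definition alpha : Z := 2 * k * k + 20 * k + 32.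
Definition Yb : Z := 2 ^ (alpha * w).

Lemma ple_mul x y e f : 0 <= x <= 2 ^ e -> 0 <= y <= 2 ^ f -> 0 <= e -> 0 <= f ->
  0 <= x * y <= 2 ^ (e + f).
Proof. intros Hx Hy He Hf. rewrite Z.pow_add_r by easy. nia. Qed.

Lemma ple_add x y e : 0 <= x <= 2 ^ e -> 0 <= y <= 2 ^ e -> 0 <= e -> 0 <= x + y <= 2 ^ (e + 1).
Proof. intros Hx Hy He. rewrite Z.pow_add_r, Z.pow_1_r by lia. lia. Qed.

Lemma ple_mono x e f : 0 <= x <= 2 ^ e -> e <= f -> 0 <= x <= 2 ^ f.
Proof. intros Hx Hf. pose proof (Z.pow_le_mono_r 2 e f ltac:(lia) Hf). lia. Qed.

Lemma ple_self x : 0 <= x -> 0 <= x <= 2 ^ x.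
Proof. intros Hx. pose proof (Z.pow_gt_lin_r 2 x ltac:(lia) Hx). lia. Qed.

Definition zexp : Z := (12 + 2 * k + 4 * w) * k + 25 + 4 * k + 7 * w.

Lemma zexp_le : zexp <= alpha * w.
Proof. unfold zexp, alpha. nia. Qed.

Local Ltac ex := match goal with
  | Hkk : 0 <= ?kk, Hkw : 0 <= ?kw, HA : ?A = _, Hz : zexp = _ |- _ =>
    clear - Hk Hw Hkk Hkw HA Hz; lia
  end.

Lemma sizes : 2 * n + 20 * k + 100 <= Yb /\ 128 * n + 2000 <= Yb /\ E <= Yb /\ l <= Yb /\ N <= Yb /\
  L <= Yb /\ 2 ^ l <= Yb /\ amx <= Yb /\ q <= Yb /\ 8 * (2 ^ l * amx) + amx + k + K + 10 <= Yb /\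
  (1 + (n + 1) * l * (N + K)) * (k + 1) + k < Yb.
Proof.
  set (kk := k * k). set (kw := k * w).
  assert (Hkk : 0 <= kk) by (unfold kk; nia). assert (Hkw : 0 <= kw) by (unfold kw; nia).
  assert (Hz : zexp = 12 * k + 2 * kk + 4 * kw + 25 + 4 * k + 7 * w) by (unfold zexp, kk, kw; ring).
  assert (HY : forall x e, 0 <= x <= 2 ^ e -> e <= zexp -> x <= Yb).
  { intros x e Hx He. apply (ple_mono x e (alpha * w)); [assumption|]. pose proof zexp_le. lia. }
  assert (HE2 : 1 <= q / p /\ q / p <= q).
  { split; [apply Z.div_le_lower_bound; lia|]. apply Z.div_le_upper_bound; nia. }
  assert (BE : 0 <= E <= 2 ^ w) by (unfold cE; lia).
  assert (Bk : 0 <= k <= 2 ^ k) by (apply ple_self; lia).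
  assert (Bk1 : 0 <= k + 1 <= 2 ^ k).
  { pose proof (Z.pow_gt_lin_r 2 k ltac:(lia) ltac:(lia)). lia. }
  assert (B20 : 0 <= 20 <= 2 ^ 5) by (cbn; lia).
  assert (B8 : 0 <= 8 <= 2 ^ 3) by (cbn; lia).
  assert (B40 : 0 <= 40 <= 2 ^ 6) by (cbn; lia).
  assert (Bx : 0 <= 20 * k * E * E <= 2 ^ (5 + k + w + w)).
  { repeat apply ple_mul; try assumption; lia. }
  assert (Bl : 0 <= l <= 5 + k + 2 * w).
  { unfold cl. split; [apply Z.log2_up_nonneg|].
    replace (5 + k + 2 * w) with (Z.log2_up (2 ^ (5 + k + w + w))) by (rewrite Z.log2_up_pow2; lia).
    apply Z.log2_up_le_mono, Bx. }
  assert (B2l : 0 <= 2 ^ l <= 2 ^ (5 + k + 2 * w)).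
  { split; [apply Z.pow_nonneg; lia|]. apply Z.pow_le_mono_r; lia. }
  assert (Bl' : 0 <= l <= 2 ^ (5 + k + 2 * w)) by (pose proof (ple_self l ltac:(lia)); lia).
  assert (BN : 0 <= N <= 2 ^ (5 + k + 2 * w + k + w)).
  { unfold cN. repeat apply ple_mul; try assumption; lia. }
  assert (BL : 0 <= L <= 2 ^ (6 + (5 + k + 2 * w + k + w) + w)).
  { unfold cL. repeat apply ple_mul; try assumption; try lia. }
  assert (BL1 : 0 <= L + 1 <= 2 ^ (12 + 2 * k + 4 * w)).
  { replace (12 + 2 * k + 4 * w) with (6 + (5 + k + 2 * w + k + w) + w + 1) by ring.
    apply ple_add; [assumption| |lia]. pose proof (Z.pow_pos_nonneg 2 (6 + (5 + k + 2 * w + k + w) + w)). lia. }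
  assert (BK : 0 <= K <= 2 ^ (12 * k + 2 * kk + 4 * kw)).
  { unfold KK. split; [apply Z.pow_nonneg; lia|].
    replace (12 * k + 2 * kk + 4 * kw) with ((12 + 2 * k + 4 * w) * k) by (unfold kk, kw; ring).
    rewrite Z.pow_mul_r by lia. apply Z.pow_le_mono_l. lia. }
  set (A := 12 * k + 2 * kk + 4 * kw + (5 + 2 * k + 3 * w)).
  assert (HA : A = 12 * k + 2 * kk + 4 * kw + (5 + 2 * k + 3 * w)) by reflexivity. clearbody A.
  clearbody kk kw.
  assert (BNK : 0 <= N + K <= 2 ^ (A + 1)).
  { apply ple_add; [| |ex]; (eapply ple_mono; [eassumption|ex]). }
  assert (Bn : 0 <= n + 1 <= 2 ^ w) by lia.
  assert (BS1 : 0 <= (n + 1) * l * (N + K) <= 2 ^ (w + (5 + k + 2 * w) + (A + 1))).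
  { repeat apply ple_mul; try assumption; ex. }
  assert (BS2 : 0 <= 1 + (n + 1) * l * (N + K) <= 2 ^ (w + (5 + k + 2 * w) + (A + 1) + 1)).
  { apply ple_add; [|assumption|ex].
    pose proof (Z.pow_pos_nonneg 2 (w + (5 + k + 2 * w) + (A + 1)) ltac:(lia) ltac:(ex)) as Hpos.
    clear - Hpos. lia. }
  assert (BS3 : 0 <= (1 + (n + 1) * l * (N + K)) * (k + 1) <= 2 ^ (w + (5 + k + 2 * w) + (A + 1) + 1 + k)).
  { apply ple_mul; try assumption; ex. }
  assert (BS4 : 0 <= (1 + (n + 1) * l * (N + K)) * (k + 1) + (k + 1)
     <= 2 ^ (w + (5 + k + 2 * w) + (A + 1) + 1 + k + 1)).
  { apply ple_add; [assumption| |ex]. eapply ple_mono; [exact Bk1|ex]. }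
  assert (Bamx : 0 <= amx <= 2 ^ w) by (clear - Hamx; lia).
  assert (BZ1 : 0 <= 8 * (2 ^ l * amx) <= 2 ^ (3 + (5 + k + 2 * w + w))).
  { repeat apply ple_mul; try assumption; ex. }
  assert (BZ2 : 0 <= 8 * (2 ^ l * amx) + amx <= 2 ^ (3 + (5 + k + 2 * w + w) + 1)).
  { apply ple_add; [assumption| |ex]. apply (ple_mono amx w); [assumption|ex]. }
  assert (BZ3 : 0 <= k + K <= 2 ^ (12 * k + 2 * kk + 4 * kw + k + 1)).
  { apply ple_add; [| |ex]; (eapply ple_mono; [eassumption|ex]). }
  assert (BZ4 : 0 <= 8 * (2 ^ l * amx) + amx + (k + K) <= 2 ^ (12 * k + 2 * kk + 4 * kw + k + 9 + 3 * w + 1)).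
  { apply ple_add; [| |ex]; (eapply ple_mono; [eassumption|ex]). }
  assert (BZ5 : 0 <= 8 * (2 ^ l * amx) + amx + (k + K) + 10 <= 2 ^ (12 * k + 2 * kk + 4 * kw + k + 10 + 3 * w + 1)).
  { apply ple_add; [|apply (ple_mono 10 4); [cbn; lia|ex]|ex]. eapply ple_mono; [exact BZ4|ex]. }
  assert (BC1 : 0 <= 128 * n <= 2 ^ (7 + w)) by (apply ple_mul; [cbn; lia|lia|lia|lia]).
  assert (BC2 : 0 <= 128 * n + 2000 <= 2 ^ (11 + w + 1)).
  { apply ple_add; [eapply ple_mono; [exact BC1|ex]|apply (ple_mono 2000 11); [cbn; lia|ex]|ex]. }
  assert (BD1 : 0 <= 20 * k <= 2 ^ (5 + k)) by (apply ple_mul; try assumption; ex).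
  assert (BD2 : 0 <= (128 * n + 2000) + 20 * k <= 2 ^ (12 + k + w + 1)).
  { apply ple_add; [eapply ple_mono; [exact BC2|ex]|eapply ple_mono; [exact BD1|ex]|ex]. }
  pose proof (HY _ _ BD2 ltac:(ex)) as Y1. pose proof (HY _ _ BC2 ltac:(ex)) as Y2.
  pose proof (HY _ _ BE ltac:(ex)) as Y3. pose proof (HY _ _ Bl' ltac:(ex)) as Y4.
  pose proof (HY _ _ BN ltac:(ex)) as Y5. pose proof (HY _ _ BL ltac:(ex)) as Y6.
  pose proof (HY _ _ B2l ltac:(ex)) as Y7. pose proof (HY _ _ BZ5 ltac:(ex)) as Y8.
  pose proof (HY _ _ BS4 ltac:(ex)) as Y9. pose proof (HY _ _ Bamx ltac:(ex)) as Y10.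
  assert (Bq : 0 <= q <= 2 ^ w) by (clear - Hpq Hqw; lia).
  pose proof (HY _ _ Bq ltac:(ex)) as Y11.
  split; [clear - Y1 Hn; lia|]. do 8 (split; [assumption|]).
  split; [clear - Y8; lia|clear - Y9; lia].
Qed.
End Bounds.

(** * Running time *)

Section Time.
Variables (n k p q : Z).
Hypothesis Hn : 0 <= n.
Hypothesis Hk : 2 <= k.
Hypothesis Hpq : 0 < p < q.
Notation E := (cE p q).
Notation l := (cl k p q).
Notation N := (cN k p q).
Notation L := (cL k p q).
Notation K := (KK k L).

Definition cticks : Z := 10 * k * k + 100 * k + 200.

(** For each of [n + 1] values of [h] and [l] scales, the table is swept [N] times over [K] nodes.
    Scoring visits [K] nodes and may trace up to [N] elements from each, which is of the same
    order. *)
Lemma ticks_le : tP n k p q <= cticks * ((n + 1) * (l * N * K)).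
Proof.
  pose proof (E_bounds p q Hpq) as [BE1 BE2]. pose proof (l_spec k p q Hpq Hk) as (Bl1 & _ & _).
  pose proof (N_bounds k p q Hpq Hk) as [BN1 BN2]. pose proof (K_bounds k p q Hpq Hk) as BK.
  set (X := N * K). assert (HX : 1 <= X) by (unfold X; nia).
  assert (HXN : N <= X) by (unfold X; nia). assert (HXK : K <= X) by (unfold X; nia).
  set (c1 := 3 * k * k + 16 * k + 6).
  assert (Hc1 : 0 <= c1) by (unfold c1; nia).
  assert (HtE : tE k L = 4 + K * (c1 + 1)) by (unfold tE, tC, tJ, c1; ring).
  assert (HtD : tD k N L <= (c1 + 10) * X).
  { unfold tD. rewrite HtE.
    replace (4 + N * (4 + K * (c1 + 1) + 1)) with (4 + 5 * N + (c1 + 1) * X) by (unfold X; ring). lia. }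
  assert (HtL : tL k N L <= (17 * k + 26) * X).
  { unfold tL, tV. replace (2 + K * (17 * k + 3 * N + 20 + 1)) with (2 + (17 * k + 21) * K + 3 * X) by (unfold X; ring).
    assert ((17 * k + 21) * K <= (17 * k + 21) * X) by (apply Z.mul_le_mono_nonneg_l; lia). lia. }
  set (c2 := c1 + 17 * k + 38).
  assert (HtT : tT k N L <= c2 * X) by (unfold tT, c2; lia).
  assert (Hc2 : 0 <= c2) by (unfold c2; lia).
  assert (HlX : 1 <= l * X) by nia.
  assert (HtH : tH k l N L <= (c2 + 10) * (l * X)).
  { unfold tH. assert (l * tT k N L <= l * (c2 * X)) by (apply Z.mul_le_mono_nonneg_l; lia).
    assert (l * 1 <= l * X) by (apply Z.mul_le_mono_nonneg_l; lia). lia. }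
  assert (Hll : l <= l * X) by (assert (l * 1 <= l * X) by (apply Z.mul_le_mono_nonneg_l; lia); lia).
  set (W := (n + 1) * (l * X)).
  assert (HW : l * X <= W /\ n + 1 <= W).
  { unfold W. split.
    - rewrite <- (Z.mul_1_l (l * X)) at 1. apply Z.mul_le_mono_nonneg_r; lia.
    - rewrite <- (Z.mul_1_r (n + 1)) at 1. apply Z.mul_le_mono_nonneg_l; lia. }
  assert (HtM : tM n k l N L <= (c2 + 13) * W).
  { unfold tM. assert ((n + 1) * tH k l N L <= (n + 1) * ((c2 + 10) * (l * X))) by (apply Z.mul_le_mono_nonneg_l; lia).
    unfold W in *. lia. }
  assert (HkW : k * 1 <= k * W) by (apply Z.mul_le_mono_nonneg_l; lia).
  replace ((n + 1) * (l * N * K)) with W by (unfold W, X; ring).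
  unfold tP, tI, tF.
  assert (30 + 3 * l + 3 * k + 4 * n + (2 + 9 * n) <= (60 + 3 * k) * W) by lia.
  assert (c2 + 13 + 60 + 3 * k <= cticks) by (unfold cticks, c2, c1; clear - Hk; nia).
  assert ((c2 + 13 + 60 + 3 * k) * W <= cticks * W) by (apply Z.mul_le_mono_nonneg_r; lia). lia.
Qed.

Definition clog : Z := Z.log2_up (20 * k) + 2.

(** [l] is at most [log2_up (20 * k) + 2 * log2_up E], and [log2_up E = log2 (q / p) + 1]. *)
Lemma l_le : l <= clog * (Z.log2 (q / p) + 2).
Proof.
  assert (H1 : 1 <= q / p) by (apply Z.div_le_lower_bound; lia).
  assert (HE : Z.log2_up E = Z.log2 (q / p) + 1).
  { unfold cE. rewrite Z.log2_up_eqn by lia. replace (Z.pred (q / p + 1)) with (q / p) by lia. lia. }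
  unfold cl. assert (HEp : 0 < E) by (unfold cE; lia).
  pose proof (Z.log2_up_mul_above (20 * k * E) E ltac:(nia) ltac:(lia)).
  pose proof (Z.log2_up_mul_above (20 * k) E ltac:(nia) ltac:(lia)).
  pose proof (Z.log2_nonneg (q / p)). pose proof (Z.log2_up_nonneg (20 * k)).
  unfold clog. nia.
Qed.

Definition cpoly : Z := k * (41 * k) ^ k * clog ^ (k + 2) * 2 ^ (3 * k - 1).

(** [K] is of order [(l * E^2)^k] and [N] of order [l * E], giving [E^(2*k+1)] and [l^(k+2)]. *)
Lemma lNK_le : l * N * K * p ^ (3 * k - 1)
  <= cpoly * (q ^ (3 * k - 1) * (Z.log2 (q / p) + 2) ^ (k + 2)).
Proof.
  pose proof (E_bounds p q Hpq) as [BE1 BE2]. pose proof (l_spec k p q Hpq Hk) as (Bl1 & _ & _).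
  pose proof (N_bounds k p q Hpq Hk) as [BN1 BN2]. pose proof (K_bounds k p q Hpq Hk) as BK.
  pose proof (L_bounds k p q Hpq Hk) as [BL1 BL2].
  assert (HK : K <= (41 * k) ^ k * l ^ k * E ^ (2 * k)).
  { rewrite Z.pow_mul_r, <- !Z.pow_mul_l by lia. unfold KK. apply Z.pow_le_mono_l. split; [lia|].
    rewrite Z.pow_2_r. unfold cL, cN in *. nia. }
  set (lg := Z.log2 (q / p) + 2). set (e := 3 * k - 1).
  assert (Hlg : 0 <= lg) by (pose proof (Z.log2_nonneg (q / p)); unfold lg; lia).
  assert (H1 : l * N * K <= k * (41 * k) ^ k * l ^ (k + 2) * E ^ (2 * k + 1)).
  { assert (l * N * K <= l * N * ((41 * k) ^ k * l ^ k * E ^ (2 * k))) by (apply Z.mul_le_mono_nonneg_l; nia).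
    rewrite !Z.pow_add_r, Z.pow_1_r, Z.pow_2_r by lia. unfold cN in *. lia. }
  assert (H2 : l ^ (k + 2) <= clog ^ (k + 2) * lg ^ (k + 2)).
  { rewrite <- Z.pow_mul_l. apply Z.pow_le_mono_l. split; [lia|]. apply l_le. }
  (* Here [k >= 2] enters, as [2*k + 1 <= 3*k - 1]; moreover [E * p <= q + p <= 2 * q]. *)
  assert (H3 : E ^ (2 * k + 1) * p ^ e <= 2 ^ e * q ^ e).
  { rewrite <- Z.pow_mul_l. transitivity ((E * p) ^ e).
    - rewrite Z.pow_mul_l. apply Z.mul_le_mono_nonneg_r; [apply Z.pow_nonneg; lia|].
      apply Z.pow_le_mono_r; unfold e; lia.
    - apply Z.pow_le_mono_l. split; [lia|]. unfold cE.
      pose proof (Z.div_mod q p ltac:(lia)). pose proof (Z.mod_pos_bound q p ltac:(lia)). lia. }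
  assert (P0 : 0 <= (41 * k) ^ k) by (apply Z.pow_nonneg; clear - Hk; lia).
  assert (P1 : 0 <= p ^ e) by (apply Z.pow_nonneg; lia).
  assert (P2 : 0 <= E ^ (2 * k + 1)) by (apply Z.pow_nonneg; lia).
  assert (P3 : 0 <= l ^ (k + 2)) by (apply Z.pow_nonneg; lia).
  assert (P4 : 0 <= k * (41 * k) ^ k) by (apply Z.mul_nonneg_nonneg; lia).
  transitivity (k * (41 * k) ^ k * l ^ (k + 2) * (E ^ (2 * k + 1) * p ^ e)).
  { rewrite Z.mul_assoc. now apply Z.mul_le_mono_nonneg_r. }
  transitivity (k * (41 * k) ^ k * l ^ (k + 2) * (2 ^ e * q ^ e)).
  { apply Z.mul_le_mono_nonneg_l; [now apply Z.mul_nonneg_nonneg|easy]. }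
  transitivity (k * (41 * k) ^ k * (clog ^ (k + 2) * lg ^ (k + 2)) * (2 ^ e * q ^ e)).
  { apply Z.mul_le_mono_nonneg_r; [apply Z.mul_nonneg_nonneg; apply Z.pow_nonneg; clear - Hpq; lia|].
    now apply Z.mul_le_mono_nonneg_l. }
  unfold cpoly. fold e. apply Z.eq_le_incl. ring.
Qed.
End Time.

(** * The approximation ratio *)

Lemma fold_max_spec d l : (forall x, In x (d :: l) -> x <= fold_right Z.max d l) /\
  In (fold_right Z.max d l) (d :: l).
Proof.
  induction l as [|y l [IH1 IH2]]; cbn [fold_right].
  - split; [intros x [->|[]]; lia|now left].
  - split.
    + intros x [->|[->|Hx]]; [specialize (IH1 x (or_introl eq_refl))| |specialize (IH1 x (or_intror Hx))]; lia.
    + destruct (Z.max_spec y (fold_right Z.max d l)) as [[_ ->]|[_ ->]]; [|right; now left].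
      destruct IH2 as [<-|]; [now left|right; now right].
Qed.

Lemma fold_min_spec d l : (forall x, In x (d :: l) -> fold_right Z.min d l <= x) /\
  In (fold_right Z.min d l) (d :: l).
Proof.
  induction l as [|y l [IH1 IH2]]; cbn [fold_right].
  - split; [intros x [->|[]]; lia|now left].
  - split.
    + intros x [->|[->|Hx]]; [specialize (IH1 x (or_introl eq_refl))| |specialize (IH1 x (or_intror Hx))]; lia.
    + destruct (Z.min_spec y (fold_right Z.min d l)) as [[_ ->]|[_ ->]]; [right; now left|].
      destruct IH2 as [<-|]; [now left|right; now right].
Qed.

Section Ratio.
Variables (k : nat) (A : list Z).
Hypothesis Hk : (2 <= k)%nat.

Lemma sums_hd S : hd 0 (sums k A S) = subset_sum A (S 0%nat).
Proof. unfold sums. destruct k; [lia|easy]. Qed.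

Lemma sums_In S x : In x (sums k A S) <-> exists j, (j < k)%nat /\ subset_sum A (S j) = x.
Proof.
  unfold sums. rewrite in_map_iff. split; intros (j & H1 & H2); exists j.
  - apply in_seq in H2. split; [lia|easy].
  - split; [easy|apply in_seq; lia].
Qed.

Lemma hd_sums_In S x : In x (hd 0 (sums k A S) :: sums k A S) <-> In x (sums k A S).
Proof.
  split; [|now right]. intros [<-|H]; [|easy]. rewrite sums_hd. apply sums_In.
  exists 0%nat. split; [lia|easy].
Qed.

Lemma min_max_sum S j : (j < k)%nat -> min_sum k A S <= subset_sum A (S j) <= max_sum k A S.
Proof.
  intros Hj. unfold min_sum, max_sum. split.
  - apply fold_min_spec, hd_sums_In, sums_In. now exists j.
  - apply fold_max_spec, hd_sums_In, sums_In. now exists j.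
Qed.

Lemma min_sum_attained S : exists j, (j < k)%nat /\ subset_sum A (S j) = min_sum k A S.
Proof. apply sums_In, hd_sums_In, fold_min_spec. Qed.

Lemma max_sum_attained S : exists j, (j < k)%nat /\ subset_sum A (S j) = max_sum k A S.
Proof. apply sums_In, hd_sums_In, fold_max_spec. Qed.
End Ratio.

Lemma ratio_Qle M m M' m' p q : 0 < m -> 0 < m' -> 0 < p -> 0 < q ->
  M * (q * m') <= (q + p) * M' * m ->
  (inject_Z M / inject_Z m <= (1 + inject_Z p / inject_Z q) * (inject_Z M' / inject_Z m'))%Q.
Proof.
  intros Hm Hm' Hp Hq H.
  assert (Qm : (0 < inject_Z m)%Q) by now rewrite <- (Zlt_Qlt 0).
  assert (Qm' : (0 < inject_Z m')%Q) by now rewrite <- (Zlt_Qlt 0).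
  assert (Qq : (0 < inject_Z q)%Q) by now rewrite <- (Zlt_Qlt 0).
  apply Qle_shift_div_r; [easy|].
  assert (E : ((1 + inject_Z p / inject_Z q) * (inject_Z M' / inject_Z m') * inject_Z m ==
    inject_Z ((q + p) * M' * m) / inject_Z (q * m'))%Q).
  { rewrite !inject_Z_mult, inject_Z_plus. field. split; intros Hx; rewrite Hx in *; now apply Qlt_irrefl in Qq || apply Qlt_irrefl in Qm'. }
  rewrite E. apply Qle_shift_div_l.
  - rewrite <- (Zlt_Qlt 0). now apply Z.mul_pos_pos.
  - rewrite <- inject_Z_mult, <- Zle_Qle. exact H.
Qed.

(** Total and 1-based; the value 0 outside the input makes nonexistent singletons lose every
    comparison. *)
Definition shift (A : list Z) (x : Z) : Z := if 1 <=? x then nth (Z.to_nat (x - 1)) A 0 else 0.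

Section Shift.
Variable A : list Z.
Hypothesis Hs : Sorted Z.le A.
Hypothesis Hpos : Forall (fun a => 0 < a) A.
Notation n := (Z.of_nat (length A)).

Lemma shift_pos x : 1 <= x <= n -> 0 < shift A x.
Proof.
  intros Hx. unfold shift. replace (1 <=? x) with true by lia.
  rewrite Forall_forall in Hpos. apply Hpos, nth_In. lia.
Qed.

Lemma shift_out x : n < x -> shift A x = 0.
Proof.
  intros Hx. unfold shift. destruct (1 <=? x); [|easy]. apply nth_overflow. lia.
Qed.

Lemma shift_neg x : x < 1 -> shift A x = 0.
Proof. intros Hx. unfold shift. now replace (1 <=? x) with false by lia. Qed.

Lemma nth_mono l i j : StronglySorted Z.le l -> (i <= j < length l)%nat -> nth i l 0 <= nth j l 0.
Proof.
  intros H. revert i j. induction H as [|y l Hl IH Hy]; intros i j Hij; [cbn in Hij; lia|].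
  rewrite Forall_forall in Hy. destruct j as [|j]; [replace i with O by lia; lia|].
  cbn in Hij. destruct i as [|i]; cbn [nth].
  - apply Hy, nth_In. lia.
  - apply IH. lia.
Qed.

Lemma shift_mono x y : 1 <= x <= y -> y <= n -> shift A x <= shift A y.
Proof.
  intros Hx Hy. unfold shift. replace (1 <=? x) with true by lia. replace (1 <=? y) with true by lia.
  apply nth_mono; [|lia]. apply Sorted_StronglySorted; [|easy]. intros u v t. apply Z.le_trans.
Qed.

Lemma subset_sum_lsum Sj g j : (forall i, (i < length A)%nat -> Sj i = (g (Z.of_nat i + 1) =? j + 1)) ->
  subset_sum A Sj = lsum (shift A) g j (n + 1).
Proof.
  intros H. unfold subset_sum, lsum, zs. replace (Z.to_nat (n + 1)) with (S (length A)) by lia.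
  set (F := fun x => if g x =? j + 1 then shift A x else 0).
  assert (HF : forall m, fold_right Z.add 0 (map (fun i => F (Z.of_nat i + 1)) (seq 0 m)) = zsn F (S m)).
  { induction m as [|m IH].
    - cbn. unfold F. rewrite shift_neg by lia. now destruct (_ =? _).
    - rewrite seq_S, map_app, fold_right_app. cbn [map fold_right].
      assert (Happ : forall l c, fold_right Z.add c l = fold_right Z.add 0 l + c).
      { clear. intros l c. induction l as [|y l IH]; cbn; lia. }
      rewrite Happ, IH. cbn [zsn]. rewrite Nat.add_0_l. replace (Z.of_nat (S m)) with (Z.of_nat m + 1) by lia. lia. }
  rewrite <- HF. f_equal. apply map_ext_in. intros i Hi. apply in_seq in Hi.
  unfold F. rewrite H by lia. destruct (_ =? _); [|easy].
  unfold shift. replace (1 <=? Z.of_nat i + 1) with true by lia. f_equal. lia.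
Qed.
End Shift.

(** Taking the first set that contains the element loses nothing, because disjoint sets leave no
    choice. *)
Definition labels (k : nat) (S : nat -> nat -> bool) (x : Z) : Z :=
  match find (fun j => S j (Z.to_nat (x - 1))) (seq 0 k) with
  | Some j => Z.of_nat j + 1
  | None => 0
  end.

Lemma labels_spec k m S : pairwise_disjoint k m S -> forall i j, (i < m)%nat -> (j < k)%nat ->
  S j i = (labels k S (Z.of_nat i + 1) =? Z.of_nat j + 1).
Proof.
  intros HD i j Hi Hj. unfold labels. replace (Z.to_nat (Z.of_nat i + 1 - 1)) with i by lia.
  destruct (find _ _) as [j'|] eqn:Hf.
  - apply find_some in Hf. destruct Hf as [Hin Hj']. apply in_seq in Hin.
    destruct (Z.eqb_spec (Z.of_nat j' + 1) (Z.of_nat j + 1)).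
    + now replace j with j' by lia.
    + destruct (HD j j' i) as [H|H]; try lia; [easy|congruence].
  - pose proof (find_none _ _ Hf j) as H. cbn in H. rewrite H by (apply in_seq; lia).
    destruct (Z.eqb_spec 0 (Z.of_nat j + 1)); [lia|easy].
Qed.

Section Correct.
Variables (k : nat) (A : list Z) (p q : Z).
Hypothesis Hk : (2 <= k)%nat.
Hypothesis Hs : Sorted Z.le A.
Hypothesis Hpos : Forall (fun a => 0 < a) A.
Hypothesis Hpq : 0 < p < q.
Notation n := (Z.of_nat (length A)).
Notation kz := (Z.of_nat k).
Hypothesis Hn : 1 <= n.

(** A competitor [T] with extreme sums [mT] and [MT] yields a candidate with bound
    [U / V = (1 + eps) * MT / mT], which the recorded [M / m] respects. The actual ratio of the
    output is at most [M / m]. *)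
Lemma approx_of_labels S g M m : 1 <= M -> 0 <= m ->
  (forall i j, (i < length A)%nat -> S j i = (g (Z.of_nat i + 1) =? Z.of_nat j + 1)) ->
  (m = 0 \/ forall j, 0 <= j < kz -> m <= lsum (shift A) g j (n + 1) <= M) ->
  (forall h t U V, 0 <= h <= n -> 0 <= t < cl kz p q -> 0 < V ->
     HasCand (shift A) kz (cN kz p q) (cL kz p q) h t U V -> M * V <= U * m) ->
  approx_solution k A p q S.
Proof.
  intros HM Hm HS Hsum Hc. split.
  - intros j1 j2 i H1 H2 Hne Hi. rewrite !HS by easy.
    destruct (Z.eqb_spec (g (Z.of_nat i + 1)) (Z.of_nat j1 + 1)); [right|now left].
    apply Z.eqb_neq. lia.
  - intros T HT. unfold ratio at 2. destruct (Z.ltb_spec 0 (min_sum k A T)) as [HmT|]; [|exact I].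
    set (mT := min_sum k A T) in *. set (MT := max_sum k A T) in *.
    pose proof (E_bounds p q Hpq) as [BE1 BE2]. pose proof (l_spec kz p q Hpq ltac:(lia)) as (Bl1 & Bl2 & _).
    destruct (cand_exists (shift A) n kz p q (cE p q) (cl kz p q) (cN kz p q) (cL kz p q))
      with (g := labels k T) (M := MT) (m := mT) as (h & t & Hh & Ht & Hcand); try easy; try lia.
    + intros i Hi. now apply shift_pos.
    + intros i i' Hi Hi'. now apply shift_mono.
    + intros i Hi. now apply shift_out.
    + intros j Hj. rewrite <- (subset_sum_lsum A (T (Z.to_nat j))).
      * apply min_max_sum; lia.
      * intros i Hi. rewrite (labels_spec k _ T HT) by lia. now rewrite Z2Nat.id by lia.
    + assert (Hqm : 0 < q * mT) by (apply Z.mul_pos_pos; lia).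
      specialize (Hc h t _ _ Hh Ht Hqm Hcand).
      assert (HMT : 0 < MT).
      { pose proof (min_max_sum k A Hk T 0 ltac:(lia)). lia. }
      (* With [m = 0] the bound would read [M * V <= 0]; so as soon as a competitor of finite ratio
         exists, something has been recorded. *)
      assert (Hm0 : 0 < m).
      { destruct (Z.eq_dec m 0) as [->|]; [|lia]. assert (0 < M * (q * mT)) by (apply Z.mul_pos_pos; lia). lia. }
      destruct Hsum as [|Hsum]; [lia|].
      assert (HSj : forall j, (j < k)%nat -> m <= subset_sum A (S j) <= M).
      { intros j Hj. rewrite (subset_sum_lsum A (S j) g (Z.of_nat j)) by (intros; now apply HS).
        apply Hsum. lia. }
      destruct (min_sum_attained k A Hk S) as (j1 & Hj1 & E1).
      destruct (max_sum_attained k A Hk S) as (j2 & Hj2 & E2).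
      pose proof (HSj j1 Hj1) as B1. pose proof (HSj j2 Hj2) as B2.
      unfold ratio, ext_le_scaled. replace (0 <? min_sum k A S) with true by lia.
      apply ratio_Qle; try lia.
      transitivity (M * (q * mT)); [apply Z.mul_le_mono_nonneg_r; lia|].
      transitivity ((q + p) * MT * m); [exact Hc|].
      apply Z.mul_le_mono_nonneg_l; [|lia]. apply Z.mul_nonneg_nonneg; lia.
Qed.
End Correct.

Lemma wf_PROG Y k : 2 <= k -> 1000 <= Y -> 20 * k <= Y -> wfc Y (PROG k).
Proof.
  intros Hk HY HkY. unfold maxdg. cbn [wfc PROG INIT MAIN FINAL HBODY TBODY ELOOP VBODY RECORD FILL TRACE SCORE
    DPROG EBODY CBODY JLOOP JBODY INSERT COPY bkE wfe dg Nat.max Nat.add].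
  unfold nV, nA, zR, maxdg. repeat split; try lia.
Qed.

(** * Runs of the complete program *)

Section Run.
Variables (k : nat) (A : list Z) (p q : Z).
Hypothesis Hk : (2 <= k)%nat.
Hypothesis Hs : Sorted Z.le A.
Hypothesis Hpos : Forall (fun a => 0 < a) A.
Hypothesis Hpq : 0 < p < q.
Notation n := (Z.of_nat (length A)).
Notation kz := (Z.of_nat k).

Definition wX : Z := fold_right Z.max (Z.max n q) A.
Notation w := (word_size A q).
Notation Y := (Yb kz w).
(** The factor 40 is [maxdg]: intermediate results are at most [Y ^ 40]. *)
Definition kap : Z := (40 * alpha kz + 1) * (40 * alpha kz + 1).
Definition Bb : Z := 2 ^ (40 * alpha kz * w).

Lemma wX_spec : 2 <= wX /\ n <= wX /\ q <= wX /\ forall x, shift A x <= wX.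
Proof.
  destruct (fold_max_spec (Z.max n q) A) as [H _]. fold wX in H.
  pose proof (H _ (or_introl eq_refl)). split; [lia|]. split; [lia|]. split; [lia|].
  intros x. unfold shift. destruct (1 <=? x); [|lia].
  destruct (nth_in_or_default (Z.to_nat (x - 1)) A 0) as [Hin|Hd].
  - apply H. now right.
  - rewrite Hd. lia.
Qed.

Lemma w_spec : 1 <= w /\ forall x, x <= wX -> x < 2 ^ w.
Proof.
  destruct wX_spec as [H _]. unfold word_size, bits. fold wX. rewrite Z.abs_eq by lia.
  pose proof (Z.log2_nonneg wX). split; [lia|]. intros x Hx.
  pose proof (Z.log2_spec wX ltac:(lia)). rewrite Z.add_1_r. lia.
Qed.

Lemma alpha_pos : 32 <= alpha kz.
Proof. unfold alpha. pose proof (Z.square_nonneg kz). lia. Qed.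

Lemma Bb_pow d : (d <= maxdg)%nat -> Y ^ Z.of_nat d <= Bb.
Proof.
  intros Hd. pose proof w_spec as [Hw _]. pose proof alpha_pos.
  unfold Yb, Bb. rewrite <- Z.pow_mul_r by nia.
  apply Z.pow_le_mono_r; [lia|]. unfold maxdg in Hd.
  assert (0 <= alpha kz * w) by (apply Z.mul_nonneg_nonneg; lia).
  assert (alpha kz * w * Z.of_nat d <= alpha kz * w * 40) by (apply Z.mul_le_mono_nonneg_l; lia). lia.
Qed.

Lemma kap_spec vs : Forall (fun v => Z.abs v <= Bb) vs -> op_cost w vs <= kap.
Proof.
  pose proof w_spec as [Hw _]. pose proof alpha_pos. unfold kap, Bb. now apply op_cost_le; [|lia].
Qed.

Lemma init_mem x : mem (init_state A p q) x = match x with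
  | O => n | 1%nat => p | 2%nat => q | _ => shift A (Z.of_nat x - 2) end.
Proof.
  destruct x as [|[|[|i]]]; cbn [init_state mem]; try reflexivity.
  unfold shift. destruct (Z.leb_spec 1 (Z.of_nat (S (S (S i))) - 2)) as [H|H]; [|lia].
  replace (Z.to_nat (Z.of_nat (S (S (S i))) - 2 - 1)) with i by lia. reflexivity.
Qed.

Definition Ctot : Z := kap * (251 + Z.of_nat (clen (PROG kz)) * cticks kz).
Definition Cmain : Z := Ctot * cpoly kz.

Lemma run_pos : 1 <= n -> exists m pcf g M mn,
  reach w (full kz) (init_state A p q) (mkState pcf m)
    (Ctot * ((n + 1) * (cl kz p q * cN kz p q * KK kz (cL kz p q)))) /\
  step w (full kz) (mkState pcf m) = None /\
  1 <= M /\ 0 <= mn /\ (forall x, 1 <= x <= n -> m (Z.to_nat (n + 2 + x)) = g x) /\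
  (mn = 0 \/ forall j, 0 <= j < kz -> mn <= lsum (shift A) g j (n + 1) <= M) /\
  (forall h t U V, 0 <= h <= n -> 0 <= t < cl kz p q -> 0 < V ->
     HasCand (shift A) kz (cN kz p q) (cL kz p q) h t U V -> M * V <= U * mn).
Proof.
  intros Hn. destruct wX_spec as (X1 & X2 & X3 & X4). destruct w_spec as [Hw1 Hw2].
  pose proof alpha_pos as Hal.
  destruct (sizes n kz p q w wX) as (Y1 & Y2 & Y3 & Y4 & Y5 & Y6 & Y7 & Y8 & Y9 & Y10 & Y11);
    try lia; try (split; [lia|apply Hw2; lia]); try (apply Hw2; lia).
  pose proof kap_spec as Hkap. pose proof Bb_pow as HBp.
  assert (HY3 : 1000 * Y <= Bb).
  { specialize (HBp 2%nat ltac:(unfold maxdg; lia)). change (Z.of_nat 2) with 2 in HBp.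
    rewrite Z.pow_2_r in HBp. assert (1000 * Y <= Y * Y) by (apply Z.mul_le_mono_nonneg_r; lia). lia. }
  assert (Hmem : forall x, Z.abs (mem (init_state A p q) x) <= Y).
  { intros x. rewrite init_mem. destruct x as [|[|[|i]]]; try lia.
    specialize (X4 (Z.of_nat (S (S (S i))) - 2)). set (y := Z.of_nat (S (S (S i))) - 2) in *.
    assert (0 <= shift A y).
    { destruct (Z_lt_le_dec y 1); [rewrite shift_neg; lia|].
      destruct (Z_lt_le_dec n y); [rewrite shift_out; lia|]. pose proof (shift_pos A Hpos y). lia. }
    lia. }
  assert (C0 : code_at (full kz) 0 prologue).
  { exists [], (cc 132 (PROG kz) ++ epilogue). split; reflexivity. }
  assert (C1 : code_at (full kz) 132 (cc 132 (PROG kz))).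
  { exists prologue, epilogue. split; reflexivity. }
  assert (C2 : code_at (full kz) (132 + clen (PROG kz)) epilogue).
  { exists (prologue ++ cc 132 (PROG kz)), []. rewrite app_nil_r, <- app_assoc. split; [reflexivity|].
    rewrite length_app, length_cc. reflexivity. }
  destruct (prologue_ok w (full kz) Y Bb kap ltac:(lia) ltac:(lia) Hkap n (mem (init_state A p q)) C0 Hn
    eq_refl Hmem ltac:(lia)) as (m1 & R1 & E0 & E1 & E2 & E3 & E4 & E5 & E6).
  set (base := 128 * n - 8) in *.
  set (s0 := mkSt (fun x => m1 (S x)) (fun b i => m1 (Z.to_nat (base + zA * i + Z.of_nat b)))
     (fun i => m1 (Z.to_nat i))).
  assert (HRel : Rel base s0 m1) by (unfold Rel, s0; cbn; easy).
  assert (Hbs : bs Y base s0) by (unfold bs, s0; cbn; repeat split; intros; apply E6).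
  assert (Hsz : forall x, 3 <= x -> mem (init_state A p q) (Z.to_nat x) = shift A (x - 2)).
  { intros x Hx. rewrite init_mem. destruct (Z.to_nat x) as [|[|[|i]]] eqn:Hxx; try lia. f_equal. lia. }
  (* The input ends at cell [n + 2], so memory from [base] on is zero before relocation; hence the
     arrays other than [aA] start out as zero. *)
  assert (Hfar : forall x, 128 * n - 8 <= x -> mem (init_state A p q) (Z.to_nat x) = 0).
  { intros x Hx. rewrite Hsz by lia. apply shift_out. lia. }
  assert (Hinit : init_ok base (shift A) n p q s0).
  { unfold init_ok, s0. cbn [rg ar raw]. split; [now rewrite E1|]. split; [now rewrite E2|].
    split; [easy|]. unfold zR, zA in *. split; [|split].
    - intros i Hi. replace (base + 8 * i + Z.of_nat 0) with (128 * n + 8 * (i - 1)) by (unfold base; lia).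
      destruct (Z.eq_dec i 0) as [->|Hi0].
      + rewrite E5 by lia. rewrite Hfar by lia. now rewrite shift_neg by lia.
      + destruct (Z.ltb_spec i (61 - 2)).
        * replace (128 * n + 8 * (i - 1)) with (128 * n + 8 * Z.of_nat (Z.to_nat (i - 1))) by lia.
          rewrite E4 by lia. replace (3 + Z.to_nat (i - 1))%nat with (Z.to_nat (i + 2)) by lia.
          rewrite Hsz by lia. f_equal. lia.
        * rewrite E5 by lia. apply Hfar. lia.
    - intros b i Hb Hi. rewrite E5 by (unfold base; lia). apply Hfar. unfold base. lia.
    - intros i Hi. rewrite E5 by (unfold base in *; lia). apply Hsz. lia. }
  pose proof (PROG_ok Y base (shift A) n kz p q Hn ltac:(lia) Hpq (shift_neg A 0 ltac:(lia))
    (shift_pos A Hpos) (shift_out A) (fun x Hx => shift_neg A x ltac:(lia)) wX X4 Y1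
    ltac:(unfold zR, base; lia) Y3 Y4 Y5 Y6 Y7 Y10 Y11 s0 Hinit) as HT.
  destruct HT as (s1 & u & Hex & Hu & g & M & mn & P1 & P2 & P3 & P4 & P5).
  assert (Hwf : wfc Y (PROG kz)) by (apply wf_PROG; lia).
  destruct (sim_c w (full kz) Y base Bb kap ltac:(lia) ltac:(unfold zR, base; lia) HBp Hkap
    (clen (PROG kz)) _ _ _ _ Hex 132 m1 C1 Hwf Hbs HRel (le_n _)) as (m2 & R2 & HRel2 & Hbs2).
  assert (Hb0 : m2 O = base) by apply HRel2.
  assert (HFIN : forall c, (3 <= c)%nat ->
    m2 (Z.to_nat (base + 8 * Z.of_nat c + 6)) = ar s1 aFIN (Z.of_nat c)).
  { intros c Hc. destruct HRel2 as (_ & _ & HRa & _). apply (HRa aFIN); unfold nA; lia. }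
  destruct (epilogue_ok w (full kz) Y Bb kap ltac:(lia) ltac:(lia) Hkap base _ m2 C2 Hb0
    ltac:(unfold base; lia) ltac:(unfold base; lia)) as (m3 & R3 & Hhalt & F1 & F2).
  { intros c Hc. rewrite HFIN by lia. destruct Hbs2 as (_ & Hba & _).
    specialize (Hba aFIN (Z.of_nat c) ltac:(unfold nA; lia) ltac:(lia)). lia. }
  exists m3, (132 + clen (PROG kz) + 119)%nat, g, M, mn.
  split; [|split; [|split; [easy|split; [easy|split; [|split; [exact P4|exact P5]]]]]].
  - replace (init_state A p q) with (mkState 0 (mem (init_state A p q))) by reflexivity.
    eapply reach_trans; [exact R1|eapply reach_trans; [exact R2|exact R3|apply Z.le_refl]|].
    pose proof (ticks_le n kz p q ltac:(lia) ltac:(lia) Hpq) as Htk.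
    set (W := (n + 1) * (cl kz p q * cN kz p q * KK kz (cL kz p q))) in *.
    assert (HW : 1 <= W).
    { pose proof (l_spec kz p q Hpq ltac:(lia)) as (B1 & _). pose proof (N_bounds kz p q Hpq ltac:(lia)) as [B2 _].
      pose proof (K_bounds kz p q Hpq ltac:(lia)) as B3. unfold W. clear - B1 B2 B3 Hn.
      assert (1 <= cl kz p q * cN kz p q) by nia.
      assert (1 <= cl kz p q * cN kz p q * KK kz (cL kz p q)) by nia. nia. }
    pose proof (kap_pos w Bb kap Hkap) as Hkp.
    set (Lam := Z.of_nat (clen (PROG kz))) in *. assert (HLam : 0 <= Lam) by (unfold Lam; lia).
    assert (K1 : u * (Lam * kap) <= cticks kz * W * (Lam * kap)).
    { apply Z.mul_le_mono_nonneg_r; [apply Z.mul_nonneg_nonneg; lia|lia]. }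
    assert (K2 : 251 * kap * 1 <= 251 * kap * W) by (apply Z.mul_le_mono_nonneg_l; lia).
    unfold Ctot. fold Lam. lia.
  - unfold step. cbn [pc]. now rewrite Hhalt.
  - intros x Hx. destruct (P3 x Hx) as [Q1 Q2].
    (* Low output cells are filled from [aFIN] by the epilogue; the others were written directly and
       the epilogue leaves them alone. *)
    destruct (Z_lt_le_dec (n + 2 + x) zR) as [Hlt|Hge]; unfold zR in *.
    + rewrite F1, HFIN by lia. rewrite Z2Nat.id by lia. exact Q1.
    + rewrite F2 by lia. destruct HRel2 as (_ & _ & _ & HRr).
      rewrite HRr by (unfold zR, base; lia). now apply Q2.
Qed.

Lemma run_zero : n = 0 -> exists m,
  reach w (full kz) (init_state A p q) (mkState 10 m) (132 * kap) /\
  step w (full kz) (mkState 10 m) = None.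
Proof.
  intros Hn. pose proof kap_spec as Hkap. pose proof Bb_pow as HBp.
  assert (HB : 1000 * 1000 <= Bb).
  { destruct w_spec as [Hw _]. pose proof alpha_pos. unfold Bb. transitivity (2 ^ 20); [cbn; lia|].
    apply Z.pow_le_mono_r; [lia|nia]. }
  assert (C0 : code_at (full kz) 0 prologue).
  { exists [], (cc 132 (PROG kz) ++ epilogue). split; reflexivity. }
  destruct (prologue_0 w (full kz) 1000 Bb kap ltac:(lia) ltac:(lia) Hkap (mem (init_state A p q)) C0)
    as (m & R & Hh).
  - exact Hn.
  - rewrite init_mem. apply shift_out. lia.
  - exists m. split; [exact R|]. unfold step. cbn [pc]. now rewrite Hh.
Qed.

Lemma consts_pos : 0 < kap /\ 132 * kap <= Ctot /\ 1 <= cpoly kz.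
Proof.
  pose proof alpha_pos. assert (Hkp : 0 < kap) by (unfold kap; nia).
  assert (0 <= cticks kz) by (unfold cticks; pose proof (Z.square_nonneg kz); lia). split; [easy|]. split.
  - unfold Ctot. assert (0 <= Z.of_nat (clen (PROG kz)) * cticks kz) by (apply Z.mul_nonneg_nonneg; lia). nia.
  - unfold cpoly, clog. pose proof (Z.log2_up_nonneg (20 * kz)).
    assert (Hpow : forall b e, 1 <= b -> 0 <= e -> 0 < b ^ e) by (intros; apply Z.pow_pos_nonneg; lia).
    assert (0 < kz * (41 * kz) ^ kz * (Z.log2_up (20 * kz) + 2) ^ (kz + 2) * 2 ^ (3 * kz - 1)); [|lia].
    repeat apply Z.mul_pos_pos; try apply Hpow; lia.
Qed.
End Run.

Theorem theorem28 (k : nat) (hk : (2 <= k)%nat) :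
  exists (prog : program) (C : Z) (c : nat),
    forall (A : list Z) (p q : Z),
      Sorted Z.le A ->
      Forall (fun a => 0 < a) A ->
      0 < p < q ->
      exists (fuel : nat) (fin : state) (cost : Z),
        run (word_size A q) prog fuel (init_state A p q) = Some (fin, cost) /\
        cost * p ^ Z.of_nat (3 * k - 1)
          <= C * (Z.of_nat (length A) + 1) * q ^ Z.of_nat (3 * k - 1)
               * (Z.log2 (q / p) + 2) ^ Z.of_nat c /\
        approx_solution k A p q (decode_output (length A) fin).
Proof.
  (* The logarithmic exponent counts factors [l]: one for the scales, one in the window [N], and [k]
     in the size of the table. *)
  exists (full (Z.of_nat k)), (Cmain k), (k + 2)%nat.
  intros A p q Hs Hpos Hpq.
  destruct (consts_pos k hk) as (Hkap & HCt & Hcp).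
  replace (Z.of_nat (3 * k - 1)) with (3 * Z.of_nat k - 1) by lia.
  replace (Z.of_nat (k + 2)) with (Z.of_nat k + 2) by lia.
  set (e := 3 * Z.of_nat k - 1). set (n := Z.of_nat (length A)). set (lg := Z.log2 (q / p) + 2).
  assert (Hlg : 1 <= lg) by (pose proof (Z.log2_nonneg (q / p)); unfold lg; lia).
  assert (Hpe : 0 < p ^ e) by (apply Z.pow_pos_nonneg; unfold e; lia).
  assert (Hlge : 0 < lg ^ (Z.of_nat k + 2)) by (apply Z.pow_pos_nonneg; lia).
  destruct (Z.eq_dec n 0) as [Hn|Hn].
  - destruct (run_zero k A p q hk Hpq Hn) as (m & (cost & Hstar & Hcost) & Hhalt).
    destruct (star_run _ _ _ _ _ Hstar Hhalt) as [fuel Hrun].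
    exists fuel, (mkState 10 m), cost. split; [exact Hrun|]. split.
    + rewrite Hn. assert (Hpq' : p ^ e <= q ^ e) by (apply Z.pow_le_mono_l; lia).
      transitivity (132 * kap k * p ^ e); [apply Z.mul_le_mono_nonneg_r; lia|].
      transitivity (132 * kap k * q ^ e); [apply Z.mul_le_mono_nonneg_l; lia|].
      assert (HC : 132 * kap k <= Cmain k).
      { unfold Cmain. assert (Ctot k * 1 <= Ctot k * cpoly (Z.of_nat k)) by (apply Z.mul_le_mono_nonneg_l; lia). lia. }
      transitivity (Cmain k * q ^ e); [apply Z.mul_le_mono_nonneg_r; lia|].
      assert (0 <= Cmain k * q ^ e) by (apply Z.mul_nonneg_nonneg; lia).
      replace (Cmain k * (0 + 1) * q ^ e) with (Cmain k * q ^ e) by ring.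
      rewrite <- (Z.mul_1_r (Cmain k * q ^ e)) at 1. apply Z.mul_le_mono_nonneg_l; lia.
    (* On the empty input every sum is 0, so all competitors have infinite ratio. *)
    + destruct A; [|unfold n in Hn; cbn in Hn; lia]. split.
      * intros j1 j2 i _ _ _ Hi. cbn in Hi. lia.
      * intros T _. unfold ratio at 2. destruct (Z.ltb_spec 0 (min_sum k [] T)) as [H|]; [|exact I].
        destruct (min_sum_attained k [] hk T) as (j & _ & Hj). cbn in Hj. lia.
  - destruct (run_pos k A p q hk Hpos Hpq ltac:(unfold n in *; lia))
      as (m & pcf & g & M & mn & (cost & Hstar & Hcost) & Hhalt & HM & Hmn & Hg & Hsum & Hcand).
    destruct (star_run _ _ _ _ _ Hstar Hhalt) as [fuel Hrun].
    exists fuel, (mkState pcf m), cost. split; [exact Hrun|]. split.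
    + fold n in Hcost. pose proof (lNK_le (Z.of_nat k) p q ltac:(lia) Hpq) as HlNK. fold e lg in HlNK.
      set (W := cl _ _ _ * _ * _) in *.
      transitivity (Ctot k * ((n + 1) * W) * p ^ e); [apply Z.mul_le_mono_nonneg_r; lia|].
      replace (Ctot k * ((n + 1) * W) * p ^ e) with (Ctot k * (n + 1) * (W * p ^ e)) by ring.
      transitivity (Ctot k * (n + 1) * (cpoly (Z.of_nat k) * (q ^ e * lg ^ (Z.of_nat k + 2)))).
      * apply Z.mul_le_mono_nonneg_l; [apply Z.mul_nonneg_nonneg; unfold n; lia|exact HlNK].
      * unfold Cmain. apply Z.eq_le_incl. ring.
    + eapply approx_of_labels; try eassumption; [unfold n in *; lia|].
      intros i j Hi. unfold decode_output. cbn [mem].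
      rewrite <- (Hg (Z.of_nat i + 1)) by lia.
      replace (Z.to_nat (Z.of_nat (length A) + 2 + (Z.of_nat i + 1))) with (3 + length A + i)%nat by lia.
      f_equal. lia.
Qed.
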